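(* Let $(\mathfrak g,\sigma)$ be a symmetric pair over $\mathbb K$, with decomposition $\mathfrak g=\mathfrak h\oplus\mathfrak q$, and let $\chi:\mathfrak h\to\operatorname{End}(V)$ be a representation of $\mathfrak h$ in a $\mathbb K$-module $V$. i) For $a\in\mathfrak g$, we have $\bar l_{\chi,a}=\Theta^a_{1,\chi}$. ii) For $a\in\mathfrak g$, we have $\alpha_a=\alpha^a_1$ and $\theta_a=\theta^a_1$.
   Context: Conventions. Everything is $\mathbb Z/2\mathbb Z$-graded and signs $\pm$ follow the rule of signs. $\mathbb K=\mathbb K_0\oplus\mathbb K_1$ is a (super)commutative associative unital $\mathbb Q$-superalgebra; modules are graded $\mathbb K$-modules. A symmetric pair is a Lie $\mathbb K$-superalgebra $\mathfrak g$ with an involution $\sigma$; $\mathfrak h,\mathfrak q$ are the $+1,-1$ eigenspaces. $j:\mathfrak g\to U(\mathfrak g)$ is the canonical map. For modules $M,N$: $S(M)$ is the symmetric superalgebra with coproduct $\Delta(w)=\sum w_i\otimes w_i'$ ($M$ primitive), $F(M,N)=\operatorname{Hom}_{\mathbb K}(S(M),N)$, $F(M)=S(M)^*$ with product dual to $\Delta$; $F(M,N)$ is a Lie $F(M)$-superalgebra if $N$ is a Lie superalgebra. For $\alpha\in F(M,M)$, $c_\alpha$ is the coderivation $c_\alpha(w)=\sum\alpha(w_i)w'_i$ of $S(M)$. The left multiplication data. Let $\beta:S(\mathfrak g)\to U(\mathfrak g)$ be the symmetrization. The map $\bar\beta:S(\mathfrak q)\otimes U(\mathfrak h)\to U(\mathfrak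 g)$, $w\otimes u\mapsto\beta(w)u$, is a coalgebra isomorphism. Let $l_a$ be left multiplication by $j(a)$ in $U(\mathfrak g)$ and $\bar l_a=\bar\beta^{-1}l_a\bar\beta$. The elements $\alpha_a\in F(\mathfrak q,\mathfrak q)$, $\theta_a\in F(\mathfrak q,\mathfrak h)$ are those determined by $\bar l_a(w\otimes u)=\sum\pm w_i\alpha_a(w_i')\otimes u+\sum\pm w_i\otimes j(\theta_a(w'_i))u$ for $w\in S(\mathfrak q)$, $u\in U(\mathfrak h)$. Similarly $\bar\beta_\chi:S(\mathfrak q)\otimes V\to U(\mathfrak g)\otimes_{\mathfrak h}V$, $w\otimes v\mapsto\beta(w)\otimes v$, is an isomorphism, and $\bar l_{\chi,a}$ is the endomorphism of $S(\mathfrak q)\otimes V$ corresponding to left multiplication by $a$ in $U(\mathfrak g)\otimes_{\mathfrak h}V$. The explicit data. Let $y\in F(\mathfrak q,\mathfrak q)\subset F(\mathfrak q,\mathfrak g)$ be the generic point of $\mathfrak q$: $0$ on $S^n(\mathfrak q)$ for $n\ne1$ and the inclusion on $\mathfrak q$. For $f(t)=\sum f_nt^n\in\mathbb K_0[[t]]$ and $a\in\mathfrak g$, $f(\operatorname{ad}y)(a)=\sum_nf_n\operatorname{ad}^n(y)(a)\in F(\mathfrak q,\mathfrak g)$ (locally finite sum; $a$ is viewed as a constant function). Put $p_1(t)=t\coth t\in\mathbb K_0[[t^2]]$, $q_1(t)=-\tanh(t/2)\in t\,\mathbb K_0[[t^2]]$. Then $\alpha^a_1=[a,y]$ and $\theta^a_1=a$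 (constant function) for $a\in\mathfrak h$; $\alpha_1^a=p_1(\operatorname{ad}y)(a)\in F(\mathfrak q,\mathfrak q)$ and $\theta_1^a=q_1(\operatorname{ad}y)(a)\in F(\mathfrak q,\mathfrak h)$ for $a\in\mathfrak q$; extended additively to $\mathfrak g$. Finally, $\Theta^a_{1,\chi}\in\operatorname{End}(S(\mathfrak q)\otimes V)$ is $$\Theta^a_{1,\chi}(w\otimes v)=c_{\alpha_1^a}(w)\otimes v+\sum\pm w_i\otimes\chi(\theta^a_1(w'_i))(v).$$ *)

(* Defs.v *)
From HB Require Import structures.
From mathcomp Require Import all_boot all_order all_algebra perm.
From mathcomp Require Import mathcomp_extra boolp classical_sets fsbigop.

Set Implicit Arguments.
Unset Strict Implicit.
Unset Printing Implicit Defensive.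

Import GRing.Theory.
Local Open Scope ring_scope.
Local Open Scope quotient_scope.

Reserved Notation "x *:> k" (at level 40, left associativity).

(* (-1)^b x *)
Definition sgn (V : zmodType) (b : bool) (x : V) : V := if b then - x else x.

(* A Z/2-grading is given by the two projections of M = M_0 (+) M_1. *)
HB.mixin Record isGraded M of GRing.Zmodule M := {
  hc : bool -> M -> M;
  hcD : forall i x y, hc i (x + y) = hc i x + hc i y;
  hcK : forall i j x, hc i (hc j x) = if i == j then hc j x else 0;
  hcE : forall x, hc false x + hc true x = x
}.

#[short(type="gradedZmodType")]
HB.structure Definition GradedZmod := {M of GRing.Zmodule M & isGraded M}.

Definition homog (M : gradedZmodType) (i : bool) (x : M) : Prop := hc i x = x.

(* The rational structure is the unit map Q -> K rather than an algType
   structure, since MathComp algebras are assumed to be nontrivial. *)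
HB.mixin Record isSuperComAlg K of GRing.PzRing K & isGraded K := {
  qinj : rat -> K;
  qinjD : forall c d, qinj (c + d) = qinj c + qinj d;
  qinjM : forall c d, qinj (c * d) = qinj c * qinj d;
  qinj1 : qinj 1 = 1;
  homogM : forall i j (x y : K), hc i x = x -> hc j y = y ->
    hc (i (+) j) (x * y) = x * y;
  supercomm : forall i j (x y : K), hc i x = x -> hc j y = y ->
    x * y = sgn (i && j) (y * x)
}.

#[short(type="superComAlgType")]
HB.structure Definition SuperComAlg :=
  {K of GRing.PzRing K & isGraded K & isSuperComAlg K}.

HB.mixin Record isSuperMod (K : superComAlgType) M of GRing.Lmodule K M
    & isGraded M := {
  homogZ : forall i j (k : K) (x : M), hc i k = k -> hc j x = x ->
    hc (i (+) j) (k *: x) = k *: x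
}.

#[short(type="superModType")]
HB.structure Definition SuperMod (K : superComAlgType) :=
  {M of GRing.Lmodule K M & isGraded M & isSuperMod K M}.

(* The right K-action attached to the left one by the rule of signs. *)
Definition rscale (K : superComAlgType) (M : superModType K) (x : M) (k : K) : M :=
  \sum_(i : bool) \sum_(j : bool) sgn (i && j) (hc j k *: hc i x).
Notation "x *:> k" := (rscale x k) : ring_scope.

(* Hom_K(M, N): commuting with the right action involves no sign, so all
   elements of Hom_K, of any parity or not homogeneous, are right-linear maps. *)
Definition right_linear (K : superComAlgType) (M N : superModType K)
    (f : M -> N) : Prop :=
  (forall x y, f (x + y) = f x + f y) /\ (forall x k, f (x *:> k) = f x *:> k).

(* The component of parity j of f. *)
Definition homc (M N : gradedZmodType) (j : bool) (f : M -> N) (x : M) : N :=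
  \sum_(i : bool) hc (i (+) j) (f (hc i x)).

HB.mixin Record isLieSuper (K : superComAlgType) g of SuperMod K g := {
  lbr : g -> g -> g;
  lbrDl : forall a b c, lbr (a + b) c = lbr a c + lbr b c;
  lbrDr : forall a b c, lbr a (b + c) = lbr a b + lbr a c;
  lbrZl : forall (k : K) a b, lbr (k *: a) b = k *: lbr a b;
  lbrZr : forall (k : K) a b, lbr a (b *:> k) = lbr a b *:> k;
  homog_lbr : forall i j a b, homog i a -> homog j b ->
    homog (i (+) j) (lbr a b);
  lbr_anti : forall i j a b, homog i a -> homog j b ->
    lbr a b = - sgn (i && j) (lbr b a);
  lbr_jacobi : forall i j a b c, homog i a -> homog j b ->
    lbr a (lbr b c) = lbr (lbr a b) c + sgn (i && j) (lbr b (lbr a c))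
}.

#[short(type="lieSuperType")]
HB.structure Definition LieSuper (K : superComAlgType) :=
  {g of SuperMod K g & isLieSuper K g}.

Record lie_rep (K : superComAlgType) (h : lieSuperType K) (V : superModType K) :=
  LieRep {
  act :> h -> V -> V;
  actDl : forall a b v, act (a + b) v = act a v + act b v;
  actDr : forall a u v, act a (u + v) = act a u + act a v;
  actZl : forall (k : K) a v, act (k *: a) v = k *: act a v;
  actZr : forall (k : K) a v, act a (v *:> k) = act a v *:> k;
  homog_act : forall i j a v, homog i a -> homog j v ->
    homog (i (+) j) (act a v);
  act_lbr : forall i j a b v, homog i a -> homog j b ->
    act (lbr a b) v = act a (act b v) - sgn (i && j) (act b (act a v))
}.

Record involution (K : superComAlgType) (g : lieSuperType K) := Involution {
  inv_fun :> g -> g;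
  invD : forall a b, inv_fun (a + b) = inv_fun a + inv_fun b;
  invZ : forall (k : K) a, inv_fun (k *: a) = k *: inv_fun a;
  inv_homog : forall i a, homog i a -> homog i (inv_fun a);
  inv_lbr : forall a b, inv_fun (lbr a b) = lbr (inv_fun a) (inv_fun b);
  invK : forall a, inv_fun (inv_fun a) = a
}.

Section SignTheory.
Variable V : zmodType.
Implicit Types (b c : bool) (x y : V).

Lemma sgn0 b : sgn b 0 = 0 :> V.
Proof. by case: b; rewrite /= ?oppr0. Qed.
Lemma sgnD b x y : sgn b (x + y) = sgn b x + sgn b y.
Proof. by case: b; rewrite //= opprD. Qed.
Lemma sgnN b x : sgn b (- x) = - sgn b x.
Proof. by case: b. Qed.
Lemma sgnsgn b c x : sgn b (sgn c x) = sgn (b (+) c) x.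
Proof. by case: b; case: c; rewrite //= opprK. Qed.
Lemma sum_bool (F : bool -> V) : \sum_(i : bool) F i = F false + F true.
Proof. by rewrite big_bool addrC. Qed.
End SignTheory.

Section GradedTheory.
Variable M : gradedZmodType.
Implicit Types (x y : M) (i : bool).

Lemma hc0 i : hc i 0 = 0 :> M.
Proof. by apply: (@addrI _ (hc i 0)); rewrite -hcD !addr0. Qed.
Lemma hcN i x : hc i (- x) = - hc i x.
Proof. by apply: (@addrI _ (hc i x)); rewrite -hcD !subrr hc0. Qed.
Lemma hc_sgn i b x : hc i (sgn b x) = sgn b (hc i x).
Proof. by case: b; rewrite //= hcN. Qed.
Lemma homog_hc i x : homog i (hc i x).
Proof. by rewrite /homog hcK eqxx. Qed.
Lemma homog0 i : homog i (0 : M).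
Proof. exact: hc0. Qed.
Lemma homogD i x y : homog i x -> homog i y -> homog i (x + y).
Proof. by rewrite /homog hcD => -> ->. Qed.
Lemma homogN i x : homog i x -> homog i (- x).
Proof. by rewrite /homog hcN => ->. Qed.
Lemma homog_sgn i b x : homog i x -> homog i (sgn b x).
Proof. by case: b => //=; apply: homogN. Qed.
Lemma homog_hcE i j x : homog j x -> hc i x = if i == j then x else 0.
Proof. by rewrite {1}/homog => <-; rewrite hcK. Qed.

(* The parity automorphism x |-> x_0 - x_1. *)
Fact par_key : unit. Proof. exact: tt. Qed.
Definition par : M -> M :=
  locked_with par_key (fun x => hc false x - hc true x).
Lemma parE x : par x = hc false x - hc true x.
Proof. by rewrite /par unlock. Qed.

Lemma parD x y : par (x + y) = par x + par y.
Proof. by rewrite !parE !hcD opprD addrACA. Qed.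
Lemma parN x : par (- x) = - par x.
Proof. by rewrite !parE !hcN opprD. Qed.
Lemma par0 : par 0 = 0.
Proof. by rewrite !parE !hc0 subrr. Qed.
Lemma par_homog i x : homog i x -> par x = sgn i x.
Proof.
by move=> hx; rewrite !parE !(homog_hcE _ hx); case: (i); rewrite /= ?sub0r ?subr0.
Qed.
Lemma parK x : par (par x) = x.
Proof.
by rewrite !parE !hcD !hcN !hcK /= subr0 sub0r opprK hcE.
Qed.
Lemma hc_par i x : hc i (par x) = sgn i (hc i x).
Proof. by rewrite !parE hcD hcN !hcK; case: i; rewrite /= ?subr0 ?sub0r. Qed.
Lemma par_hc i x : par (hc i x) = sgn i (hc i x).
Proof. by rewrite (par_homog (homog_hc _ _)). Qed.
Lemma par_sgn b x : par (sgn b x) = sgn b (par x).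
Proof. by case: b; rewrite //= parN. Qed.

Lemma homog_ind (P : M -> Prop) :
  (forall x y, P x -> P y -> P (x + y)) -> (forall i x, homog i x -> P x) ->
  forall x, P x.
Proof. by move=> PD Ph x; rewrite -(hcE x); apply: PD; apply: Ph (homog_hc _ _). Qed.
End GradedTheory.

Section ScalarTheory.
Variable K : superComAlgType.
Implicit Types (k l : K).

Lemma qinj0 : qinj 0 = 0 :> K.
Proof. by apply: (@addrI _ (qinj 0)); rewrite -qinjD !addr0. Qed.
Lemma qinjN c : qinj (- c) = - qinj c :> K.
Proof. by apply: (@addrI _ (qinj c)); rewrite -qinjD !subrr qinj0. Qed.
Lemma qinj_nat n : qinj n%:R = n%:R :> K.
Proof. by elim: n => [|n IH]; rewrite ?qinj0 // -!natr1 qinjD IH qinj1. Qed.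

Lemma homogMK i j k l : homog i k -> homog j l -> homog (i (+) j) (k * l).
Proof. exact: homogM. Qed.

Lemma mulKC i j k l : homog i k -> homog j l -> k * l = sgn (i && j) (l * k).
Proof. exact: supercomm. Qed.

Lemma sgnMl b k l : sgn b k * l = sgn b (k * l).
Proof. by case: b; rewrite //= mulNr. Qed.
Lemma sgnMr b k l : k * sgn b l = sgn b (k * l).
Proof. by case: b; rewrite //= mulrN. Qed.

Lemma homog1 : homog false (1 : K).
Proof.
have E (k : K) : k * hc true 1 = 0.
  elim/homog_ind: k => [x y Hx Hy|i x hx]; first by rewrite mulrDl Hx Hy addr0.
  have := mulr1 x; rewrite -{1}(hcE (1 : K)) mulrDr.
  have h0 := homogMK hx (homog_hc false (1 : K)).
  have h1 := homogMK hx (homog_hc true (1 : K)).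
  move=> /(congr1 (hc (i (+) true))); rewrite hcD (homog_hcE _ h0) h1.
  rewrite (homog_hcE _ hx) addbF addbT.
  by case: (i) => /=; rewrite add0r.
by rewrite /homog -[RHS](hcE (1 : K)) -[hc true 1]mul1r E addr0.
Qed.

Lemma homog_qinj c : homog false (qinj c : K).
Proof.
have hn n : homog false (n%:R : K).
  elim: n => [|n IH]; first exact: homog0.
  by rewrite -natr1; apply: homogD IH homog1.
have hi n : homog false (qinj (n.+1%:R^-1) : K).
  set e := qinj _; have e1 : e * n.+1%:R = 1 :> K.
    by rewrite -qinj_nat -qinjM mulVf ?qinj1 // Num.Theory.pnatr_eq0.
  have := e1; rewrite -{1}(hcE e) mulrDl => /(congr1 (hc true)).
  have h0 := homogMK (homog_hc false e) (hn n.+1).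
  have h1 := homogMK (homog_hc true e) (hn n.+1).
  rewrite hcD (homog_hcE _ h0) h1 (homog_hcE _ homog1) /= add0r => E.
  have e2 : n.+1%:R * e = 1 :> K.
    by rewrite -qinj_nat -qinjM mulfV ?qinj1 // Num.Theory.pnatr_eq0.
  have E' : hc true e = 0 by rewrite -[LHS]mulr1 -e2 mulrA E mul0r.
  by rewrite /homog -[RHS](hcE e) E' addr0.
have hz (z : int) : homog false (qinj (z%:~R) : K).
  case: z => n; first by rewrite -pmulrn qinj_nat; apply: hn.
  by rewrite NegzE mulrNz qinjN -pmulrn qinj_nat; apply: homogN (hn _).
case: (ratP c) => n d _; rewrite qinjM; exact: (homogMK (hz _) (hi _)).
Qed.

Section Lmodule.
Variable N : lmodType K.
Lemma sgnZl b k (x : N) : sgn b k *: x = sgn b (k *: x).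
Proof. by case: b; rewrite //= scaleNr. Qed.
Lemma sgnZr b k (x : N) : k *: sgn b x = sgn b (k *: x).
Proof. by case: b; rewrite //= scalerN. Qed.

Definition half : K := qinj (2%:R^-1).

Lemma halfD (x : N) : half *: (x + x) = x.
Proof.
rewrite -mulr2n -scaler_nat scalerA -qinj_nat -qinjM mulVf ?Num.Theory.pnatr_eq0 //.
by rewrite qinj1 scale1r.
Qed.
End Lmodule.

Variable M : superModType K.
Implicit Types (x y : M).

Lemma homogZM i j k x : homog i k -> homog j x -> homog (i (+) j) (k *: x).
Proof. exact: homogZ. Qed.

Lemma parZ k x : par (k *: x) = par k *: par x.
Proof.
elim/homog_ind: k => [k l Hk Hl|i k hk]; first by rewrite scalerDl !parD Hk Hl [RHS]scalerDl.
elim/homog_ind: x => [x y Hx Hy|j x hx]; first by rewrite scalerDr !parD Hx Hy [RHS]scalerDr.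
rewrite (par_homog hk) (par_homog hx) (par_homog (homogZM hk hx)).
by rewrite sgnZl sgnZr sgnsgn.
Qed.

Lemma rscaleE x k : x *:> k = hc false k *: x + hc true k *: par x.
Proof.
rewrite /rscale !sum_bool /= -[in hc false k *: x](hcE x) parE scalerDr scalerBr.
by rewrite addrACA.
Qed.

Lemma rscale_homog i j x k : homog i x -> homog j k ->
  x *:> k = sgn (i && j) (k *: x).
Proof.
move=> hx hk; rewrite rscaleE !(homog_hcE _ hk) (par_homog hx).
by case: (j); case: (i); rewrite /= ?scale0r ?add0r ?addr0 ?scalerN.
Qed.

Lemma rscaleDl x y k : (x + y) *:> k = x *:> k + y *:> k.
Proof. by rewrite !rscaleE parD !scalerDr addrACA. Qed.
Lemma rscaleDr x k l : x *:> (k + l) = x *:> k + x *:> l.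
Proof. by rewrite !rscaleE !hcD !scalerDl addrACA. Qed.
Lemma rscaleNl x k : (- x) *:> k = - (x *:> k).
Proof. by rewrite !rscaleE parN !scalerN opprD. Qed.
Lemma rscale0l k : (0 : M) *:> k = 0.
Proof. by rewrite !rscaleE par0 !scaler0 addr0. Qed.
Lemma rscale0r x : x *:> 0 = 0.
Proof. by rewrite !rscaleE !hc0 !scale0r addr0. Qed.
Lemma rscaleNr x k : x *:> (- k) = - (x *:> k).
Proof. by rewrite !rscaleE !hcN !scaleNr opprD. Qed.
Lemma rscale1 x : x *:> 1 = x.
Proof. by rewrite rscaleE !(homog_hcE _ homog1) /= scale0r addr0 scale1r. Qed.

Lemma par_rscale x k : par (x *:> k) = par x *:> par k.
Proof.
by rewrite !rscaleE parD !parZ !par_hc !hc_par.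
Qed.

Lemma rscaleA x k l : x *:> k *:> l = x *:> (k * l).
Proof.
elim/homog_ind: x => [x y Hx Hy|i x hx]; first by rewrite !rscaleDl Hx Hy.
elim/homog_ind: k => [k k' Hk Hl|j k hk].
  by rewrite rscaleDr rscaleDl mulrDl rscaleDr Hk Hl.
elim/homog_ind: l => [l l' Hk Hl|m l hl].
  by rewrite rscaleDr mulrDr rscaleDr Hk Hl.
rewrite (rscale_homog hx hk) (rscale_homog hx (homogMK hk hl)).
rewrite (rscale_homog (homog_sgn _ (homogZM hk hx)) hl).
rewrite sgnZr sgnsgn scalerA (mulKC hl hk) sgnZl sgnsgn.
by congr sgn; case: (i); case: (j); case: (m).
Qed.

Lemma rscaleZ x k l : (k *: x) *:> l = k *: (x *:> l).
Proof.
elim/homog_ind: x => [x y Hx Hy|i x hx].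
  by rewrite scalerDr !rscaleDl Hx Hy scalerDr.
elim/homog_ind: k => [k k' Hk Hl|j k hk].
  by rewrite !scalerDl !rscaleDl Hk Hl.
elim/homog_ind: l => [l l' Hk Hl|m l hl].
  by rewrite !rscaleDr Hk Hl scalerDr.
rewrite (rscale_homog hx hl) (rscale_homog (homogZM hk hx) hl).
rewrite sgnZr !scalerA (mulKC hl hk) sgnZl sgnsgn.
by congr sgn; case: (i); case: (j); case: (m).
Qed.

Lemma halfM k : half * (k + k) = k.
Proof.
rewrite -mulr2n -[k *+ 2]mulr_natl mulrA -qinj_nat -qinjM.
by rewrite mulVf ?Num.Theory.pnatr_eq0 // qinj1 mul1r.
Qed.
Lemma par_half : par half = half.
Proof. by rewrite (par_homog (homog_qinj _)). Qed.

End ScalarTheory.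

(* The eigenspaces of an involution: eig s false is the +1 eigenspace,
   eig s true the -1 eigenspace. *)
Section Eigenspace.
Variables (K : superComAlgType) (g : lieSuperType K) (s : involution g).

Lemma inv0 : s 0 = 0.
Proof. by apply: (@addrI _ (s 0)); rewrite -invD !addr0. Qed.
Lemma invN a : s (- a) = - s a.
Proof. by apply: (@addrI _ (s a)); rewrite -invD !subrr inv0. Qed.
Lemma inv_sgn b a : s (sgn b a) = sgn b (s a).
Proof. by case: b; rewrite //= invN. Qed.
Lemma inv_hc i a : s (hc i a) = hc i (s a).
Proof.
rewrite -{2}(hcE a) invD hcD.
rewrite (homog_hcE i (inv_homog s (homog_hc false a))).
rewrite (homog_hcE i (inv_homog s (homog_hc true a))).
by case: i; rewrite /= ?add0r ?addr0.
Qed.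

Variable e : bool.

Definition eig_pred : {pred g} := fun a => s a == sgn e a.
Lemma eig_closed : submod_closed eig_pred.
Proof.
split; first by rewrite unfold_in /eig_pred inv0 sgn0.
move=> k a b; rewrite !unfold_in /eig_pred => /eqP ha /eqP hb.
by rewrite invD invZ ha hb sgnD sgnZr.
Qed.
HB.instance Definition _ := GRing.isSubmodClosed.Build K g eig_pred eig_closed.

Record eig := Eig { eig_val :> g; eig_valP : eig_val \in eig_pred }.
HB.instance Definition _ := [isSub for eig_val].
HB.instance Definition _ := [Choice of eig by <:].
HB.instance Definition _ := [SubChoice_isSubLmodule of eig by <:].

Lemma eigE (a : eig) : s (val a) = sgn e (val a).
Proof. exact/eqP/(eig_valP a). Qed.

Fact eig_hc_subproof i (a : eig) : hc i (val a) \in eig_pred.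
Proof. by rewrite unfold_in /eig_pred inv_hc eigE hc_sgn. Qed.
Definition eig_hc i (a : eig) : eig := Eig (eig_hc_subproof i a).

Fact eig_hcD i (a b : eig) : eig_hc i (a + b) = eig_hc i a + eig_hc i b.
Proof. by apply: val_inj; rewrite /= hcD. Qed.
Fact eig_hcK i j (a : eig) :
  eig_hc i (eig_hc j a) = if i == j then eig_hc j a else 0.
Proof. by apply: val_inj; rewrite /= hcK; case: eqP. Qed.
Fact eig_hcE (a : eig) : eig_hc false a + eig_hc true a = a.
Proof. by apply: val_inj; rewrite /= hcE. Qed.
HB.instance Definition _ := isGraded.Build eig eig_hcD eig_hcK eig_hcE.

Lemma val_hc i (a : eig) : val (hc i a) = hc i (val a).
Proof. by []. Qed.
Lemma val_homog i (a : eig) : homog i a <-> homog i (val a).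
Proof.
split; first by rewrite /homog -val_hc => ->.
by move=> h; apply: val_inj; rewrite val_hc.
Qed.

Fact eig_homogZ i j (k : K) (a : eig) : hc i k = k -> hc j a = a ->
  hc (i (+) j) (k *: a) = k *: a.
Proof.
move=> hk /val_homog ha; apply: val_inj.
by rewrite val_hc /= homogZ.
Qed.
HB.instance Definition _ := isSuperMod.Build K eig eig_homogZ.

Lemma val_rscale (a : eig) (k : K) : val (a *:> k) = val a *:> k.
Proof. by rewrite !rscaleE !parE !scalerBr. Qed.

Fact eig_proj_subproof (a : g) : half K *: (a + sgn e (s a)) \in eig_pred.
Proof.
rewrite unfold_in /eig_pred invZ invD inv_sgn invK -sgnZr sgnD sgnsgn.
by rewrite addbb /= addrC.
Qed.
(* The projection of g onto the eigenspace along the other one. *)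
Definition eig_proj (a : g) : eig := Eig (eig_proj_subproof a).

Lemma eig_projK (a : g) : a \in eig_pred -> val (eig_proj a) = a.
Proof.
by rewrite unfold_in /eig_pred => /eqP /= ->; rewrite sgnsgn addbb halfD.
Qed.
End Eigenspace.

Section FixedLie.
Variables (K : superComAlgType) (g : lieSuperType K) (s : involution g).
Notation h := (eig s false).

Fact fix_lbr_subproof (a b : h) : lbr (val a) (val b) \in eig_pred s false.
Proof. by rewrite unfold_in /eig_pred inv_lbr !eigE. Qed.
Definition fix_lbr (a b : h) : h := Eig (fix_lbr_subproof a b).

Fact fix_lbrDl a b c : fix_lbr (a + b) c = fix_lbr a c + fix_lbr b c.
Proof. by apply: val_inj; rewrite /= lbrDl. Qed.
Fact fix_lbrDr a b c : fix_lbr a (b + c) = fix_lbr a b + fix_lbr a c.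
Proof. by apply: val_inj; rewrite /= lbrDr. Qed.
Fact fix_lbrZl (k : K) a b : fix_lbr (k *: a) b = k *: fix_lbr a b.
Proof. by apply: val_inj; rewrite /= lbrZl. Qed.
Fact fix_lbrZr (k : K) a b : fix_lbr a (b *:> k) = fix_lbr a b *:> k.
Proof. by apply: val_inj; rewrite val_rscale /= -[eig_val _]/(val _) val_rscale lbrZr. Qed.
Fact fix_homog_lbr i j a b : homog i a -> homog j b ->
  homog (i (+) j) (fix_lbr a b).
Proof. by move=> /val_homog ha /val_homog hb; apply/val_homog; exact: homog_lbr. Qed.
Fact val_sgn e b (a : eig s e) : val (sgn b a) = sgn b (val a).
Proof. by case: b. Qed.
Fact fix_lbr_anti i j a b : homog i a -> homog j b ->
  fix_lbr a b = - sgn (i && j) (fix_lbr b a).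
Proof.
move=> /val_homog ha /val_homog hb; apply: val_inj.
by rewrite /= (lbr_anti _ _ _ _ ha hb) -[eig_val (sgn _ _)]/(val _) val_sgn.
Qed.
Fact fix_lbr_jacobi i j a b c : homog i a -> homog j b ->
  fix_lbr a (fix_lbr b c) =
  fix_lbr (fix_lbr a b) c + sgn (i && j) (fix_lbr b (fix_lbr a c)).
Proof.
move=> /val_homog ha /val_homog hb; apply: val_inj.
by rewrite /= (lbr_jacobi _ _ _ _ _ ha hb) -[eig_val (sgn _ _)]/(val _) val_sgn.
Qed.
HB.instance Definition _ := isLieSuper.Build K h fix_lbrDl fix_lbrDr fix_lbrZl
  fix_lbrZr fix_homog_lbr fix_lbr_anti fix_lbr_jacobi.
End FixedLie.

(* M viewed as a Lie superalgebra with zero bracket. *)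
Definition abel (K : superComAlgType) (M : superModType K) : Type := M.

Section Abelian.
Variables (K : superComAlgType) (M : superModType K).
HB.instance Definition _ := SuperMod.on (abel M).

Definition abel_lbr (a b : abel M) : abel M := 0.
Fact abel_lbrD a b c : abel_lbr a c = abel_lbr b c + abel_lbr b c.
Proof. by rewrite addr0. Qed.
Fact abel_lbrZl (k : K) a b : abel_lbr (k *: a) b = k *: abel_lbr a b.
Proof. by rewrite scaler0. Qed.
Fact abel_lbrZr (k : K) a b : abel_lbr a (b *:> k) = abel_lbr a b *:> k.
Proof. by rewrite rscale0l. Qed.
Fact abel_homog i j a b : homog i a -> homog j b ->
  homog (i (+) j) (abel_lbr a b).
Proof. by move=> _ _; exact: homog0. Qed.
Fact abel_anti i j a b : homog i a -> homog j b ->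
  abel_lbr a b = - sgn (i && j) (abel_lbr b a).
Proof. by rewrite /abel_lbr sgn0 oppr0. Qed.
Fact abel_jacobi i j a b c : homog i a -> homog j b ->
  abel_lbr a (abel_lbr b c) =
  abel_lbr (abel_lbr a b) c + sgn (i && j) (abel_lbr b (abel_lbr a c)).
Proof. by rewrite /abel_lbr sgn0 addr0. Qed.
HB.instance Definition _ := isLieSuper.Build K (abel M)
  (fun a b c => abel_lbrD (a + b) a c) (fun a b c => abel_lbrD a a (b + c))
  abel_lbrZl abel_lbrZr abel_homog abel_anti abel_jacobi.
End Abelian.

(* The relations uc_GenZl, uc_GenZr identify the two actions of K on g with
   left and right multiplication by Cst k, so that K is supercentral in the
   quotient; homogeneity being required in uc_lbr is no restriction. *)
Inductive uterm (K g : Type) : Type :=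
  | Cst of K
  | Gen of g
  | Add of uterm K g & uterm K g
  | Opp of uterm K g
  | Mul of uterm K g & uterm K g.
Arguments Cst {K g}.
Arguments Gen {K g}.

HB.instance Definition _ (K g : Type) := gen_eqMixin (uterm K g).
HB.instance Definition _ (K g : Type) := gen_choiceMixin (uterm K g).

Inductive ucong (K : superComAlgType) (g : lieSuperType K) :
    uterm K g -> uterm K g -> Prop :=
  | uc_refl t : ucong t t
  | uc_sym t u : ucong t u -> ucong u t
  | uc_trans t u v : ucong t u -> ucong u v -> ucong t v
  | uc_Add t t' u u' : ucong t t' -> ucong u u' -> ucong (Add t u) (Add t' u')
  | uc_Opp t t' : ucong t t' -> ucong (Opp t) (Opp t')
  | uc_Mul t t' u u' : ucong t t' -> ucong u u' -> ucong (Mul t u) (Mul t' u')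
  | uc_addA t u v : ucong (Add t (Add u v)) (Add (Add t u) v)
  | uc_addC t u : ucong (Add t u) (Add u t)
  | uc_add0 t : ucong (Add (Cst 0) t) t
  | uc_addN t : ucong (Add (Opp t) t) (Cst 0)
  | uc_mulA t u v : ucong (Mul t (Mul u v)) (Mul (Mul t u) v)
  | uc_mul1l t : ucong (Mul (Cst 1) t) t
  | uc_mul1r t : ucong (Mul t (Cst 1)) t
  | uc_mulDl t u v : ucong (Mul (Add t u) v) (Add (Mul t v) (Mul u v))
  | uc_mulDr t u v : ucong (Mul t (Add u v)) (Add (Mul t u) (Mul t v))
  | uc_CstD k l : ucong (Cst (k + l)) (Add (Cst k) (Cst l))
  | uc_CstM k l : ucong (Cst (k * l)) (Mul (Cst k) (Cst l))
  | uc_GenD a b : ucong (Gen (a + b)) (Add (Gen a) (Gen b))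
  | uc_GenZl k a : ucong (Gen (k *: a)) (Mul (Cst k) (Gen a))
  | uc_GenZr k a : ucong (Gen (a *:> k)) (Mul (Gen a) (Cst k))
  | uc_lbr i j a b : homog i a -> homog j b ->
      ucong (Gen (lbr a b))
        (Add (Mul (Gen a) (Gen b))
             (Opp (Mul (Cst (sgn (i && j) 1)) (Mul (Gen b) (Gen a))))).

Section Enveloping.
Variables (K : superComAlgType) (g : lieSuperType K).

Definition ucongb : rel (uterm K g) := fun t u => `[< ucong t u >].
Fact ucongb_refl : reflexive ucongb.
Proof. by move=> t; apply/asboolP/uc_refl. Qed.
Fact ucongb_sym : symmetric ucongb.
Proof. by move=> t u; apply/asboolP/asboolP; apply: uc_sym. Qed.
Fact ucongb_trans : transitive ucongb.
Proof. by move=> u t v /asboolP tu /asboolP uv; apply/asboolP/(uc_trans tu uv). Qed.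
Canonical ucong_equiv := EquivRel ucongb ucongb_refl ucongb_sym ucongb_trans.

Definition U : Type := {eq_quot ucong_equiv}.
HB.instance Definition _ := Choice.on U.
HB.instance Definition _ := EqQuotient.on U.

Definition upi (t : uterm K g) : U := \pi_U t.
Lemma upiE t u : ucong t u -> upi t = upi u.
Proof. by move=> h; apply/eqmodP/asboolP. Qed.
Lemma upiP t u : upi t = upi u -> ucong t u.
Proof. by move=> /eqmodP/asboolP. Qed.
Lemma upiK x : upi (repr x) = x.
Proof. exact: reprK. Qed.
Lemma repr_upi t : ucong (repr (upi t)) t.
Proof. by apply: upiP; rewrite upiK. Qed.

Definition uadd (x y : U) : U := upi (Add (repr x) (repr y)).
Definition uopp (x : U) : U := upi (Opp (repr x)).
Definition umul (x y : U) : U := upi (Mul (repr x) (repr y)).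

Lemma upi_add t u : upi (Add t u) = uadd (upi t) (upi u).
Proof. by apply/upiE/uc_Add; apply/uc_sym/repr_upi. Qed.
Lemma upi_opp t : upi (Opp t) = uopp (upi t).
Proof. by apply/upiE/uc_Opp; apply/uc_sym/repr_upi. Qed.
Lemma upi_mul t u : upi (Mul t u) = umul (upi t) (upi u).
Proof. by apply/upiE/uc_Mul; apply/uc_sym/repr_upi. Qed.
Lemma upi_surj x : exists t, x = upi t.
Proof. by exists (repr x); rewrite upiK. Qed.

Fact uaddA : associative uadd.
Proof.
move=> x y z; case: (upi_surj x) (upi_surj y) (upi_surj z) => [t ->] [u ->] [v ->].
by rewrite -!upi_add; apply/upiE/uc_addA.
Qed.
Fact uaddC : commutative uadd.
Proof.
move=> x y; case: (upi_surj x) (upi_surj y) => [t ->] [u ->].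
by rewrite -!upi_add; apply/upiE/uc_addC.
Qed.
Fact uadd0 : left_id (upi (Cst 0)) uadd.
Proof.
by move=> x; case: (upi_surj x) => [t ->]; rewrite -upi_add; apply/upiE/uc_add0.
Qed.
Fact uaddN : left_inverse (upi (Cst 0)) uopp uadd.
Proof.
move=> x; case: (upi_surj x) => [t ->].
by rewrite -upi_opp -upi_add; apply/upiE/uc_addN.
Qed.
HB.instance Definition _ := GRing.isZmodule.Build U uaddA uaddC uadd0 uaddN.

Fact umulA : associative umul.
Proof.
move=> x y z; case: (upi_surj x) (upi_surj y) (upi_surj z) => [t ->] [u ->] [v ->].
by rewrite -!upi_mul; apply/upiE/uc_mulA.
Qed.
Fact umul1l : left_id (upi (Cst 1)) umul.
Proof.
by move=> x; case: (upi_surj x) => [t ->]; rewrite -upi_mul; apply/upiE/uc_mul1l.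
Qed.
Fact umul1r : right_id (upi (Cst 1)) umul.
Proof.
by move=> x; case: (upi_surj x) => [t ->]; rewrite -upi_mul; apply/upiE/uc_mul1r.
Qed.
Fact umulDl : left_distributive umul +%R.
Proof.
move=> x y z; case: (upi_surj x) (upi_surj y) (upi_surj z) => [t ->] [u ->] [v ->].
by rewrite -[LHS]/(umul (uadd _ _) _) -[RHS]/(uadd _ _) -!(upi_mul, upi_add);
   apply/upiE/uc_mulDl.
Qed.
Fact umulDr : right_distributive umul +%R.
Proof.
move=> x y z; case: (upi_surj x) (upi_surj y) (upi_surj z) => [t ->] [u ->] [v ->].
by rewrite -[LHS]/(umul _ (uadd _ _)) -[RHS]/(uadd _ _) -!(upi_mul, upi_add);
   apply/upiE/uc_mulDr.
Qed.
HB.instance Definition _ := GRing.Zmodule_isPzRing.Build U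
  umulA umul1l umul1r umulDl umulDr.

Definition uC (k : K) : U := upi (Cst k).
(* The canonical map j : g -> U(g). *)
Definition uG (a : g) : U := upi (Gen a).

Lemma upiD t u : upi (Add t u) = upi t + upi u. Proof. exact: upi_add. Qed.
Lemma upiN t : upi (Opp t) = - upi t. Proof. exact: upi_opp. Qed.
Lemma upiM t u : upi (Mul t u) = upi t * upi u. Proof. exact: upi_mul. Qed.

Lemma uCD k l : uC (k + l) = uC k + uC l.
Proof. by rewrite -upiD; apply/upiE/uc_CstD. Qed.
Lemma uCM k l : uC (k * l) = uC k * uC l.
Proof. by rewrite -upiM; apply/upiE/uc_CstM. Qed.
Lemma uC0 : uC 0 = 0. Proof. by []. Qed.
Lemma uC1 : uC 1 = 1. Proof. by []. Qed.
Lemma uCN k : uC (- k) = - uC k.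
Proof. by apply: (@addrI _ (uC k)); rewrite -uCD !subrr. Qed.
Lemma uC_sgn b k : uC (sgn b k) = sgn b (uC k).
Proof. by case: b; rewrite //= uCN. Qed.
Lemma uGD a b : uG (a + b) = uG a + uG b.
Proof. by rewrite -upiD; apply/upiE/uc_GenD. Qed.
Lemma uGZl k a : uG (k *: a) = uC k * uG a.
Proof. by rewrite -upiM; apply/upiE/uc_GenZl. Qed.
Lemma uGZr k a : uG (a *:> k) = uG a * uC k.
Proof. by rewrite -upiM; apply/upiE/uc_GenZr. Qed.
Lemma uG_lbr i j a b : homog i a -> homog j b ->
  uG (lbr a b) = uG a * uG b - sgn (i && j) (uG b * uG a).
Proof.
move=> ha hb; transitivity (uG a * uG b - uC (sgn (i && j) 1) * (uG b * uG a)).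
  rewrite /uC /uG -[upi (Gen b) * upi (Gen a)]upiM -[upi (Gen a) * _]upiM.
  by rewrite -[upi (Cst _) * _]upiM -upiN -upiD; apply: upiE; exact: uc_lbr.
by rewrite uC_sgn; case: (i && j); rewrite /= ?mulN1r ?mul1r.
Qed.

Lemma U_ind (P : U -> Prop) :
  (forall k, P (uC k)) -> (forall a, P (uG a)) ->
  (forall x y, P x -> P y -> P (x + y)) -> (forall x, P x -> P (- x)) ->
  (forall x y, P x -> P y -> P (x * y)) -> forall x, P x.
Proof.
move=> PC PG PD PN PM x; case: (upi_surj x) => [t ->].
elim: t => [k|a|t Pt u Pu|t Pt|t Pt u Pu]; first exact: PC.
- exact: PG.
- by rewrite upiD; apply: PD.
- by rewrite upiN; apply: PN.
- by rewrite upiM; apply: PM.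
Qed.

Section Lift.
Variables (A : pzRingType) (c : K -> A) (f : g -> A).

Fixpoint ueval (t : uterm K g) : A :=
  match t with
  | Cst k => c k
  | Gen a => f a
  | Add t u => ueval t + ueval u
  | Opp t => - ueval t
  | Mul t u => ueval t * ueval u
  end.
Definition ulift (x : U) : A := ueval (repr x).

Definition ulift_ok : Prop :=
  [/\ [/\ forall k l, c (k + l) = c k + c l, forall k l, c (k * l) = c k * c l
        & c 1 = 1],
      [/\ forall a b, f (a + b) = f a + f b, forall k a, f (k *: a) = c k * f a
        & forall k a, f (a *:> k) = f a * c k]
    & forall i j a b, homog i a -> homog j b ->
        f (lbr a b) = f a * f b - sgn (i && j) (f b * f a)].

Hypothesis ok : ulift_ok.

Lemma ueval_cong t u : ucong t u -> ueval t = ueval u.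
Proof.
case: ok => [[cD cM c1] [fD fZl fZr] fl].
have c0 : c 0 = 0 by apply: (@addrI _ (c 0)); rewrite -cD !addr0.
have cN k : c (- k) = - c k by apply: (@addrI _ (c k)); rewrite -cD !subrr.
elim=> //= {t u}.
- by move=> t u v _ -> _ ->.
- by move=> t t' u u' _ -> _ ->.
- by move=> t t' _ ->.
- by move=> t t' u u' _ -> _ ->.
- by move=> t u v; rewrite addrA.
- by move=> t u; rewrite addrC.
- by move=> t; rewrite c0 add0r.
- by move=> t; rewrite c0 addNr.
- by move=> t u v; rewrite mulrA.
- by move=> t; rewrite c1 mul1r.
- by move=> t; rewrite c1 mulr1.
- by move=> t u v; rewrite mulrDl.
- by move=> t u v; rewrite mulrDr.
- move=> i j a b ha hb; rewrite (fl _ _ _ _ ha hb).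
  by case: (i && j); rewrite /= ?cN c1 ?mulN1r ?mul1r.
Qed.

Lemma ulift_upi t : ulift (upi t) = ueval t.
Proof. exact/ueval_cong/repr_upi. Qed.
Lemma uliftC k : ulift (uC k) = c k. Proof. exact: ulift_upi. Qed.
Lemma uliftG a : ulift (uG a) = f a. Proof. exact: ulift_upi. Qed.
Lemma uliftD x y : ulift (x + y) = ulift x + ulift y.
Proof.
case: (upi_surj x) (upi_surj y) => [t ->] [u ->].
by rewrite -upiD !ulift_upi.
Qed.
Lemma uliftN x : ulift (- x) = - ulift x.
Proof. by case: (upi_surj x) => [t ->]; rewrite -upiN !ulift_upi. Qed.
Lemma uliftM x y : ulift (x * y) = ulift x * ulift y.
Proof.
case: (upi_surj x) (upi_surj y) => [t ->] [u ->].
by rewrite -upiM !ulift_upi.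
Qed.
Lemma ulift1 : ulift 1 = 1.
Proof. by rewrite -uC1 uliftC; case: ok => [[]]. Qed.
End Lift.

Definition uscale (k : K) (x : U) : U := uC k * x.
Fact uscaleA k l x : uscale k (uscale l x) = uscale (k * l) x.
Proof. by rewrite /uscale uCM mulrA. Qed.
Fact uscale1 : left_id 1 uscale.
Proof. by move=> x; rewrite /uscale uC1 mul1r. Qed.
Fact uscaleDr : right_distributive uscale +%R.
Proof. by move=> k x y; rewrite /uscale mulrDr. Qed.
Fact uscaleDl x : {morph uscale^~ x : k l / k + l}.
Proof. by move=> k l; rewrite /uscale uCD mulrDl. Qed.
HB.instance Definition _ := GRing.Zmodule_isLmodule.Build K U
  uscaleA uscale1 uscaleDr uscaleDl.
Lemma uscaleE k (x : U) : k *: x = uC k * x. Proof. by []. Qed.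

(* The parity automorphism of U(g), from which its grading is read off. *)
Definition upar : U -> U := ulift (fun k => uC (par k)) (fun a => uG (par a)).

Lemma parMK (k l : K) : par (k * l) = par k * par l.
Proof.
elim/homog_ind: k => [x y Hx Hy|i k hk]; first by rewrite mulrDl !parD Hx Hy [RHS]mulrDl.
elim/homog_ind: l => [x y Hx Hy|j l hl]; first by rewrite mulrDr !parD Hx Hy [RHS]mulrDr.
rewrite (par_homog hk) (par_homog hl) (par_homog (homogMK hk hl)).
by rewrite sgnMl sgnMr sgnsgn.
Qed.
Lemma upar_ok : ulift_ok (fun k => uC (par k)) (fun a => uG (par a)).
Proof.
split; first split.
- by move=> k l; rewrite parD uCD.
- by move=> k l; rewrite parMK uCM.
- by rewrite (par_homog (homog1 K)).
- split=> [a b|k a|k a]; first by rewrite parD uGD.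
  + by rewrite parZ uGZl.
  + by rewrite par_rscale uGZr.
move=> i j a b ha hb; rewrite (par_homog ha) (par_homog hb).
rewrite (par_homog (homog_lbr _ _ _ _ ha hb)).
have GN e (d : g) : uG (sgn e d) = sgn e (uG d).
  case: e => //=; rewrite -scaleN1r uGZl uCN uC1 mulN1r //.
rewrite !GN (uG_lbr ha hb); case: (i); case: (j); rewrite /= ?opprK ?mulrN ?mulNr ?opprK ?opprD ?opprK //.
Qed.
Lemma uparC k : upar (uC k) = uC (par k). Proof. exact: (uliftC upar_ok). Qed.
Lemma uparG a : upar (uG a) = uG (par a). Proof. exact: (uliftG upar_ok). Qed.
Lemma uparD x y : upar (x + y) = upar x + upar y. Proof. exact: (uliftD upar_ok). Qed.
Lemma uparN x : upar (- x) = - upar x. Proof. exact: (uliftN upar_ok). Qed.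
Lemma uparM x y : upar (x * y) = upar x * upar y. Proof. exact: (uliftM upar_ok). Qed.
Lemma uparK x : upar (upar x) = x.
Proof.
elim/U_ind: x => [k|a|x y Hx Hy|x Hx|x y Hx Hy].
- by rewrite !uparC parK.
- by rewrite !uparG parK.
- by rewrite !uparD Hx Hy.
- by rewrite !uparN Hx.
- by rewrite !uparM Hx Hy.
Qed.
Lemma upar_sgn b x : upar (sgn b x) = sgn b (upar x).
Proof. by case: b; rewrite //= uparN. Qed.

Fact uhc_key : unit. Proof. exact: tt. Qed.
Definition uhc : bool -> U -> U :=
  locked_with uhc_key (fun i x => half K *: (x + sgn i (upar x))).
Lemma uhc_def i x : uhc i x = half K *: (x + sgn i (upar x)).
Proof. by rewrite /uhc unlock. Qed.
Fact uhcD i x y : uhc i (x + y) = uhc i x + uhc i y.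
Proof. by rewrite !uhc_def uparD sgnD addrACA scalerDr. Qed.
Lemma upar_hc i x : upar (uhc i x) = sgn i (uhc i x).
Proof.
rewrite uhc_def {1}uscaleE uparM uparC par_half uparD upar_sgn uparK -uscaleE.
by rewrite -sgnZr sgnD sgnsgn addbb addrC.
Qed.
Lemma uhcP i x : upar x = sgn i x -> uhc i x = x.
Proof. by rewrite uhc_def => ->; rewrite sgnsgn addbb halfD. Qed.
Fact uhcK i j x : uhc i (uhc j x) = if i == j then uhc j x else 0.
Proof.
case: eqP => [->|/eqP ij]; first exact/uhcP/upar_hc.
rewrite uhc_def upar_hc sgnsgn; have -> : i (+) j = true by case: i j ij => [] [].
by rewrite subrr scaler0.
Qed.
Fact uhcE x : uhc false x + uhc true x = x.
Proof. by rewrite !uhc_def -scalerDr addrACA subrr addr0 halfD. Qed.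
HB.instance Definition _ := isGraded.Build U uhcD uhcK uhcE.

Lemma parU x : par x = upar x.
Proof.
by rewrite parE -[in RHS](uhcE x) uparD !upar_hc.
Qed.
Lemma U_homogP i (x : U) : homog i x <-> upar x = sgn i x.
Proof. by split=> [/par_homog|/uhcP//]; rewrite parU. Qed.

Lemma homogMU i j (x y : U) : homog i x -> homog j y -> homog (i (+) j) (x * y).
Proof.
move=> /U_homogP hx /U_homogP hy; apply/U_homogP; rewrite uparM hx hy.
by case: (i); case: (j); rewrite /= ?mulNr ?mulrN ?opprK.
Qed.
Lemma homog_uC i k : homog i k -> homog i (uC k).
Proof. by move=> hk; apply/U_homogP; rewrite uparC (par_homog hk) uC_sgn. Qed.
Lemma uG_sgn b a : uG (sgn b a) = sgn b (uG a).
Proof. by case: b => //=; rewrite -scaleN1r uGZl uCN uC1 mulN1r. Qed.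
Lemma homog_uG i a : homog i a -> homog i (uG a).
Proof. by move=> ha; apply/U_homogP; rewrite uparG (par_homog ha) uG_sgn. Qed.

Fact U_homogZ i j (k : K) (x : U) : hc i k = k -> hc j x = x ->
  hc (i (+) j) (k *: x) = k *: x.
Proof. by move=> hk hx; apply: homogMU => //; apply: homog_uC. Qed.
HB.instance Definition _ := isSuperMod.Build K U U_homogZ.

Lemma parMU (x y : U) : par (x * y) = par x * par y.
Proof. by rewrite !parU uparM. Qed.
Lemma urscaleE (x : U) k : x *:> k = x * uC k.
Proof.
elim/homog_ind: k => [k l Hk Hl|j k hk]; first by rewrite rscaleDr uCD mulrDr Hk Hl.
have E z : z *:> k = uC k * (if j then par z else z) :> U.
  rewrite rscaleE !(homog_hcE _ hk).
  by case: (j); rewrite /= scale0r ?add0r ?addr0 uscaleE.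
have ED z w : (z + w) *:> k = z *:> k + w *:> k := rscaleDl z w k.
elim/U_ind: x => [l|a|x y Hx Hy|x Hx|x y Hx Hy].
- rewrite -uCM E; elim/homog_ind: l => [l m Hl Hm|i l hl].
    rewrite -E uCD ED !E Hl Hm -uCD mulrDl //.
  rewrite (par_homog (homog_uC hl)) (mulKC hl hk) uC_sgn uCM.
  by case: (j); case: (i); rewrite /= ?mulrN.
- rewrite E -uGZr rscaleE !(homog_hcE _ hk) parU uparG.
  by case: (j); rewrite /= scale0r ?add0r ?addr0 uGZl.
- by rewrite ED Hx Hy mulrDl.
- by rewrite rscaleNl Hx mulNr.
- rewrite -mulrA -Hy E E.
  have := Hx; rewrite E => Hx'.
  case: (j) Hx' => Hx'; last by rewrite !mulrA Hx'.
  by rewrite parMU !mulrA Hx'.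
Qed.
End Enveloping.

Arguments uC {K g}.
Arguments uG {K g}.

Definition umap (K : superComAlgType) (g g' : lieSuperType K) (f : g -> g') :
  U g -> U g' := ulift uC (fun a => uG (f a)).

(* Tensor products: formal sums of pairs, i.e. sequences, modulo biadditivity
   and the identifications m (x) n = m' (x) n' for R (m, n) (m', n'). *)
Inductive tcong (M N : zmodType) (R : M * N -> M * N -> Prop) :
    seq (M * N) -> seq (M * N) -> Prop :=
  | tc_refl p : tcong R p p
  | tc_sym p q : tcong R p q -> tcong R q p
  | tc_trans p q r : tcong R p q -> tcong R q r -> tcong R p r
  | tc_cat p p' q q' : tcong R p p' -> tcong R q q' -> tcong R (p ++ q) (p' ++ q')
  | tc_catC p q : tcong R (p ++ q) (q ++ p)
  | tc_addl m m' n : tcong R [:: (m + m', n)] [:: (m, n); (m', n)]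
  | tc_addr m n n' : tcong R [:: (m, n + n')] [:: (m, n); (m, n')]
  | tc_0l n : tcong R [:: (0, n)] [::]
  | tc_0r m : tcong R [:: (m, 0)] [::]
  | tc_rel p q : R p q -> tcong R [:: p] [:: q].

Section Tensor.
Variables (M N : zmodType) (R : M * N -> M * N -> Prop).

Definition tcongb : rel (seq (M * N)) := fun p q => `[< tcong R p q >].
Fact tcongb_refl : reflexive tcongb.
Proof. by move=> t; apply/asboolP/tc_refl. Qed.
Fact tcongb_sym : symmetric tcongb.
Proof. by move=> t u; apply/asboolP/asboolP; apply: tc_sym. Qed.
Fact tcongb_trans : transitive tcongb.
Proof. by move=> u t v /asboolP tu /asboolP uv; apply/asboolP/(tc_trans tu uv). Qed.
Canonical tcong_equiv := EquivRel tcongb tcongb_refl tcongb_sym tcongb_trans.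

Definition tensor : Type := {eq_quot tcong_equiv}.
HB.instance Definition _ := Choice.on tensor.
HB.instance Definition _ := EqQuotient.on tensor.

Definition tpi (p : seq (M * N)) : tensor := \pi_tensor p.
Lemma tpiE p q : tcong R p q -> tpi p = tpi q.
Proof. by move=> h; apply/eqmodP/asboolP. Qed.
Lemma tpiP p q : tpi p = tpi q -> tcong R p q.
Proof. by move=> /eqmodP/asboolP. Qed.
Lemma tpiK x : tpi (repr x) = x.
Proof. exact: reprK. Qed.
Lemma repr_tpi p : tcong R (repr (tpi p)) p.
Proof. by apply: tpiP; rewrite tpiK. Qed.
Lemma tpi_surj x : exists p, x = tpi p.
Proof. by exists (repr x); rewrite tpiK. Qed.

Definition sneg (p : seq (M * N)) := [seq (- u.1, u.2) | u <- p].
Definition tadd (x y : tensor) : tensor := tpi (repr x ++ repr y).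
Definition topp (x : tensor) : tensor := tpi (sneg (repr x)).

Lemma tpi_add p q : tpi (p ++ q) = tadd (tpi p) (tpi q).
Proof. by apply/tpiE/tc_cat; apply/tc_sym/repr_tpi. Qed.

Fact taddA : associative tadd.
Proof.
move=> x y z; case: (tpi_surj x) (tpi_surj y) (tpi_surj z) => [t ->] [u ->] [v ->].
by rewrite -!tpi_add catA.
Qed.
Fact taddC : commutative tadd.
Proof.
move=> x y; case: (tpi_surj x) (tpi_surj y) => [t ->] [u ->].
by rewrite -!tpi_add; apply/tpiE/tc_catC.
Qed.
Fact tadd0 : left_id (tpi [::]) tadd.
Proof. by move=> x; case: (tpi_surj x) => [t ->]; rewrite -tpi_add. Qed.

Lemma sneg_cat p : tpi (sneg p ++ p) = tpi [::].
Proof.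
elim: p => [|[m n] p IH] //=.
rewrite -cat1s -[(m, n) :: p]cat1s !tpi_add.
have e : tadd (tpi [:: (- m, n)]) (tpi [:: (m, n)]) = tpi [::].
  rewrite -tpi_add -(tpiE (tc_0l R n)) -[X in tpi [:: (X, n)]](addNr m).
  by symmetry; apply/tpiE/tc_addl.
rewrite [tadd (tpi (sneg p)) _]taddA [tadd (tpi (sneg p)) _]taddC -taddA taddA.
by rewrite e tadd0 -tpi_add.
Qed.
Fact taddN : left_inverse (tpi [::]) topp tadd.
Proof.
by move=> x; rewrite -[X in tadd _ X]tpiK /topp -tpi_add sneg_cat.
Qed.
HB.instance Definition _ := GRing.isZmodule.Build tensor taddA taddC tadd0 taddN.

(* m (x) n *)
Definition pure (m : M) (n : N) : tensor := tpi [:: (m, n)].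

Lemma tpiD p q : tpi (p ++ q) = tpi p + tpi q. Proof. exact: tpi_add. Qed.
Lemma pureDl m m' n : pure (m + m') n = pure m n + pure m' n.
Proof. by rewrite -tpiD; apply/tpiE/tc_addl. Qed.
Lemma pureDr m n n' : pure m (n + n') = pure m n + pure m n'.
Proof. by rewrite -tpiD; apply/tpiE/tc_addr. Qed.
Lemma pure0l n : pure 0 n = 0.
Proof. by apply: (@addrI _ (pure 0 n)); rewrite -pureDl !addr0. Qed.
Lemma pure0r m : pure m 0 = 0.
Proof. by apply: (@addrI _ (pure m 0)); rewrite -pureDr !addr0. Qed.
Lemma pureNl m n : pure (- m) n = - pure m n.
Proof. by apply: (@addrI _ (pure m n)); rewrite -pureDl !subrr pure0l. Qed.
Lemma pureNr m n : pure m (- n) = - pure m n.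
Proof. by apply: (@addrI _ (pure m n)); rewrite -pureDr !subrr pure0r. Qed.
Lemma pure_rel m n m' n' : R (m, n) (m', n') -> pure m n = pure m' n'.
Proof. by move=> h; apply/tpiE/tc_rel. Qed.

Lemma tensor_ind (P : tensor -> Prop) :
  P 0 -> (forall m n, P (pure m n)) -> (forall x y, P x -> P y -> P (x + y)) ->
  forall x, P x.
Proof.
move=> P0 Pp PD x; case: (tpi_surj x) => p ->.
elim: p => [|[m n] p IH]; first exact: P0.
by rewrite -cat1s tpiD; apply: PD IH; apply: Pp.
Qed.

Section TensorLift.
Variables (G : zmodType) (f : M -> N -> G).

(* \sum_i f m_i n_i, where \sum_i m_i (x) n_i is any expression of x. *)
Definition tlift (x : tensor) : G := \sum_(u <- repr x) f u.1 u.2.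

Definition tlift_ok : Prop :=
  [/\ forall m m' n, f (m + m') n = f m n + f m' n,
      forall m n n', f m (n + n') = f m n + f m n'
    & forall m n m' n', R (m, n) (m', n') -> f m n = f m' n'].
Hypothesis ok : tlift_ok.

Lemma tsum_cong p q : tcong R p q ->
  \sum_(u <- p) f u.1 u.2 = \sum_(u <- q) f u.1 u.2.
Proof.
case: ok => [fDl fDr fR].
elim=> //= {p q}.
- by move=> p q r _ -> _ ->.
- by move=> p p' q q' _ Hp _ Hq; rewrite !big_cat /= Hp Hq.
- by move=> p q; rewrite !big_cat /= addrC.
- by move=> m m' n; rewrite !big_cons !big_nil /= fDl !addr0.
- by move=> m n n'; rewrite !big_cons !big_nil /= fDr !addr0.
- move=> n; rewrite big_cons big_nil addr0 /=.
  by apply: (@addrI _ (f 0 n)); rewrite -fDl !addr0.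
- move=> m; rewrite big_cons big_nil addr0 /=.
  by apply: (@addrI _ (f m 0)); rewrite -fDr !addr0.
- by move=> [m n] [m' n'] h; rewrite !big_cons !big_nil /= (fR _ _ _ _ h).
Qed.
Lemma tlift_tpi p : tlift (tpi p) = \sum_(u <- p) f u.1 u.2.
Proof. exact/tsum_cong/repr_tpi. Qed.
Lemma tlift_pure m n : tlift (pure m n) = f m n.
Proof. by rewrite tlift_tpi big_cons big_nil addr0. Qed.
Lemma tliftD x y : tlift (x + y) = tlift x + tlift y.
Proof.
case: (tpi_surj x) (tpi_surj y) => [p ->] [q ->].
by rewrite -tpiD !tlift_tpi big_cat.
Qed.
Lemma tlift0 : tlift 0 = 0.
Proof. by rewrite -[0]/(tpi [::]) tlift_tpi big_nil. Qed.
End TensorLift.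
End Tensor.

(* The identifications m k (x) n = m (x) k n of M (x)_K N. *)
Definition Krel (K : superComAlgType) (M N : superModType K) (p q : M * N) : Prop :=
  exists k, p.1 = q.1 *:> k /\ q.2 = k *: p.2.

Notation "M *t N" := (tensor (@Krel _ M N)) (at level 40) : type_scope.
Notation pureK := (pure (@Krel _ _ _)).

Lemma addr_aux (V : zmodType) (P A B Q X Y : V) :
  P + A + (B + Q) - (X + B + (A + Y)) = P - X + (Q - Y).
Proof.
apply: (@addIr _ (X + B + (A + Y))); rewrite subrK [RHS]addrACA.
rewrite [P - X + _]addrA subrK [A + Y]addrC [Q - Y + _]addrA subrK.
by rewrite [LHS]addrACA [A + Q]addrC.
Qed.

Section TensorSquare.
Variables (K : superComAlgType) (g : lieSuperType K).

Definition UU : Type := U g *t U g.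
HB.instance Definition _ := GRing.Zmodule.on UU.

Lemma pureZ (x y : U g) k : pureK (x * uC k) y = pureK x (uC k * y).
Proof. by apply: pure_rel; exists k; rewrite /= urscaleE. Qed.

Lemma pureC k (y : U g) : pureK (uC k : U g) y = pureK (1 : U g) (uC k * y).
Proof. by rewrite -pureZ mul1r. Qed.

(* (a (x) b) (c (x) d) = \sum +- a c (x) b d *)
Definition tmul_pure (a b c d : U g) : UU :=
  \sum_(i : bool) \sum_(j : bool)
    sgn (i && j) (pureK (a * hc i c) (hc j b * d)).
Definition tmul (x y : UU) : UU :=
  tlift (fun a b => tlift (tmul_pure a b) y) x.

Lemma tmul_pureE a b c d : tmul_pure a b c d =
  pureK (a * c) (hc false b * d) + pureK (a * par c) (hc true b * d).
Proof.
rewrite /tmul_pure !sum_bool /= [par c]parE mulrBr pureDl pureNl.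
have -> : pureK (a * c) (hc false b * d) = pureK (a * hc false c) (hc false b * d)
    + pureK (a * hc true c) (hc false b * d) by rewrite -pureDl -mulrDr hcE.
by rewrite addrACA.
Qed.

Lemma uC_par (x : U g) k : x * uC k = uC (hc false k) * x + uC (hc true k) * par x.
Proof. by rewrite -urscaleE rscaleE !uscaleE. Qed.
Lemma uC_par' (x : U g) k : uC k * x = x * uC (hc false k) + par x * uC (hc true k).
Proof.
by rewrite !uC_par !hcK /= uC0 !mul0r addr0 add0r parK -mulrDl -uCD hcE.
Qed.
Lemma uC_even (x : U g) k : hc false x * uC k = uC k * hc false x.
Proof. by rewrite uC_par par_hc /= -mulrDl -uCD hcE. Qed.
Lemma uC_odd (x : U g) k : hc true x * uC k = uC (par k) * hc true x.
Proof. by rewrite uC_par par_hc /= mulrN -mulrBl parE uCD uCN. Qed.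
Lemma hcZ i (x : U g) k : hc i (uC k * x) =
  uC (hc false k) * hc i x + uC (hc true k) * hc (~~ i) x.
Proof.
rewrite -{1}(hcE k) -{1}(hcE x) uCD mulrDl !mulrDr !hcD.
have H l j : homog (l (+) j) (uC (hc l k) * hc j x).
  by apply: homogMU; [apply: homog_uC; apply: homog_hc|apply: homog_hc].
rewrite !(homog_hcE _ (H _ _)).
by case: (i); rewrite /= ?addr0 ?add0r.
Qed.

Lemma par_uC k : par (uC k : U g) = uC (par k).
Proof. by rewrite parU uparC. Qed.

Lemma tmul_ok1 a b : tlift_ok (@Krel K (U g) (U g)) (tmul_pure a b).
Proof.
split=> [m m' n|m n n'|m n m' n' [k /= [-> ->]]]; rewrite !tmul_pureE.
- by rewrite parD !mulrDr !pureDl addrACA.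
- by rewrite !mulrDr !pureDr addrACA.
rewrite urscaleE uscaleE parMU par_uC !mulrA !pureZ !mulrA uC_even uC_odd. done.

Qed.

Lemma tmul_pureDl a a' b c d :
  tmul_pure (a + a') b c d = tmul_pure a b c d + tmul_pure a' b c d.
Proof. by rewrite !tmul_pureE !mulrDl !pureDl addrACA. Qed.
Lemma tmul_pureDr a b b' c d :
  tmul_pure a (b + b') c d = tmul_pure a b c d + tmul_pure a b' c d.
Proof. by rewrite !tmul_pureE !hcD !mulrDl !pureDr addrACA. Qed.
Lemma tmul_pureK a b k c d :
  tmul_pure (a * uC k) b c d = tmul_pure a (uC k * b) c d.
Proof.
rewrite !tmul_pureE !hcZ !mulrDl !pureDr -!mulrA.
rewrite (uC_par' c) (uC_par' (par c)) parK !mulrDr !pureDl !mulrA !pureZ !mulrA.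
by rewrite /= [X in _ + X = _]addrC addrACA; congr (_ + _); rewrite addrC.
Qed.

Lemma tmul_ok2 (y : UU) : tlift_ok (@Krel K (U g) (U g)) (fun a b => tlift (tmul_pure a b) y).
Proof.
split=> [m m' n|m n n'|m n m' n' [k /= [-> ->]]].
- by rewrite /tlift -big_split; apply: eq_bigr => u _; rewrite tmul_pureDl.
- by rewrite /tlift -big_split; apply: eq_bigr => u _; rewrite tmul_pureDr.
by rewrite /tlift; apply: eq_bigr => u _; rewrite urscaleE tmul_pureK.
Qed.

Lemma tmul_purepure a b c d : tmul (pureK a b) (pureK c d) = tmul_pure a b c d.
Proof. by rewrite /tmul (tlift_pure (tmul_ok2 _)) (tlift_pure (tmul_ok1 _ _)). Qed.
Fact tmulDl : left_distributive tmul +%R.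
Proof. by move=> x y z; rewrite /tmul (tliftD (tmul_ok2 _)). Qed.
Fact tmulDr : right_distributive tmul +%R.
Proof.
move=> x y z; rewrite /tmul -big_split; apply: eq_bigr => u _.
by rewrite (tliftD (tmul_ok1 _ _)).
Qed.
Lemma tmul0l y : tmul 0 y = 0.
Proof. by apply: (@addrI _ (tmul 0 y)); rewrite -tmulDl !addr0. Qed.
Lemma tmul0r y : tmul y 0 = 0.
Proof. by apply: (@addrI _ (tmul y 0)); rewrite -tmulDr !addr0. Qed.

Lemma hcM_homog i j (x y : U g) : homog j x -> hc i (x * y) = x * hc (i (+) j) y.
Proof.
move=> hx; rewrite -{1}(hcE y) mulrDr hcD.
rewrite (homog_hcE _ (homogMU hx (homog_hc _ _))).
rewrite (homog_hcE _ (homogMU hx (homog_hc _ _))).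
by case: (i); case: (j); rewrite /= ?addr0 ?add0r.
Qed.

Fact tmulA : associative tmul.
Proof.
move=> x y z; elim/tensor_ind: x => [|a b|x x' Hx Hx'].
- by rewrite !tmul0l.
- elim/tensor_ind: y => [|c d|y y' Hy Hy'].
  + by rewrite !(tmul0l, tmul0r).
  + elim/tensor_ind: z => [|e f|z z' Hz Hz'].
    * by rewrite !tmul0r.
    * rewrite !(tmul_purepure, tmul_pureE) !tmulDr !tmulDl.
      rewrite !(tmul_purepure, tmul_pureE) !(hcM_homog _ _ (homog_hc _ _)) /=.
      rewrite !parMU parK !mulrA.
      by rewrite addrACA; congr (_ + _); rewrite addrC.
    * by rewrite !tmulDr Hz Hz'.
  + by rewrite !(tmulDl, tmulDr) Hy Hy'.
- by rewrite !tmulDl Hx Hx'.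
Qed.

Lemma homog1U : homog false (1 : U g).
Proof. by rewrite -uC1; apply: homog_uC; apply: homog1. Qed.
Lemma par1U : par (1 : U g) = 1.
Proof. exact: par_homog homog1U. Qed.

Fact tmul1l : left_id (pureK (1 : U g) (1 : U g)) tmul.
Proof.
move=> x; elim/tensor_ind: x => [|c d|x x' Hx Hx'].
- exact: tmul0r.
- rewrite tmul_purepure tmul_pureE !(homog_hcE _ homog1U) /=.
  by rewrite mul0r pure0r addr0 !mul1r.
- by rewrite tmulDr Hx Hx'.
Qed.
Fact tmul1r : right_id (pureK (1 : U g) (1 : U g)) tmul.
Proof.
move=> x; elim/tensor_ind: x => [|c d|x x' Hx Hx'].
- exact: tmul0l.
- rewrite tmul_purepure tmul_pureE par1U !mulr1 -pureDr.
  by rewrite hcE.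
- by rewrite tmulDl Hx Hx'.
Qed.
HB.instance Definition _ := GRing.Zmodule_isPzRing.Build UU
  tmulA tmul1l tmul1r tmulDl tmulDr.

Lemma UU_mulE a b c d : (pureK a b : UU) * (pureK c d : UU) =
  pureK (a * c) (hc false b * d) + pureK (a * par c) (hc true b * d).
Proof. by rewrite -tmul_pureE -tmul_purepure. Qed.

(* The coproduct: the algebra morphism for which the elements of g are
   primitive. *)
Definition coprodC (k : K) : UU := pureK (uC k : U g) (1 : U g).
Definition coprodG (a : g) : UU := pureK (uG a : U g) (1 : U g) + pureK (1 : U g) (uG a : U g).
Definition coprod : U g -> UU := ulift coprodC coprodG.

Lemma hc_uG i (a : g) : hc i (uG a : U g) = uG (hc i a).
Proof.
rewrite -{1}(hcE a) uGD hcD !(homog_hcE _ (homog_uG (homog_hc _ _))).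
by case: i; rewrite /= ?add0r ?addr0.
Qed.

Lemma coprod_ok : ulift_ok coprodC coprodG.
Proof.
have e1 := homog_hcE _ homog1U.
split; first split.
- by move=> k l; rewrite /coprodC uCD pureDl.
- move=> k l; rewrite /coprodC UU_mulE !e1 /= mul0r pure0r addr0 mul1r uCM //.
- by [].
- split=> [a b|k a|k a]; rewrite /coprodG /coprodC.
  + by rewrite uGD pureDl pureDr addrACA.
  + rewrite mulrDr !UU_mulE !e1 /= !mul0r !pure0r !addr0 !mul1r mulr1 uGZl.
    by rewrite pureC.
  + rewrite mulrDl !UU_mulE !e1 /= !mul0r !pure0r !addr0 !mul1r !mulr1 uGZr.
    by rewrite par_uC (pureC k) (pureC (par k)) -pureDr -uC_even -uC_odd -mulrDl hcE.
move=> i j a b ha hb; rewrite /coprodG (uG_lbr ha hb) !mulrDl !mulrDr !UU_mulE.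
rewrite !e1 /= !(homog_hcE _ (homog_uG ha)) !(homog_hcE _ (homog_uG hb)).
rewrite !(par_homog (homog_uG ha)) !(par_homog (homog_uG hb)) !par1U.
have pS e x y : pureK (sgn e x : U g) (y : U g) = sgn e (pureK x y : UU).
  by case: e; rewrite //= pureNl.
have pS' e x y : pureK (x : U g) (sgn e y : U g) = sgn e (pureK x y : UU).
  by case: e; rewrite //= pureNr.
rewrite !(mul1r, mulr1, mul0r, pure0r, addr0) pureDl pureDr pureNl pureNr pS pS'.
case: (i) (j) => [] [] /=;
  rewrite !(mul0r, pure0r, addr0, add0r, pS) /= ?addr_aux //.
by rewrite -(addr_aux _ (pureK (uG a) (uG b)) (- pureK (uG b) (uG a))) !pureNl !opprD !opprK.
Qed.
Lemma coprod_uC k : coprod (uC k) = pureK (uC k : U g) (1 : U g).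
Proof. exact: (uliftC coprod_ok). Qed.
Lemma coprod_uG a :
  coprod (uG a) = pureK (uG a : U g) (1 : U g) + pureK (1 : U g) (uG a : U g).
Proof. exact: (uliftG coprod_ok). Qed.
Lemma coprodD x y : coprod (x + y) = coprod x + coprod y.
Proof. exact: (uliftD coprod_ok). Qed.
Lemma coprodM x y : coprod (x * y) = coprod x * coprod y.
Proof. exact: (uliftM coprod_ok). Qed.

(* The counit: the algebra morphism vanishing on g. *)
Definition counit : U g -> K := ulift (fun k => k) (fun=> 0).

Lemma counit_ok : ulift_ok (fun k : K => k) (fun=> 0 : K) (g := g).
Proof.
split; [by split|split=> *; rewrite ?addr0 ?mulr0 ?mul0r //|].
by move=> *; rewrite mulr0 sgn0 subr0.
Qed.
Lemma counit_uC k : counit (uC k) = k. Proof. exact: (uliftC counit_ok). Qed.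
Lemma counit_uG a : counit (uG a) = 0. Proof. exact: (uliftG counit_ok). Qed.
Lemma counitD x y : counit (x + y) = counit x + counit y.
Proof. exact: (uliftD counit_ok). Qed.
Lemma counitM x y : counit (x * y) = counit x * counit y.
Proof. exact: (uliftM counit_ok). Qed.
End TensorSquare.

(* The symmetric algebra of M: for the zero bracket, the relations of the
   enveloping algebra reduce to a b = +- b a. *)
Notation SymAlg M := (U (abel M)).

Section GenericPoint.
Variables (K : superComAlgType) (M : superModType K).

Definition symG (m : M) : SymAlg M := uG (m : abel M).

(* The projection of S(M) onto M = S^1(M); on products it is given by
   y(w w') = eps(w) y(w') + y(w) eps(w'). *)
Fixpoint gpt_term (t : uterm K (abel M)) : M :=
  match t with
  | Cst _ => 0
  | Gen a => a
  | Add t u => gpt_term t + gpt_term u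
  | Opp t => - gpt_term t
  | Mul t u => counit (upi t) *: gpt_term u + gpt_term t *:> counit (upi u)
  end.
Definition gpt (w : SymAlg M) : M := gpt_term (repr w).

Lemma gpt_cong t u : ucong t u -> gpt_term t = gpt_term u.
Proof.
elim=> //= {t u}.
- by move=> t u v _ -> _ ->.
- by move=> t t' u u' _ -> _ ->.
- by move=> t t' _ ->.
- by move=> t t' u u' tt -> uu ->; rewrite (upiE tt) (upiE uu).
- by move=> t u v; rewrite addrA.
- by move=> t u; rewrite addrC.
- by move=> t; rewrite add0r.
- by move=> t; rewrite addNr.
- move=> t u v; rewrite !upiM !counitM scalerDr rscaleDl scalerA rscaleZ rscaleA.
  by rewrite addrA.
- by move=> t; rewrite counit_uC scale1r rscale0l addr0.
- by move=> t; rewrite counit_uC scaler0 rscale1 add0r.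
- move=> t u v; rewrite upiD counitD scalerDl rscaleDl.
  by rewrite addrACA.
- move=> t u v; rewrite upiD counitD scalerDr rscaleDr.
  by rewrite addrACA.
- by move=> k l; rewrite addr0.
- by move=> k l; rewrite scaler0 rscale0l addr0.
- by move=> k a; rewrite counit_uC counit_uG rscale0l addr0.
- by move=> k a; rewrite counit_uC counit_uG scaler0 add0r.
- move=> i j a b ha hb; rewrite upiM counitM !counit_uG.
  by rewrite mul0r !scale0r !rscale0r !addr0 scaler0 subrr.
Qed.
Lemma gpt_upi t : gpt (upi t) = gpt_term t.
Proof. exact/gpt_cong/repr_upi. Qed.
Lemma gpt_uC k : gpt (uC k) = 0. Proof. exact: gpt_upi. Qed.
Lemma gpt_symG m : gpt (symG m) = m. Proof. exact: gpt_upi. Qed.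
Lemma gptD v w : gpt (v + w) = gpt v + gpt w.
Proof.
by case: (upi_surj v) (upi_surj w) => [t ->] [u ->]; rewrite -upiD !gpt_upi.
Qed.
Lemma gptM v w : gpt (v * w) = counit v *: gpt w + gpt v *:> counit w.
Proof.
by case: (upi_surj v) (upi_surj w) => [t ->] [u ->]; rewrite -upiM !gpt_upi.
Qed.
Lemma gpt_prod n (a : 'I_n -> M) : n != 1%N -> gpt (\prod_(i < n) symG (a i)) = 0.
Proof.
case: n a => [|[|n]] a // _; first by rewrite big_ord0 gpt_uC.
rewrite big_ord_recl gptM counit_uG scale0r add0r.
by rewrite big_ord_recl counitM counit_uG mul0r rscale0r.
Qed.
End GenericPoint.

Section Functions.
Variables (K : superComAlgType) (M : superModType K).

(* \sum f w_i w'_i *)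
Definition sweedler (G : zmodType) (f : SymAlg M -> SymAlg M -> G)
  (w : SymAlg M) : G := tlift f (coprod w).

(* \sum +- B(w_i, psi(w'_i)), psi moving past w_i *)
Definition sconv (N : superModType K) (G : zmodType) (B : SymAlg M -> N -> G)
    (psi : SymAlg M -> N) : SymAlg M -> G :=
  sweedler (fun v v' => \sum_(i : bool) \sum_(j : bool)
    sgn (i && j) (B (hc i v) (homc j psi v'))).

(* The coderivation c_alpha. *)
Definition cod (alpha : SymAlg M -> M) : SymAlg M -> SymAlg M :=
  sweedler (fun v v' => symG (alpha v) * v').

Definition Flbr (g : lieSuperType K) (phi psi : SymAlg M -> g) :
  SymAlg M -> g := sconv (fun v b => lbr (phi v) b) psi.

Definition Fconst (N : superModType K) (a : N) (w : SymAlg M) : N :=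
  a *:> counit w.

(* f(ad y)(a), a sum which is finite on each w *)
Definition ad_series (g : lieSuperType K) (y : SymAlg M -> g) (f : nat -> rat)
    (a : g) (w : SymAlg M) : g :=
  \sum_(n \in [set: nat]) qinj (f n) *: iter n (Flbr y) (Fconst a) w.
End Functions.

(* Quotient of formal power series, v 0 != 0; see fdivP. *)
Fixpoint fdiv_seq (u v : nat -> rat) (n : nat) : seq rat :=
  if n is m.+1 then
    let c := fdiv_seq u v m in
    rcons c ((u m - \sum_(k < m) c`_k * v (m - k)%N) / v 0%N)
  else [::].
Definition fdiv (u v : nat -> rat) (n : nat) : rat := (fdiv_seq u v n.+1)`_n.

Lemma size_fdiv_seq u v n : size (fdiv_seq u v n) = n.
Proof. by elim: n => //= n IH; rewrite size_rcons IH. Qed.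
Lemma nth_fdiv_seq u v n k : (k < n)%N -> (fdiv_seq u v n)`_k = fdiv u v k.
Proof.
elim: n => //= n IH; rewrite ltnS leq_eqVlt => /orP[/eqP->|kn].
  by [].
by rewrite nth_rcons size_fdiv_seq kn IH.
Qed.
Lemma fdivE u v n :
  fdiv u v n = (u n - \sum_(k < n) fdiv u v k * v (n - k)%N) / v 0%N.
Proof.
rewrite {1}/fdiv /= nth_rcons size_fdiv_seq ltnn eqxx.
by do 2 f_equal; congr (- _); apply: eq_bigr => k _; rewrite nth_fdiv_seq.
Qed.
Lemma fdivP u v n : v 0%N != 0 ->
  \sum_(k < n.+1) fdiv u v k * v (n - k)%N = u n.
Proof.
move=> v0; rewrite big_ord_recr /= subnn [X in X * v 0%N]fdivE.
by rewrite mulfVK // addrC subrK.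
Qed.
Lemma fdiv_parity (d : bool) u v : (forall n, odd n != d -> u n = 0) ->
  (forall n, odd n -> v n = 0) -> forall n, odd n != d -> fdiv u v n = 0.
Proof.
move=> hu hv n; elim/ltn_ind: n => n IH hn; rewrite fdivE hu // sub0r.
rewrite big1 ?oppr0 ?mul0r // => k _.
have [hk|hk] := eqVneq (odd k) d; last by rewrite IH ?mul0r.
rewrite (hv (n - k)%N) ?mulr0 // oddB ?(ltnW (ltn_ord k)) // hk.
by case: (odd n) (d) hn => [] [].
Qed.

(* t coth t = cosh t / (sinh t / t) and - tanh (t / 2) *)
Definition p1_series : nat -> rat :=
  fdiv (fun n => if odd n then 0 else n`!%:R^-1)
       (fun n => if odd n then 0 else n.+1`!%:R^-1).
Definition q1_series (n : nat) : rat :=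
  - fdiv (fun n => if odd n then 2%:R^-1 ^+ n / n`!%:R else 0)
         (fun n => if odd n then 0 else 2%:R^-1 ^+ n / n`!%:R) n.

Lemma p1_series_odd n : odd n -> p1_series n = 0.
Proof.
move=> hn; apply: (@fdiv_parity false); last by rewrite hn.
  by move=> m; case: (odd m).
by move=> m ->.
Qed.
Lemma q1_series_even n : ~~ odd n -> q1_series n = 0.
Proof.
move=> hn; rewrite /q1_series (@fdiv_parity true) ?oppr0 ?(negbTE hn) //.
  by move=> m; case: (odd m).
by move=> m ->.
Qed.

(* The parity of the sign in a_0 ... a_(n-1) = +- a_(p 0) ... a_(p (n-1)) for
   supercommuting a_i of parity e_i. *)
Definition koszul_sign n (e : 'I_n -> bool) (p : 'S_n) : bool :=
  odd (\sum_(i < n) \sum_(j < n) [&& (i < j)%N, (p j < p i)%N, e (p i) & e (p j)]).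

(* The inverse of f, meaningful when f is bijective. *)
Definition linv (X Y : zmodType) (f : X -> Y) (y : Y) : X := xget 0 [set x | f x = y].

Section Symmetrization.
Variables (K : superComAlgType) (g : lieSuperType K).

Definition is_symmetrization (b : SymAlg g -> U g) : Prop :=
  right_linear b /\
  forall n (a : 'I_n -> g) (e : 'I_n -> bool), (forall i, homog (e i) (a i)) ->
    b (\prod_(i < n) symG (a i)) =
    qinj (n`!%:R^-1) *: \sum_(p : 'S_n) sgn (koszul_sign e p) (\prod_(i < n) uG (a (p i))).

(* The unique such map: products of homogeneous elements of g generate S(g)
   as a right K-module. *)
Definition symmetrization : SymAlg g -> U g := xget (fun=> 0) is_symmetrization.
End Symmetrization.

Section SymmetricPair.
Variables (K : superComAlgType) (g : lieSuperType K) (s : involution g).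
Notation h := (eig s false).
Notation q := (eig s true).

(* beta on S(q), through S(q) -> S(g). *)
Definition betaq (w : SymAlg q) : U g :=
  symmetrization (umap (val : abel q -> abel g) w).
Definition jh (u : U h) : U g := umap (val : h -> g) u.

Definition betabar : SymAlg q *t U h -> U g :=
  tlift (fun w u => betaq w * jh u).
Definition lbar (a : g) (x : SymAlg q *t U h) : SymAlg q *t U h :=
  linv betabar (uG a * betabar x).

(* The generic point y, as an element of F(q, g). *)
Definition gpt_q (w : SymAlg q) : g := val (gpt w).

Definition ph (a : g) : h := eig_proj s false a.
Definition pq (a : g) : q := eig_proj s true a.

(* ph a and pq a are the components of a in h and q. *)
Definition alpha1_val (a : g) (w : SymAlg q) : g :=
  Flbr (Fconst (val (ph a))) gpt_q w + ad_series gpt_q p1_series (val (pq a)) w.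
Definition theta1_val (a : g) (w : SymAlg q) : g :=
  Fconst (val (ph a)) w + ad_series gpt_q q1_series (val (pq a)) w.

Lemma inv_sum (I : Type) (r : seq I) (F : I -> g) :
  s (\sum_(i <- r) F i) = \sum_(i <- r) s (F i).
Proof. exact: (big_morph s (invD s) (inv0 s)). Qed.
Lemma sgn_sum (W : zmodType) b (I : Type) (r : seq I) (F : I -> W) :
  sgn b (\sum_(i <- r) F i) = \sum_(i <- r) sgn b (F i).
Proof. exact: (big_morph _ (sgnD b) (sgn0 W b)). Qed.

Lemma Flbr_eig d e (phi psi : SymAlg q -> g) :
  (forall w, s (phi w) = sgn d (phi w)) ->
  (forall w, s (psi w) = sgn e (psi w)) ->
  forall w, s (Flbr phi psi w) = sgn (d (+) e) (Flbr phi psi w).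
Proof.
move=> hphi hpsi w; rewrite /Flbr /sconv /sweedler /tlift inv_sum sgn_sum.
apply: eq_bigr => u _; rewrite inv_sum sgn_sum; apply: eq_bigr => i _.
rewrite inv_sum sgn_sum; apply: eq_bigr => j _.
have hh v : s (homc j psi v) = sgn e (homc j psi v).
  rewrite /homc inv_sum sgn_sum; apply: eq_bigr => l _.
  by rewrite inv_hc hpsi hc_sgn.
have lS b c x y : lbr (sgn b x) (sgn c y) = sgn (b (+) c) (lbr x y) :> g.
  have NN x' y' : lbr (- x') y' = - lbr x' y' :> g.
    by rewrite -scaleN1r lbrZl scaleN1r.
  have NR x' y' : lbr x' (- y') = - lbr x' y' :> g.
    have r1 (z : g) : z *:> (- 1) = - z by rewrite rscaleNr rscale1.
    by rewrite -r1 lbrZr r1.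
  by case: b; case: c; rewrite /= ?NN ?NR ?opprK.
by rewrite inv_sgn inv_lbr hphi hh lS !sgnsgn addbC.
Qed.

Lemma Fconst_eig d (a : g) (w : SymAlg q) :
  s a = sgn d a -> s (Fconst a w) = sgn d (Fconst a w).
Proof.
move=> ha; rewrite /Fconst !rscaleE invD !invZ sgnD -!sgnZr -par_sgn -ha.
by rewrite !parE invD invN !inv_hc.
Qed.

Lemma ad_series_eig d e f (a : g) : s a = sgn d a ->
  (forall n, odd n != e -> f n = 0) ->
  forall w, s (ad_series gpt_q f a w) = sgn (d (+) e) (ad_series gpt_q f a w).
Proof.
move=> ha hf w; rewrite /ad_series inv_sum sgn_sum; apply: eq_bigr => n _.
have [hn|/hf ->] := eqVneq (odd n) e; last by rewrite qinj0 scale0r inv0 sgn0.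
rewrite invZ -sgnZr -{}hn; congr (_ *: _).
elim: n w => [|n IH] w.
  by rewrite /= addbF (Fconst_eig w ha).
rewrite iterS (Flbr_eig (d := true) _ IH); first by rewrite oddS; case: (d); case: odd.
by move=> v; rewrite /gpt_q eigE.
Qed.

(* alpha1_val a and theta1_val a take their values in q and h: see val_alpha1
   and val_theta1. *)
Definition alpha1 (a : g) (w : SymAlg q) : q := pq (alpha1_val a w).
Definition theta1 (a : g) (w : SymAlg q) : h := ph (theta1_val a w).

Lemma val_alpha1 a w : val (alpha1 a w) = alpha1_val a w.
Proof.
apply: eig_projK; rewrite unfold_in /eig_pred /alpha1_val invD sgnD; apply/eqP.
congr (_ + _).
  apply: (Flbr_eig (d := false) (e := true)) => v; last by rewrite /gpt_q eigE.
  by apply: Fconst_eig; rewrite eigE.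
apply: (ad_series_eig (d := true) (e := false)); first by rewrite eigE.
by move=> n; case: (boolP (odd n)) => // hn _; rewrite p1_series_odd.
Qed.
Lemma val_theta1 a w : val (theta1 a w) = theta1_val a w.
Proof.
apply: eig_projK; rewrite unfold_in /eig_pred /theta1_val invD sgnD; apply/eqP.
congr (_ + _); first by apply: Fconst_eig; rewrite eigE.
apply: (ad_series_eig (d := true) (e := true)); first by rewrite eigE.
by move=> n; case: (boolP (odd n)) => // hn _; rewrite q1_series_even.
Qed.

(* alpha and theta are the data alpha_a, theta_a of a. *)
Definition left_data (a : g) (alpha : SymAlg q -> q) (theta : SymAlg q -> h) : Prop :=
  [/\ right_linear alpha, right_linear theta
    & forall w u, lbar a (pureK w u) =
        sconv (fun v m => pureK (v * symG m) u) alpha w +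
        sconv (fun v b => pureK v (uG b * u)) theta w].

Section Induced.
Variables (V : superModType K) (chi : lie_rep h V).

(* U(g) (x)_h V *)
Definition indrel (p p' : U g * V) : Prop :=
  Krel p p' \/ exists b : h, p.1 = p'.1 * uG (val b) /\ p'.2 = chi b p.2.
Definition indmod : zmodType := tensor indrel.
(* Left multiplication by a. *)
Definition lind (a : g) : indmod -> indmod :=
  tlift (fun u v => pure indrel (uG a * u) v).

Definition betabar_chi : SymAlg q *t V -> indmod :=
  tlift (fun w v => pure indrel (betaq w) v).
Definition lbar_chi (a : g) (x : SymAlg q *t V) : SymAlg q *t V :=
  linv betabar_chi (lind a (betabar_chi x)).

Definition Theta1 (a : g) : SymAlg q *t V -> SymAlg q *t V :=
  tlift (fun w v => pureK (cod (alpha1 a) w) v +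
                    sconv (fun v' b => pureK v' (chi b v)) (theta1 a) w).
End Induced.
End SymmetricPair.

(* Main.v *)
Require Import Defs.
From mathcomp Require Import all_boot all_order all_algebra.
From HB Require Import structures.
From mathcomp Require Import perm boolp classical_sets functions fsbigop.
From mathcomp Require Import ring.
Import Defs.

(** Let y be the generic point of q, an even element of the Lie superalgebra
F(q, g). Under convolution, symmetrization restricted to S(q) is the exponential
e^y in F(q, U(g)), and composition with the coderivation of alpha is the derivation D
with D(y) = alpha. Since D(e^y) = e^y A(alpha), where A(alpha) = f(ad y)(alpha) and
f(t) = (1 - e^{-t}) / t, left multiplication by a is given by (alpha, theta) as soon as
  e^{-ad y}(a) = A(alpha) + theta.
This equation has at most one solution, because A(alpha) and alpha have the same
component of lowest degree and g = h (+) q; the series t coth t and - tanh(t/2) solve it.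
Hence Theta1 corresponds to left multiplication under beta.

That e^{-ad y} is a morphism, together with the zero curvature equation for A,
shows that the commutator of D_a and D_b comes from a solution of the equation for
[a, b], when D_a and D_b come from solutions for a and b. By uniqueness Theta1 is a representation of g on
S(q) (x) V, so that U(g) acts there, and acting on 1 (x) v provides a left inverse of
beta (x) id. This is the Poincare-Birkhoff-Witt theorem needed to invert it. *)

Set Implicit Arguments.
Unset Strict Implicit.
Unset Printing Implicit Defensive.
Import GRing.Theory.
Local Open Scope ring_scope.

(** The bracket relation for [Theta1] cannot be read off from left multiplication in U(g), since
    that would presuppose the injectivity of [betabar_chi]. The equation is therefore posed in F(q,
    g), before U(g) enters, where uniqueness is a matter of lowest degree. The modules need not be
    free over K, so ordered monomials are not at hand; the action on 1 (x) v takes their place.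

    Identities between exponentials are proved for e^{ty} with a formal t: a differential equation
    in t becomes a recursion on coefficients, whose factor n + 1 can be divided out because K is a
    Q-algebra. Where D occurs, indices are shifted by one, since D kills the constant term and a
    coderivation raises the degree by at most one.

    In the second assertion alpha and theta may have mixed parity and are split into components.
    Moreover theta is seen only through the canonical map h -> U(h), whose injectivity has to be
    proved too; it follows from the action constructed for the symmetric pair h x h with the
    exchange of factors. *)

(* parn j v is v with the sign of moving an object of parity j past it. Using it,
   the product of F, (phi psi)(w) = sum phi (parn j w_i) (psi w'_i) for psi of
   parity j, is written without signs depending on w_i. *)
Definition parn (M : gradedZmodType) (i : bool) (x : M) : M := if i then par x else x.

(** * Signs, torsion and additive maps *)

Section Parn.
Variable M : gradedZmodType.
Implicit Types (x y : M).

Lemma parnD i x y : parn i (x + y) = parn i x + parn i y.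
Proof. by case: i; rewrite //= parD. Qed.
Lemma parn_homog i j x : homog j x -> parn i x = sgn (i && j) x.
Proof. by move=> hx; case: i => //=; apply: par_homog. Qed.
Lemma parnn i j x : parn i (parn j x) = parn (i (+) j) x.
Proof. by case: i; case: j; rewrite /= ?parK. Qed.
Lemma par_parn i x : par (parn i x) = parn i (par x).
Proof. by case: i. Qed.
Lemma homog_parn i j x : homog j x -> homog j (parn i x).
Proof. by move=> hx; rewrite (parn_homog i hx); apply: homog_sgn. Qed.
Lemma hc_parn i j x : hc i (parn j x) = sgn (j && i) (hc i x).
Proof. by case: j; rewrite //= hc_par. Qed.
Lemma parn_hc i j x : parn j (hc i x) = sgn (j && i) (hc i x).
Proof. exact: parn_homog (homog_hc _ _). Qed.
End Parn.

Section Torsion.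
Variables (K : superComAlgType) (N : lmodType K).
Lemma mulrn_inj (x : N) n : x *+ n.+1 = 0 -> x = 0.
Proof.
move=> e; have : (qinj (n.+1%:R^-1) * qinj n.+1%:R : K) *: x = x.
  by rewrite -qinjM mulVf ?Num.Theory.pnatr_eq0 // qinj1 scale1r.
by rewrite -scalerA qinj_nat scaler_nat e scaler0.
Qed.
End Torsion.

(** The component of the wrong parity equals its opposite, so it vanishes as 2 is invertible.
    Homogeneity thus becomes an equation in [par], the form in which [fH] records the parity of a
    function. *)
Lemma homog_par (K : superComAlgType) (M : superModType K) i (x : M) :
  par x = sgn i x -> homog i x.
Proof.
move=> e; have hcx : hc (~~ i) x = 0.
  apply: (@mulrn_inj K _ _ 1); rewrite mulr2n.
  move/(congr1 (hc (~~ i))): e; rewrite hc_par hc_sgn.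
  by case: (i) => /= e; [rewrite {1}e|rewrite -{1}e]; rewrite addNr.
by rewrite /homog -[RHS](hcE x); case: (i) hcx => /= ->; rewrite ?add0r ?addr0.
Qed.

Lemma sgn_additive (V W : zmodType) (f : V -> W) b x :
  (forall x y, f (x + y) = f x + f y) -> f (sgn b x) = sgn b (f x).
Proof.
move=> fD; have f0 : f 0 = 0 by apply: (@addrI _ (f 0)); rewrite -fD !addr0.
by case: b => //=; apply: (@addrI _ (f x)); rewrite -fD !subrr f0.
Qed.
Lemma morph0 (V W : zmodType) (f : V -> W) :
  (forall x y, f (x + y) = f x + f y) -> f 0 = 0.
Proof. by move=> fD; apply: (@addrI _ (f 0)); rewrite -fD !addr0. Qed.
Lemma morphN (V W : zmodType) (f : V -> W) x :
  (forall x y, f (x + y) = f x + f y) -> f (- x) = - f x.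
Proof. by move=> fD; apply: (@addrI _ (f x)); rewrite -fD !subrr (morph0 fD). Qed.
Lemma morph_sum (V W : zmodType) (f : V -> W) (I : Type) (r : seq I) (F : I -> V) :
  (forall x y, f (x + y) = f x + f y) -> f (\sum_(i <- r) F i) = \sum_(i <- r) f (F i).
Proof. by move=> fD; apply: (big_morph f fD (morph0 fD)). Qed.

(** * The coproduct of S(M) *)

Lemma homog_uC_comm (K : superComAlgType) (g : lieSuperType K) i (x : U g) k :
  homog i x -> x * uC k = uC (parn i k) * x.
Proof.
move=> hx; rewrite uC_par (par_homog hx).
case: (i); rewrite /= ?mulrN -?mulNr -mulrDl -?uCN -uCD //.
  by rewrite parE.
by rewrite hcE.
Qed.

Section Sweedler.
Variables (K : superComAlgType) (M : superModType K).
Notation C := (SymAlg M).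

(** The condition for f to descend to the tensor product over K. Values lie in a bare abelian group,
    since [sweedler] is also used with targets that carry no K-module structure. *)
Definition bal (G : zmodType) (f : C -> C -> G) : Prop :=
  [/\ forall a a' b, f (a + a') b = f a b + f a' b,
      forall a b b', f a (b + b') = f a b + f a b'
    & forall a k b, f (a * uC k) b = f a (uC k * b)].

Definition bal3 (G : zmodType) (f : C -> C -> C -> G) : Prop :=
  [/\ forall a a' b c, f (a + a') b c = f a b c + f a' b c,
      forall a b b' c, f a (b + b') c = f a b c + f a b' c,
      forall a b c c', f a b (c + c') = f a b c + f a b c',
      forall a k b c, f (a * uC k) b c = f a (uC k * b) c
    & forall a b k c, f a (b * uC k) c = f a b (uC k * c)].

Lemma bal_ok (G : zmodType) (f : C -> C -> G) : bal f -> tlift_ok (@Krel K C C) f.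
Proof.
case=> fl fr fk; split=> // a b a' b' [k /= [-> ->]].
by rewrite urscaleE uscaleE fk.
Qed.

(** The elements of degree at most n. The constructors follow left multiplication by generators, so
    that induction on a derivation of [flt n w] handles the degree and the shape of w at once. *)
Inductive flt : nat -> C -> Prop :=
  | flt_C k : flt 0 (uC k)
  | flt_S n i x w : homog i x -> flt n w -> flt n.+1 (symG x * w)
  | flt_D n v w : flt n v -> flt n w -> flt n (v + w)
  | flt_W n w : flt n w -> flt n.+1 w.

Lemma flt_le m n w : (m <= n)%N -> flt m w -> flt n w.
Proof.
move=> /subnK <- hw; elim: (n - m)%N => [|p IH] //.
by rewrite addSn; apply: flt_W.
Qed.
Lemma flt_parn n i w : flt n w -> flt n (parn i w).
Proof.
case: i => //=; elim=> {n w}.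
- by move=> k; rewrite par_uC; apply: flt_C.
- move=> n i x w hx _ IH; rewrite parMU [par (symG x)]parU uparG.
  by rewrite (par_homog hx); apply: (flt_S (i := i)) => //; apply: homog_sgn.
- by move=> n v w _ Hv _ Hw; rewrite parD; apply: flt_D.
- by move=> n w _; apply: flt_W.
Qed.
Lemma symGD (x y : M) : symG (x + y) = symG x + symG y :> C.
Proof. exact: uGD. Qed.
Lemma symG_sgn b (x : M) : symG (sgn b x) = sgn b (symG x) :> C.
Proof. exact: uG_sgn. Qed.
Lemma symG0 : symG (0 : M) = 0.
Proof. exact: (morph0 symGD). Qed.
Lemma homog_symG i (x : M) : homog i x -> homog i (symG x : C).
Proof. by move=> hx; apply: (@homog_uG K (abel M)). Qed.
Lemma par_symG (x : M) : par (symG x : C) = symG (par x).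
Proof. by rewrite parU uparG. Qed.
Lemma flt_symG n x w : flt n w -> flt n.+1 (symG x * w).
Proof.
move=> hw; rewrite -(hcE x) symGD mulrDl.
by apply: flt_D; apply: (flt_S (homog_hc _ _)).
Qed.
Lemma flt0 n : flt n 0.
Proof. by apply: (@flt_le 0) => //; rewrite -(uC0 (abel M)); apply: flt_C. Qed.
Lemma flt_uCl n k w : flt n w -> flt n (uC k * w).
Proof.
move=> hw; elim: hw k => {n w}.
- by move=> l k; rewrite -uCM; apply: flt_C.
- move=> n i x w hx _ IH k; rewrite mulrA.
  have -> : uC k * symG x = symG x * uC (hc false k) + symG (par x) * uC (hc true k) :> C.
    by rewrite [LHS]uC_par' par_symG.
  by rewrite mulrDl -!mulrA; apply: flt_D; apply: flt_symG.
- by move=> n v w _ Hv _ Hw k; rewrite mulrDr; apply: flt_D.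
- by move=> n w _ H k; apply: flt_W.
Qed.
Lemma flt_uCr n k w : flt n w -> flt n (w * uC k).
Proof.
move=> hw; rewrite uC_par; apply: flt_D; apply: flt_uCl => //.
exact: (flt_parn true).
Qed.
Lemma fltN n w : flt n w -> flt n (- w).
Proof. by move=> hw; rewrite -mulN1r -uC1 -uCN; apply: flt_uCl. Qed.
Lemma flt_mul m n v w : flt m v -> flt n w -> flt (m + n) (v * w).
Proof.
move=> hv; elim: hv n w => {m v}.
- by move=> k n w hw; apply: flt_uCl.
- by move=> m i x v hx _ IH n w hw; rewrite -mulrA addSn; apply: (flt_S hx); apply: IH.
- by move=> m v v' _ H _ H' n w hw; rewrite mulrDl; apply: flt_D; [apply: H|apply: H'].
- by move=> m v _ H n w hw; rewrite addSn; apply: flt_W; apply: H.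
Qed.
Lemma flt_ex w : exists n, flt n w.
Proof.
elim/U_ind: w => [k|a|x y [m Hx] [n Hy]|x [n Hx]|x y [m Hx] [n Hy]].
- by exists 0%N; apply: flt_C.
- by exists 1%N; rewrite -[uG a]mulr1 -uC1; apply: flt_symG; apply: flt_C.
- exists (m + n)%N; apply: flt_D; [apply: flt_le Hx|apply: flt_le Hy].
    exact: leq_addr.
  exact: leq_addl.
- by exists n; apply: fltN.
- by exists (m + n)%N; apply: flt_mul.
Qed.

(** The induction behind the coalgebra identities: [sw_symG] expresses the coproduct of [symG x * w]
    through that of w. *)
Lemma sym_ind (P : C -> Prop) :
  (forall k, P (uC k)) -> (forall v w, P v -> P w -> P (v + w)) ->
  (forall i x w, homog i x -> P w -> P (symG x * w)) -> forall w, P w.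
Proof.
move=> PC PD PS w; have [n] := flt_ex w.
by elim=> {n w} // [n i x w hx _|n v w _ Hv _]; [apply: PS hx|apply: PD].
Qed.

Section Sw.
Variables (G : zmodType).
Implicit Types (f : C -> C -> G) (w : C).

Lemma swE f w : sweedler f w = \sum_(u <- repr (coprod w)) f u.1 u.2.
Proof. by []. Qed.
Lemma sw_addf f f' w :
  sweedler (fun a b => f a b + f' a b) w = sweedler f w + sweedler f' w.
Proof. by rewrite !swE big_split. Qed.
Lemma sw_oppf f w : sweedler (fun a b => - f a b) w = - sweedler f w.
Proof. by rewrite !swE sumrN. Qed.
Lemma sw_sgnf b f w : sweedler (fun x y => sgn b (f x y)) w = sgn b (sweedler f w).
Proof. by case: b => //=; apply: sw_oppf. Qed.
Lemma sw_eq f f' w : (forall a b, f a b = f' a b) -> sweedler f w = sweedler f' w.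
Proof. by move=> e; rewrite !swE; apply: eq_bigr => u _. Qed.
Lemma sw_morph (H : zmodType) (h : G -> H) f w : (forall x y, h (x + y) = h x + h y) ->
  h (sweedler f w) = sweedler (fun a b => h (f a b)) w.
Proof. by move=> hD; rewrite !swE (morph_sum _ _ hD). Qed.
Lemma sw_homog f f' w :
  (forall a a' b, f (a + a') b = f a b + f a' b) ->
  (forall a b b', f a (b + b') = f a b + f a b') ->
  (forall a a' b, f' (a + a') b = f' a b + f' a' b) ->
  (forall a b b', f' a (b + b') = f' a b + f' a b') ->
  (forall i j a b, homog i a -> homog j b -> f a b = f' a b) ->
  sweedler f w = sweedler f' w.
Proof.
move=> fl fr fl' fr' e; apply: sw_eq => a b.
rewrite -(hcE a) -(hcE b) !(fl, fr, fl', fr').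
by rewrite !(e _ _ _ _ (homog_hc _ _) (homog_hc _ _)).
Qed.

Variable f : C -> C -> G.
Hypothesis fb : bal f.

Lemma swD v w : sweedler f (v + w) = sweedler f v + sweedler f w.
Proof. by rewrite /sweedler coprodD (tliftD (bal_ok fb)). Qed.
Lemma sw_uC k : sweedler f (uC k) = f (uC k) 1.
Proof. by rewrite /sweedler coprod_uC (tlift_pure (bal_ok fb)). Qed.
Lemma sw_1 : sweedler f 1 = f 1 1.
Proof. by rewrite -{1}uC1 sw_uC. Qed.

End Sw.

Lemma bal_comp1 (G : zmodType) (f : C -> C -> G) (F : C -> C) : bal f ->
  (forall a b, F (a + b) = F a + F b) -> (forall a k, F (a * uC k) = F a * uC k) ->
  bal (fun a b => f (F a) b).
Proof.
by case=> fl fr fk FD Fk; split=> *; rewrite ?FD ?Fk ?fl ?fr ?fk.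
Qed.

Lemma sw_tensor (G : zmodType) (f : C -> C -> G) (x : UU (abel M)) (Y : C -> C -> G) w :
  bal f -> bal Y ->
  (forall a b, tlift f (x * pureK a b) = Y a b) -> tlift f (x * coprod w) = sweedler Y w.
Proof.
move=> fb Yb e; rewrite /sweedler; elim/tensor_ind: (coprod w) => [|a b|z z' Hz Hz'].
- by rewrite mulr0 (tlift0 (bal_ok fb)) (tlift0 (bal_ok Yb)).
- by rewrite e (tlift_pure (bal_ok Yb)).
- by rewrite mulrDr (tliftD (bal_ok fb)) Hz Hz' (tliftD (bal_ok Yb)).
Qed.

(** The coproduct is multiplicative and x is primitive; [parn i a] is the sign of moving x past the
    first tensor factor. *)
Lemma sw_symG (G : zmodType) (f : C -> C -> G) i (x : M) w : bal f -> homog i x ->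
  sweedler f (symG x * w) =
  sweedler (fun a b => f (symG x * a) b) w + sweedler (fun a b => f (parn i a) (symG x * b)) w.
Proof.
move=> fb hx; case: (fb) => fl fr fk.
have b1 : bal (fun a b => f (symG x * a) b).
  by apply: (bal_comp1 (F := fun a => symG x * a) fb) => *; rewrite ?mulrDr ?mulrA.
have xk k : symG x * uC k = uC (parn i k) * symG x :> C.
  exact/homog_uC_comm/homog_symG.
have b2 : bal (fun a b => f (parn i a) (symG x * b)).
  split=> [a a' b|a b b'|a k b]; rewrite ?parnD ?mulrDr ?fl ?fr //.
  rewrite mulrA xk -mulrA -fk; congr (f _ _).
  by case: (i) => //=; rewrite parMU par_uC.
rewrite -sw_addf.
rewrite /sweedler coprodM coprod_uG -/(symG x); apply: sw_tensor => //.
  case: b1 b2 => l1 r1 k1 [l2 r2 k2].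
  by split=> *; rewrite ?l1 ?r1 ?k1 ?l2 ?r2 ?k2 // addrACA.
move=> a b.
rewrite [X in tlift f X](_ : _ = (pureK (symG x : C) (1 : C) : UU (abel M)) * pureK a b +
  (pureK (1 : C) (symG x : C) : UU (abel M)) * pureK a b); last exact: mulrDl.
rewrite !UU_mulE !(tliftD (bal_ok fb)) !(tlift_pure (bal_ok fb)).
rewrite !(homog_hcE _ (homog1U _)) /= !(mul0r,mul1r) !(homog_hcE _ (homog_symG hx)).
have f0 v : f v 0 = 0 by exact: (morph0 (fr v)).
by rewrite f0 addr0; congr (_ + _); case: (i); rewrite /= !mul0r f0 ?add0r ?addr0.
Qed.

Lemma sw_uCr (G : zmodType) (f : C -> C -> G) k w : bal f ->
  sweedler f (w * uC k) = sweedler (fun a b => f a (b * uC k)) w.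
Proof.
move=> fb; case: (fb) => fl fr fk.
have b1 : bal (fun a b => f a (b * uC k)).
  by split=> *; rewrite ?mulrDl ?fl ?fr ?mulrA // -?mulrA fk mulrA.
rewrite /sweedler coprodM coprod_uC; elim/tensor_ind: (coprod w) => [|a b|z z' Hz Hz'].
- by rewrite mul0r (tlift0 (bal_ok fb)) (tlift0 (bal_ok b1)).
- rewrite UU_mulE (tliftD (bal_ok fb)) !(tlift_pure (bal_ok fb)) (tlift_pure (bal_ok b1)).
  rewrite !mulr1 par_uC !fk -fr -uC_even -uC_odd -mulrDl hcE //.
- by rewrite mulrDl (tliftD (bal_ok fb)) Hz Hz' (tliftD (bal_ok b1)).
Qed.

Lemma sw_uCl (G : zmodType) (f : C -> C -> G) k w : bal f ->
  sweedler f (uC k * w) = sweedler (fun a b => f (uC k * a) b) w.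
Proof.
move=> fb; have b1 : bal (fun a b => f (uC k * a) b).
  by apply: (bal_comp1 (F := fun a => uC k * a) fb) => *; rewrite ?mulrDr ?mulrA.
rewrite /sweedler coprodM coprod_uC; apply: sw_tensor => // a b.
rewrite UU_mulE (tliftD (bal_ok fb)) !(tlift_pure (bal_ok fb)).
rewrite !(homog_hcE _ (homog1U _)) /= mul1r mul0r.
by rewrite [X in _ + X](morph0 (f := f _)) ?addr0 //; case: fb.
Qed.

Lemma parn_uCr i (a : C) k : parn i (a * uC k) = parn i a * uC (parn i k).
Proof. by case: i; rewrite //= parMU par_uC. Qed.
Lemma parn_uCl i (a : C) k : parn i (uC k * a) = uC (parn i k) * parn i a.
Proof. by case: i; rewrite //= parMU par_uC. Qed.
Lemma parnM i (a b : C) : parn i (a * b) = parn i a * parn i b.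
Proof. by case: i; rewrite //= parMU. Qed.
Lemma parn_uC i k : parn i (uC k : C) = uC (parn i k).
Proof. by case: i; rewrite //= par_uC. Qed.
Lemma symG_uC i (x : M) k : homog i x -> symG x * uC k = uC (parn i k) * symG x :> C.
Proof. by move=> hx; apply/homog_uC_comm/homog_symG. Qed.

Lemma sw_parn (G : zmodType) (f : C -> C -> G) i w : bal f ->
  sweedler f (parn i w) = sweedler (fun a b => f (parn i a) (parn i b)) w.
Proof.
move=> fb; elim/sym_ind: w f fb => [k|v w Hv Hw|j x w hx IH] f fb;
  case: (fb) => fl fr fk.
- rewrite parn_uC !sw_uC //; last first.
    by split=> *; rewrite ?parnD ?fl ?fr // !(parn_uCl, parn_uCr) fk.
  by rewrite parn_uC; congr (f _ _); case: (i); rewrite //= par1U.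
- by rewrite parnD (swD fb) Hv // Hw // swD //;
    split=> *; rewrite ?parnD ?fl ?fr // !(parn_uCl, parn_uCr) fk.
have hx' : homog j (parn i x) by apply: homog_parn.
have e a : symG (parn i x) * parn i a = parn i (symG x * a) :> C.
  by rewrite parnM; congr (_ * _); case: (i) => //=; rewrite par_symG.
rewrite -e !(sw_symG (i := j)) //; last first.
  by split=> *; rewrite ?parnD ?fl ?fr // !(parn_uCl, parn_uCr) fk.
rewrite !IH; first last.
- by apply: (bal_comp1 (F := fun a => symG (parn i x) * a) fb) => *; rewrite ?mulrDr ?mulrA.
- by split=> *; rewrite ?parnD ?mulrDr ?fl ?fr // parn_uCr fk mulrA -(symG_uC _ hx') mulrA.
by congr (_ + _); apply: sw_eq => a b; rewrite e // !parnn addbC.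
Qed.

Section Tri.
Variable G : zmodType.
Implicit Types (f : C -> C -> C -> G).

(** The iterated coproduct: products of three functions, however bracketed, are brought to this form
    and compared there. *)
Definition tri f w := sweedler (fun a v => sweedler (fun b c => f a b c) v) w.

Lemma bal3_12 f c : bal3 f -> bal (fun a b => f a b c).
Proof. by case=> f1 f2 f3 k1 k2; split. Qed.
Lemma bal3_23 f a : bal3 f -> bal (fun b c => f a b c).
Proof. by case=> f1 f2 f3 k1 k2; split. Qed.
Lemma bal3_l f : bal3 f -> bal (fun v c => sweedler (fun a b => f a b c) v).
Proof.
move=> fb; case: (fb) => f1 f2 f3 k1 k2; split=> [v v' c|v c c'|v k c].
- by rewrite swD //; apply: bal3_12.
- by rewrite -sw_addf; apply: sw_eq => a b; rewrite f3.
- by rewrite sw_uCr; [apply: sw_eq => a b; rewrite k2|apply: bal3_12].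
Qed.
Lemma bal3_r f : bal3 f -> bal (fun a v => sweedler (fun b c => f a b c) v).
Proof.
move=> fb; case: (fb) => f1 f2 f3 k1 k2; split=> [a a' v|a v v'|a k v].
- by rewrite -sw_addf; apply: sw_eq => b c; rewrite f1.
- by rewrite swD //; apply: bal3_23.
- by rewrite sw_uCl; [apply: sw_eq => b c; rewrite k1|apply: bal3_23].
Qed.

(** Multiplying w by x inserts x into one of the three slots; both ways of iterating [sw_symG]
    produce the same three terms. *)
Lemma coassoc f w : bal3 f ->
  sweedler (fun v c => sweedler (fun a b => f a b c) v) w = tri f w.
Proof.
elim/sym_ind: w f => [k|v w Hv Hw|i x w hx IH] f fb; rewrite /tri.
- rewrite !sw_uC ?sw_1; [|exact: bal3_23|exact: bal3_r|exact: bal3_12|exact: bal3_l].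
  by [].
- by rewrite (swD (bal3_l fb)) (swD (bal3_r fb)) Hv // Hw.
case: (fb) => f1 f2 f3 k1 k2.
have bx : bal3 (fun a b c => f (symG x * a) b c).
  by split=> *; rewrite ?mulrDr ?f1 ?f2 ?f3 ?mulrA ?k1 ?k2.
have by' : bal3 (fun a b c => f (parn i a) (symG x * b) c).
  split=> *; rewrite ?parnD ?mulrDr ?f1 ?f2 ?f3 ?mulrA ?k2 //.
  by rewrite parn_uCr k1 mulrA (symG_uC _ hx).
have bz : bal3 (fun a b c => f (parn i a) (parn i b) (symG x * c)).
  split=> *; rewrite ?parnD ?mulrDr ?f1 ?f2 ?f3 //.
    by rewrite parn_uCr k1 parn_uCl.
  by rewrite parn_uCr k2 mulrA -(symG_uC _ hx) mulrA.
rewrite (sw_symG _ (bal3_l fb) hx) (sw_symG _ (bal3_r fb) hx).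
transitivity (tri (fun a b c => f (symG x * a) b c) w +
  (tri (fun a b c => f (parn i a) (symG x * b) c) w +
   tri (fun a b c => f (parn i a) (parn i b) (symG x * c)) w)).
  rewrite -!IH // addrA; congr (_ + _); rewrite -?sw_addf; apply: sw_eq => v c.
    by rewrite (sw_symG _ _ hx) //; apply: bal3_12.
  by rewrite sw_parn //; apply: bal3_12.
congr (_ + _); rewrite /tri -sw_addf; apply: sw_eq => a v.
by rewrite (sw_symG _ _ hx) //; apply: bal3_23.
Qed.
End Tri.

Lemma bal_add (G : zmodType) (f f' : C -> C -> G) : bal f -> bal f' ->
  bal (fun a b => f a b + f' a b).
Proof.
case=> l r k [l' r' k']; split=> *; [rewrite l l'|rewrite r r'|by rewrite k k'];
  by rewrite addrACA.
Qed.
Lemma bal_morph (G H : zmodType) (h : G -> H) (f : C -> C -> G) : bal f ->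
  (forall x y, h (x + y) = h x + h y) -> bal (fun a b => h (f a b)).
Proof. by case=> l r k hD; split=> *; rewrite ?l ?r ?k ?hD. Qed.

(** Precomposition with the signed exchange of the factors. The sign is carried by [hc] and [par],
    so that the formula makes sense for arguments of mixed parity; [flip_homog] is the usual
    form. *)
Definition flip (G : zmodType) (f : C -> C -> G) (a b : C) : G :=
  f (hc false b) a + f (hc true b) (par a).

Lemma flip_homog (G : zmodType) (f : C -> C -> G) i j a b : bal f ->
  homog i a -> homog j b -> flip f a b = sgn (i && j) (f b a).
Proof.
case=> fl fr fk ha hb; rewrite /flip !(homog_hcE _ hb) (par_homog ha).
have f0 z : f 0 z = 0 by apply: (morph0 (f := fun u => f u z)).
rewrite (sgn_additive (f := f _)) //.
by case: (j); rewrite /= f0 ?sgn0 ?add0r ?addr0 ?andbT ?andbF.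
Qed.
Lemma bal_flip (G : zmodType) (f : C -> C -> G) : bal f -> bal (flip f).
Proof.
case=> fl fr fk; split=> [a a' b|a b b'|a k b]; rewrite /flip.
- by rewrite parD !fr addrACA.
- by rewrite !hcD !fl addrACA.
have e1 : hc false (uC k * b) = hc false b * uC (hc false k) - hc true b * uC (hc true k).
  by rewrite hcZ /= uC_even uC_odd par_hc /= uCN mulNr opprK.
have e2 : hc true (uC k * b) = hc true b * uC (hc false k) + hc false b * uC (hc true k).
  by rewrite hcZ /= uC_even uC_odd par_hc /=.
rewrite e1 e2 !fl (morphN (f := fun z => f z _) _ (fun x y => fl x y _)) !fk uC_par.
rewrite parD !parMU !par_uC !par_hc /= uCN mulNr parK !fr (morphN _ (fr _)).
by rewrite addrACA [RHS]addrACA; congr (_ + _); rewrite addrC.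
Qed.

Lemma sw_homogb (G : zmodType) (f f' : C -> C -> G) w : bal f -> bal f' ->
  (forall i j a b, homog i a -> homog j b -> f a b = f' a b) ->
  sweedler f w = sweedler f' w.
Proof. by case=> fl fr _ [fl' fr' _]; apply: sw_homog. Qed.

Lemma bal_symGl (G : zmodType) (f : C -> C -> G) x : bal f -> bal (fun a b => f (symG x * a) b).
Proof.
by move=> fb; apply: (bal_comp1 (F := fun a => symG x * a) fb) => *; rewrite ?mulrDr ?mulrA.
Qed.
Lemma bal_symGr (G : zmodType) (f : C -> C -> G) i x : homog i x -> bal f ->
  bal (fun a b => f (parn i a) (symG x * b)).
Proof.
move=> hx [fl fr fk]; split=> *; rewrite ?parnD ?mulrDr ?fl ?fr //.
by rewrite parn_uCr fk mulrA -(symG_uC _ hx) mulrA.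
Qed.

(** The exchange swaps the two terms of [sw_symG]: the induction hypothesis is applied to each, and
    the results are matched crosswise. *)
Lemma cocomm (G : zmodType) (f : C -> C -> G) w : bal f -> sweedler f w = sweedler (flip f) w.
Proof.
elim/sym_ind: w f => [k|v w Hv Hw|i x w hx IH] f fb; have ffb := bal_flip fb.
- rewrite !sw_uC // /flip !(homog_hcE _ (homog1U _)) /=.
  case: fb => fl fr fk.
  rewrite [X in _ + X](morph0 (f := fun u => f u _)) // addr0.
  by rewrite -[X in f X 1]mul1r fk mulr1.
- by rewrite !swD // Hv // Hw.
have b1 := bal_symGl x fb; have b2 := bal_symGr hx fb.
rewrite !(sw_symG _ _ hx) // IH // [X in _ + X]IH // addrC; congr (_ + _).
  apply: sw_homogb => [||l m a b ha hb]; [exact: bal_flip|exact: bal_symGl|].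
  rewrite (flip_homog b2 ha hb) (flip_homog fb (homogMU (homog_symG hx) ha) hb).
  rewrite (parn_homog _ hb) (sgn_additive (f := fun u => f u _)); last by case: fb.
  by rewrite sgnsgn; congr sgn; case: (i) (l) (m) => [] [] [].
apply: sw_homogb => [||l m a b ha hb]; [exact: bal_flip|exact: bal_symGr|].
rewrite (flip_homog b1 ha hb) (flip_homog fb (homog_parn i ha) (homogMU (homog_symG hx) hb)).
rewrite (parn_homog _ ha) (sgn_additive (f := f _)); last by case: fb.
by rewrite sgnsgn; congr sgn; case: (i) (l) (m) => [] [] [].
Qed.

Lemma counit1 : counit (1 : C) = 1. Proof. exact: counit_uC. Qed.
Lemma counit_par (w : C) : counit (par w) = par (counit w).
Proof.
elim/sym_ind: w => [k|v w Hv Hw|i x w hx _].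
- by rewrite par_uC !counit_uC.
- by rewrite parD !counitD parD Hv Hw.
by rewrite parMU par_symG !counitM !counit_uG !mul0r par0.
Qed.
Lemma counit_parn i (w : C) : counit (parn i w) = parn i (counit w).
Proof. by case: i; rewrite //= counit_par. Qed.

Lemma bal_counitl (G : zmodType) (h : C -> G) : (forall x y, h (x + y) = h x + h y) ->
  bal (fun a b => h (uC (counit a) * b)).
Proof.
by move=> hD; split=> *; rewrite ?counitD ?uCD ?mulrDl ?mulrDr ?hD // counitM counit_uC uCM mulrA.
Qed.
Lemma sw_counitl (G : zmodType) (h : C -> G) w : (forall x y, h (x + y) = h x + h y) ->
  sweedler (fun a b => h (uC (counit a) * b)) w = h w.
Proof.
elim/sym_ind: w h => [k|v w Hv Hw|i x w hx IH] h hD; have hb := bal_counitl hD.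
- by rewrite sw_uC // counit_uC mulr1.
- by rewrite swD // Hv // Hw.
rewrite (sw_symG _ hb hx) -sw_addf -[RHS](IH (fun w => h (symG x * w))); last first.
  by move=> *; rewrite mulrDr.
apply: sw_eq => a b; rewrite counitM counit_uG mul0r uC0 mul0r (morph0 hD) add0r.
by rewrite counit_parn !mulrA (symG_uC _ hx).
Qed.
Lemma bal_counitr (G : zmodType) (h : C -> G) : (forall x y, h (x + y) = h x + h y) ->
  bal (fun a b => h (a * uC (counit b))).
Proof.
by move=> hD; split=> *; rewrite ?counitD ?uCD ?mulrDl ?mulrDr ?hD // counitM counit_uC uCM mulrA.
Qed.
Lemma sw_counitr (G : zmodType) (h : C -> G) w : (forall x y, h (x + y) = h x + h y) ->
  sweedler (fun a b => h (a * uC (counit b))) w = h w.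
Proof.
elim/sym_ind: w h => [k|v w Hv Hw|i x w hx IH] h hD; have hb := bal_counitr hD.
- by rewrite sw_uC // counit1 mulr1.
- by rewrite swD // Hv // Hw.
rewrite (sw_symG _ hb hx) -sw_addf -[RHS](IH (fun w => h (symG x * w))); last first.
  by move=> *; rewrite mulrDr.
apply: sw_eq => a b; rewrite counitM counit_uG mul0r uC0 mulr0 (morph0 hD) addr0.
by rewrite mulrA.
Qed.

(** The coproduct respects the degree filtration. The conclusion is any property P closed under
    sums, which covers vanishing as well as bounds on the degree. *)
Lemma sw_flt (G : zmodType) (f : C -> C -> G) (P : G -> Prop) n w : bal f ->
  (forall x y, P x -> P y -> P (x + y)) ->
  (forall i j a b, (i + j <= n)%N -> flt i a -> flt j b -> P (f a b)) ->
  flt n w -> P (sweedler f w).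
Proof.
move=> fb PD Pf hw; elim: hw f fb Pf => {n w}.
- move=> k f fb Pf; rewrite sw_uC //; apply: (Pf 0%N 0%N) => //; first exact: flt_C.
  by rewrite -uC1; apply: flt_C.
- move=> n i x w hx _ IH f fb Pf; rewrite (sw_symG _ fb hx); apply: PD.
    apply: IH => [|l j a b h ha hb]; first exact: bal_symGl.
    by apply: (Pf l.+1 j) => //; apply: flt_symG.
  apply: IH => [|l j a b h ha hb]; first exact: bal_symGr.
  apply: (Pf l j.+1); [by rewrite addnS|exact: flt_parn|exact: flt_symG].
- move=> n v w _ Hv _ Hw f fb Pf; rewrite swD //; apply: PD; [exact: Hv|exact: Hw].
move=> n w _ H f fb Pf; apply: H => // i j a b h.
by apply: Pf; apply: leq_trans h _.
Qed.

Lemma bal3_flip (G : zmodType) (f : C -> C -> C -> G) : bal3 f ->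
  bal3 (fun a b c => flip (fun a b => f a b c) a b).
Proof.
move=> fb; have h c := bal_flip (bal3_12 c fb); case: (fb) => f1 f2 f3 k1 k2.
split=> [a a' b c|a b b' c|a b c c'|a k b c|a b k c]; try by case: (h c).
  by rewrite /flip !f3 addrACA.
rewrite /flip.
have H l j : homog (l (+) j) (hc l b * uC (hc j k)).
  by apply: homogMU; [apply: homog_hc|apply: homog_uC; apply: homog_hc].
have [e0 e1] : hc false (b * uC k) = hc false b * uC (hc false k) + hc true b * uC (hc true k)
    /\ hc true (b * uC k) = hc false b * uC (hc true k) + hc true b * uC (hc false k).
  have -> : b * uC k = hc false b * uC (hc false k) + hc false b * uC (hc true k) +
      (hc true b * uC (hc false k) + hc true b * uC (hc true k)).
    by rewrite -!mulrDr -mulrDl -uCD !hcE.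
  by rewrite !hcD !(homog_hcE _ (H _ _)) /= !(addr0, add0r).
rewrite e0 e1 !f1 !k1 -!k2 (uC_par a) (uC_par (par a)) parK !f2.
by rewrite addrACA; congr (_ + _); rewrite addrC.
Qed.
Lemma tri_swap (G : zmodType) (f : C -> C -> C -> G) w : bal3 f ->
  tri f w = tri (fun a b c => f (hc false b) a c + f (hc true b) (par a) c) w.
Proof.
move=> fb; rewrite -!coassoc //; last exact: bal3_flip.
by apply: sw_eq => v c; rewrite cocomm //; apply: bal3_12.
Qed.

Lemma tri_sgnf (G : zmodType) e (f : C -> C -> C -> G) w :
  tri (fun a b c => sgn e (f a b c)) w = sgn e (tri f w).
Proof. by rewrite /tri -sw_sgnf; apply: sw_eq => a v; rewrite sw_sgnf. Qed.
Lemma bal3_sgn (G : zmodType) e (f : C -> C -> C -> G) : bal3 f ->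
  bal3 (fun a b c => sgn e (f a b c)).
Proof. by case=> f1 f2 f3 k1 k2; split=> *; rewrite ?f1 ?f2 ?f3 ?k1 ?k2 ?sgnD. Qed.
Lemma tri_homog (G : zmodType) (f f' : C -> C -> C -> G) w : bal3 f -> bal3 f' ->
  (forall i j k a b c, homog i a -> homog j b -> homog k c -> f a b c = f' a b c) ->
  tri f w = tri f' w.
Proof.
move=> fb fb' e; apply: (sw_homogb _ (bal3_r fb) (bal3_r fb')) => i j a v ha _.
apply: sw_homogb => [||k l b c hb hc]; [exact: bal3_23|exact: bal3_23|].
exact: e ha hb hc.
Qed.
Lemma tri_addf (G : zmodType) (f f' : C -> C -> C -> G) w :
  tri (fun a b c => f a b c + f' a b c) w = tri f w + tri f' w.
Proof. by rewrite /tri -sw_addf; apply: sw_eq => a v; rewrite -sw_addf. Qed.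
Lemma bal3_add (G : zmodType) (f f' : C -> C -> C -> G) : bal3 f -> bal3 f' ->
  bal3 (fun a b c => f a b c + f' a b c).
Proof.
case=> p1 p2 p3 k1 k2 [q1 q2 q3 r1 r2].
split=> *; rewrite ?p1 ?p2 ?p3 ?q1 ?q2 ?q3 1?addrACA //; first by rewrite k1 r1.
by rewrite k2 r2.
Qed.
End Sweedler.

(** * Convolution products and coderivations *)

Section Bilin.
Variable K : superComAlgType.

(** Even K-bilinear maps in the convention of right-linear functions. The bracket, a module action
    and the product of U(g) are all of this kind and share the convolution lemmas. *)
Definition bilin (N1 N2 N3 : superModType K) (B : N1 -> N2 -> N3) : Prop :=
  [/\ forall x x' y, B (x + x') y = B x y + B x' y,
      forall x y y', B x (y + y') = B x y + B x y',
      forall x k y, B (x *:> k) y = B x (k *: y),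
      forall x y k, B x (y *:> k) = B x y *:> k
    & forall x y, par (B x y) = B (par x) (par y)].

(** Left linearity in the first argument turns into balance over K by counting signs on homogeneous
    arguments. *)
Lemma bilinI (N1 N2 N3 : superModType K) (B : N1 -> N2 -> N3) :
  (forall x x' y, B (x + x') y = B x y + B x' y) ->
  (forall x y y', B x (y + y') = B x y + B x y') ->
  (forall (k : K) x y, B (k *: x) y = k *: B x y) ->
  (forall x y (k : K), B x (y *:> k) = B x y *:> k) ->
  (forall i j x y, homog i x -> homog j y -> homog (i (+) j) (B x y)) -> bilin B.
Proof.
move=> Dl Dr Zl Zr hB.
have sl e x y : B (sgn e x) y = sgn e (B x y).
  by apply: (sgn_additive (f := fun x => B x y)).
have sr e x y : B x (sgn e y) = sgn e (B x y) by apply: (sgn_additive (f := B x)).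
split=> //.
- move=> a k b.
  elim/homog_ind: a => [x y Hx Hy|i a ha]; first by rewrite rscaleDl !Dl Hx Hy.
  elim/homog_ind: b => [x y Hx Hy|j b hb]; first by rewrite scalerDr !Dr Hx Hy.
  elim/homog_ind: k => [x y Hx Hy|l k hk]; first by rewrite rscaleDr Dl Hx Hy scalerDl Dr.
  rewrite (rscale_homog ha hk) sl Zl.
  have -> : k *: b = sgn (j && l) (b *:> k) by rewrite (rscale_homog hb hk) sgnsgn addbb.
  rewrite sr Zr (rscale_homog (hB _ _ _ _ ha hb) hk) sgnsgn.
  by congr sgn; case: (i) (j) (l) => [] [] [].
move=> a b.
elim/homog_ind: a => [x y Hx Hy|i a ha]; first by rewrite Dl !parD Hx Hy Dl.
elim/homog_ind: b => [x y Hx Hy|j b hb]; first by rewrite Dr !parD Hx Hy Dr.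
by rewrite (par_homog ha) (par_homog hb) (par_homog (hB _ _ _ _ ha hb)) sl sr sgnsgn.
Qed.

Variables (g : lieSuperType K).

Lemma lbr0l (a : g) : lbr 0 a = 0.
Proof. exact: (morph0 (f := fun x => lbr x a) (fun x y => lbrDl x y a)). Qed.
Lemma lbrNl (a b : g) : lbr (- a) b = - lbr a b.
Proof. exact: (morphN (f := fun x => lbr x b) _ (fun x y => lbrDl x y b)). Qed.
Lemma lbrNr (a b : g) : lbr a (- b) = - lbr a b.
Proof. exact: (morphN (f := fun x => lbr a x) _ (lbrDr a)). Qed.
Lemma lbr_sgnl e (a b : g) : lbr (sgn e a) b = sgn e (lbr a b).
Proof. by case: e; rewrite //= lbrNl. Qed.
Lemma lbr_sgnr e (a b : g) : lbr a (sgn e b) = sgn e (lbr a b).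
Proof. by case: e; rewrite //= lbrNr. Qed.
Lemma bilin_lbr : bilin (@lbr K g).
Proof.
apply: bilinI; [exact: lbrDl|exact: lbrDr|exact: lbrZl|by move=> *; exact: lbrZr|].
by move=> *; apply: homog_lbr.
Qed.
Lemma par_lbr (a b : g) : par (lbr a b) = lbr (par a) (par b).
Proof. by case: bilin_lbr. Qed.
Lemma lbr_rscale (a b : g) (k : K) : lbr (a *:> k) b = lbr a (k *: b).
Proof. by case: bilin_lbr. Qed.
Lemma bilin_act (h : lieSuperType K) (V : superModType K) (chi : lie_rep h V) : bilin chi.
Proof.
apply: bilinI; [exact: actDl|exact: actDr|exact: actZl|by move=> *; exact: actZr|].
by move=> *; apply: homog_act.
Qed.
Lemma bilin_mul : bilin (fun x y : U g => x * y).
Proof.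
split=> *; rewrite ?mulrDl ?mulrDr ?urscaleE ?uscaleE ?mulrA //; exact: parMU.
Qed.
End Bilin.

Section F.
Variables (K : superComAlgType) (M : superModType K).
Notation C := (SymAlg M).

(** The part of F(M, N) of parity i, parity being tested by comparison with [par] on both sides. *)
Definition fH (N : superModType K) (i : bool) (phi : C -> N) : Prop :=
  right_linear phi /\ forall w, par (phi w) = sgn i (phi (par w)).

Section FH.
Variables (N : superModType K) (i : bool) (phi : C -> N).
Hypothesis h : fH i phi.

Lemma fHD x y : phi (x + y) = phi x + phi y. Proof. by case: h => [[H _] _]; apply: H. Qed.
Lemma fH0 : phi 0 = 0. Proof. exact: (morph0 fHD). Qed.
Lemma fH_sgn b x : phi (sgn b x) = sgn b (phi x).
Proof. exact: (sgn_additive _ _ fHD). Qed.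
Lemma fHr w k : phi (w * uC k) = phi w *:> k.
Proof. by case: h => [[_ <-]]; rewrite urscaleE. Qed.
Lemma fH_par w : par (phi w) = sgn i (phi (par w)). Proof. by case: h. Qed.
Lemma fH_parn j w : parn j (phi w) = sgn (i && j) (phi (parn j w)).
Proof. by case: j; rewrite /= ?andbT ?andbF // fH_par. Qed.
Lemma fH_homog l w : homog l w -> homog (i (+) l) (phi w).
Proof.
by move=> hw; apply: homog_par; rewrite fH_par (par_homog hw) fH_sgn sgnsgn.
Qed.
Lemma fHl w k : phi (uC k * w) = parn i k *: phi w.
Proof.
rewrite uC_par' fHD !fHr !rscaleE !hcK /= !scale0r addr0 add0r fH_par parK.
rewrite sgnZr -[in RHS](hcE k) parnD scalerDl !parn_hc andbF andbT sgnZl. by rewrite sgnZl.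
Qed.
End FH.

Lemma homcE (N : superModType K) i j (phi : C -> N) w : fH i phi ->
  homc j phi w = if j == i then phi w else 0.
Proof.
move=> h; rewrite /homc sum_bool.
rewrite !(homog_hcE _ (fH_homog h (homog_hc _ w))) /=.
by case: eqP => [->|]; [rewrite -{3}(hcE w) (fHD h); case: (i)|case: (i) (j) => [] [] //=; rewrite addr0].
Qed.

(** For homogeneous psi only the parity j survives in the double sum, and the signs over the
    parities of v assemble to [parn j]. *)
Lemma sconvE (N : superModType K) (G : zmodType) (B : C -> N -> G) j psi w :
  (forall x x' y, B (x + x') y = B x y + B x' y) -> (forall x, B x 0 = 0) -> fH j psi ->
  sconv B psi w = sweedler (fun v v' => B (parn j v) (psi v')) w.
Proof.
move=> BD B0 h; apply: sw_eq => a b; rewrite !sum_bool !(homcE _ _ h).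
have BN x y : B (- x) y = - B x y.
  by apply: (morphN (f := fun x => B x y)) => *; rewrite BD.
case: (j); rewrite /= !B0 ?oppr0 ?addr0 ?add0r.
  by rewrite -BN -BD -parE.
by rewrite -BD hcE.
Qed.

Definition conv (N1 N2 N3 : superModType K) (B : N1 -> N2 -> N3)
    (phi : C -> N1) (psi : C -> N2) : C -> N3 :=
  sconv (fun v b => B (phi v) b) psi.

Section Conv.
Variables (N1 N2 N3 : superModType K) (B : N1 -> N2 -> N3).
Hypothesis bB : bilin B.

Lemma bilDl x x' y : B (x + x') y = B x y + B x' y. Proof. by case: bB. Qed.
Lemma bilDr x y y' : B x (y + y') = B x y + B x y'. Proof. by case: bB. Qed.
Lemma bil0l y : B 0 y = 0.
Proof. exact: (morph0 (f := fun x => B x y) (fun a b => bilDl a b y)). Qed.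
Lemma bil0r x : B x 0 = 0.
Proof. exact: (morph0 (f := B x) (bilDr x)). Qed.
Lemma bilsl e x y : B (sgn e x) y = sgn e (B x y).
Proof. exact: (sgn_additive (f := fun x => B x y) _ _ (fun a b => bilDl a b y)). Qed.
Lemma bilsr e x y : B x (sgn e y) = sgn e (B x y).
Proof. exact: (sgn_additive (f := B x) _ _ (bilDr x)). Qed.
Lemma bilk x k y : B (x *:> k) y = B x (k *: y). Proof. by case: bB. Qed.
Lemma bilZr x y k : B x (y *:> k) = B x y *:> k. Proof. by case: bB. Qed.
Lemma bil_par x y : par (B x y) = B (par x) (par y). Proof. by case: bB. Qed.
Lemma bil_homog i j x y : homog i x -> homog j y -> homog (i (+) j) (B x y).
Proof.
move=> hx hy; apply: homog_par; rewrite bil_par (par_homog hx) (par_homog hy).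
by rewrite bilsl bilsr sgnsgn.
Qed.
Lemma bilZl k x y : B (k *: x) y = k *: B x y.
Proof.
elim/homog_ind: x => [x x' Hx Hx'|i x hx]; first by rewrite scalerDr !bilDl Hx Hx' scalerDr.
elim/homog_ind: y => [y y' Hy Hy'|j y hy]; first by rewrite !bilDr Hy Hy' scalerDr.
elim/homog_ind: k => [k k' Hk Hk'|l k hk]; first by rewrite !scalerDl bilDl Hk Hk'.
have e (N : superModType K) m (z : N) : homog m z -> k *: z = sgn (m && l) (z *:> k).
  by move=> hz; rewrite (rscale_homog hz hk) sgnsgn addbb.
rewrite (e _ _ _ hx) (e _ _ _ (bil_homog hx hy)) bilsl bilk (e _ _ _ hy) bilsr bilZr sgnsgn.
by congr sgn; case: (i) (j) (l) => [] [] [].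
Qed.

Variables (i j : bool) (phi : C -> N1) (psi : C -> N2).
Hypotheses (hphi : fH i phi) (hpsi : fH j psi).

Lemma convE w : conv B phi psi w = sweedler (fun a b => B (phi (parn j a)) (psi b)) w.
Proof.
apply: (sconvE (B := fun v b => B (phi v) b)) => //; last by move=> *; rewrite bil0r.
by move=> *; rewrite (fHD hphi) bilDl.
Qed.
Lemma bal_conv : bal (fun a b => B (phi (parn j a)) (psi b)).
Proof.
split=> *; rewrite ?parnD ?(fHD hphi) ?(fHD hpsi) ?bilDl ?bilDr //.
by rewrite parn_uCr (fHr hphi) bilk (fHl hpsi).
Qed.
Lemma fH_conv : fH (i (+) j) (conv B phi psi).
Proof.
have bc := bal_conv; split; first split.
- by move=> x y; rewrite !convE swD.
- move=> w k; rewrite urscaleE !convE sw_uCr // (sw_morph (h := fun z => z *:> k)).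
    by apply: sw_eq => a b; rewrite (fHr hpsi) bilZr.
  by move=> *; rewrite rscaleDl.
move=> w; rewrite !convE (sw_parn true) // (sw_morph (h := @par _)); last exact: parD.
rewrite -sw_sgnf; apply: sw_eq => a b /=.
by rewrite bil_par (fH_par hphi) (fH_par hpsi) par_parn bilsl bilsr sgnsgn.
Qed.
End Conv.

(** Normal form of a triple product: the first argument is passed by the last two functions, hence
    the parity [j (+) k], and the second argument only by the last one. *)
Lemma conv_triE (N1 N2 N3 N23 N : superModType K) (B3 : N1 -> N23 -> N) (B4 : N2 -> N3 -> N23)
   i j k (phi : C -> N1) (psi : C -> N2) (chi : C -> N3) w : bilin B3 -> bilin B4 ->
   fH i phi -> fH j psi -> fH k chi ->
  let f a b c := B3 (phi (parn (j (+) k) a)) (B4 (psi (parn k b)) (chi c)) in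
  bal3 f /\ conv B3 phi (conv B4 psi chi) w = tri f w.
Proof.
move=> b3 b4 h1 h2 h3 f; split.
  rewrite /f; split=> *.
  - by rewrite parnD (fHD h1) (bilDl b3).
  - by rewrite parnD (fHD h2) (bilDl b4) (bilDr b3).
  - by rewrite (fHD h3) (bilDr b4) (bilDr b3).
  - by rewrite parn_uCr (fHr h1) parn_uCl (fHl h2) parnn (bilk b3) (bilZl b4).
  - by rewrite parn_uCr (fHr h2) (bilk b4) (fHl h3).
rewrite (convE b3 h1 (fH_conv b4 h2 h3)); apply: sw_eq => a v.
rewrite (convE b4 h2 h3) (sw_morph (h := B3 _)) //.
by move=> *; rewrite (bilDr b3).
Qed.

Lemma conv_triE' (N1 N2 N3 N12 N : superModType K) (B1 : N12 -> N3 -> N) (B2 : N1 -> N2 -> N12)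
   i j k (phi : C -> N1) (psi : C -> N2) (chi : C -> N3) w : bilin B1 -> bilin B2 ->
   fH i phi -> fH j psi -> fH k chi ->
  let f a b c := B1 (B2 (phi (parn (j (+) k) a)) (psi (parn k b))) (chi c) in
  bal3 f /\ conv B1 (conv B2 phi psi) chi w = tri f w.
Proof.
move=> b1 b2 h1 h2 h3 f.
have fb : bal3 f.
  rewrite /f; split=> *.
  - by rewrite parnD (fHD h1) (bilDl b2) (bilDl b1).
  - by rewrite parnD (fHD h2) (bilDr b2) (bilDl b1).
  - by rewrite (fHD h3) (bilDr b1).
  - by rewrite parn_uCr (fHr h1) parn_uCl (fHl h2) parnn (bilk b2).
  - by rewrite parn_uCr (fHr h2) (fHl h3) (bilZr b2) (bilk b1).
split=> //; rewrite -coassoc // (convE b1 (fH_conv b2 h1 h2) h3); apply: sw_eq => v c.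
rewrite (convE b2 h1 h2) sw_parn; last exact: (bal_conv b2 h1 h2).
rewrite (sw_morph (h := fun z => B1 z _)); last by move=> *; rewrite (bilDl b1).
by apply: sw_eq => a b; rewrite parnn.
Qed.

Lemma conv_assoc (N1 N2 N3 N12 N23 N : superModType K)
   (B1 : N12 -> N3 -> N) (B2 : N1 -> N2 -> N12) (B3 : N1 -> N23 -> N) (B4 : N2 -> N3 -> N23)
   i j k phi psi chi : bilin B1 -> bilin B2 -> bilin B3 -> bilin B4 ->
  (forall x y z, B1 (B2 x y) z = B3 x (B4 y z)) -> fH i phi -> fH j psi -> fH k chi ->
  conv B1 (conv B2 phi psi) chi = conv B3 phi (conv B4 psi chi).
Proof.
move=> b1 b2 b3 b4 e h1 h2 h3; apply: funext => w.
have [_ ->] := conv_triE w b3 b4 h1 h2 h3; have [_ ->] := conv_triE' w b1 b2 h1 h2 h3.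
by apply: sw_eq => a v; apply: sw_eq => b c; rewrite e.
Qed.

(** Cocommutativity of S(M) transfers the symmetry of the pairings to their convolutions. *)
Lemma conv_flip (N1 N2 N3 : superModType K) (B : N1 -> N2 -> N3) (B' : N2 -> N1 -> N3)
    i j phi psi : bilin B -> bilin B' ->
  (forall l m x y, homog l x -> homog m y -> B x y = sgn (l && m) (B' y x)) ->
  fH i phi -> fH j psi -> conv B phi psi = (fun w => sgn (i && j) (conv B' psi phi w)).
Proof.
move=> b b' e h1 h2; apply: funext => w.
rewrite (convE b h1 h2) (convE b' h2 h1) cocomm; last exact: (bal_conv b h1 h2).
have bb := bal_conv b' h2 h1.
have bs : bal (fun x y => sgn (i && j) (B' (psi (parn i x)) (phi y))).
  by case: bb => l r k; split=> *; rewrite ?l ?r ?k ?sgnD.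
rewrite -sw_sgnf; apply: sw_homogb => // [|l m x y hx hy].
  by apply: bal_flip; exact: (bal_conv b h1 h2).
rewrite (flip_homog (bal_conv b h1 h2) hx hy) !(parn_homog _ hx, parn_homog _ hy).
rewrite (fH_sgn h1) (fH_sgn h2) (bilsl b) (bilsl b').
rewrite (e _ _ _ _ (fH_homog h1 hy) (fH_homog h2 hx)) !sgnsgn.
by congr sgn; case: (i) (j) (l) (m) => [] [] [] [].
Qed.

Lemma fH_ext (N : superModType K) i (phi psi : C -> N) : phi =1 psi -> fH i phi -> fH i psi.
Proof. by move=> /funext <-. Qed.

Lemma fH_id : fH false (fun w : C => w).
Proof. by split; [split|]. Qed.
Lemma fH_symG (i : bool) (alpha : C -> M) : fH i alpha -> fH i (fun w => symG (alpha w)).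
Proof.
move=> h; split; first split.
- by move=> x y; rewrite (fHD h) symGD.
- by move=> x k; rewrite !urscaleE (fHr h) -uGZr.
- by move=> w; rewrite par_symG (fH_par h) symG_sgn.
Qed.

Section Cod.
Variables (i : bool) (alpha : C -> M).
Hypothesis h : fH i alpha.

Lemma codE : cod alpha = conv (fun x y : C => x * y) (fun w => symG (alpha w)) (fun w => w).
Proof.
by apply: funext => w; rewrite (convE (bilin_mul (abel M)) (fH_symG h) fH_id).
Qed.
Lemma fH_cod : fH i (cod alpha).
Proof.
by rewrite codE -[i]addbF; apply: fH_conv (fH_symG h) fH_id; exact: bilin_mul.
Qed.
Lemma bal_cod : bal (fun a b => symG (alpha a) * b).
Proof. exact: (bal_conv (bilin_mul (abel M)) (fH_symG h) fH_id). Qed.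

Lemma counit_cod w : counit (cod alpha w) = 0.
Proof.
rewrite /cod (sw_morph (h := @counit _ _)); last exact: counitD.
rewrite (sw_eq (f' := fun _ _ => 0)) ?swE ?big1 //.
by move=> a b; rewrite counitM counit_uG mul0r.
Qed.
Lemma gpt_cod w : gpt (cod alpha w) = alpha w.
Proof.
rewrite /cod (sw_morph (h := @gpt _ _)); last exact: gptD.
rewrite -[RHS](sw_counitr (h := alpha)); last exact: (fHD h).
apply: sw_eq => a b.
by rewrite gptM counit_uG scale0r add0r gpt_symG (fHr h).
Qed.

(** The coderivation rule. In the threefold coproduct a (x) u (x) v the element alpha(a) is
    multiplied into u or into v; the second case takes the shape [T3] after exchanging a and u,
    which cocommutativity allows. *)
Lemma sw_cod (G : zmodType) (f : C -> C -> G) w : bal f ->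
  sweedler f (cod alpha w) =
  sweedler (fun a b => f (cod alpha a) b) w + sweedler (fun a b => f (parn i a) (cod alpha b)) w.
Proof.
move=> fb; case: (fb) => fl fr fk.
pose T1 a b c := f (symG (alpha a) * b) c.
pose T3 a b c := f (parn i a) (symG (alpha b) * c).
have b1 : bal3 T1.
  rewrite /T1; split=> [*|*|*|a k b c|a b k c]; rewrite ?(fHD h) ?symGD ?mulrDl ?mulrDr ?fl ?fr //.
    by rewrite (fHr h) [symG (_ *:> _)]uGZr mulrA.
  by rewrite mulrA fk.
have b3 : bal3 T3.
  rewrite /T3; split=> [*|*|*|a k b c|a b k c]; rewrite ?parnD ?(fHD h) ?symGD ?mulrDl ?mulrDr ?fl ?fr //.
    by rewrite parn_uCr fk (fHl h) [symG (_ *: _)]uGZl mulrA.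
  by rewrite (fHr h) [symG (_ *:> _)]uGZr mulrA.
have -> : sweedler (fun a b => f (cod alpha a) b) w = tri T1 w.
  rewrite -coassoc //; apply: sw_eq => v c.
  by rewrite (sw_morph (h := fun z => f z c)).
have -> : sweedler (fun a b => f (parn i a) (cod alpha b)) w = tri T3 w.
  by apply: sw_eq => a v; rewrite (sw_morph (h := f _)).
rewrite (tri_swap _ b3) /tri -sw_addf [LHS](sw_morph (h := sweedler f)); last first.
  by move=> *; rewrite swD.
apply: sw_eq => a b; rewrite -[in LHS](hcE (alpha a)) symGD mulrDl swD //.
rewrite !(sw_symG _ fb (homog_hc _ _)) addrACA -!sw_addf; apply: sw_eq => u v.
congr (_ + _); first by rewrite -fl -mulrDl -symGD hcE.
rewrite /T3 /= -{1 2}(hcE u) parD !par_hc /= !fl.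
have ea : symG (alpha (par a)) = sgn i (symG (par (alpha a))) :> C.
  by rewrite (fH_par h) symG_sgn sgnsgn addbb.
rewrite ea !parn_hc andbF andbT /=.
have -> : f (sgn i (hc true u)) (sgn i (symG (par (alpha a))) * v) =
   f (hc true u) (symG (par (alpha a)) * v).
  case: (i) => //=; rewrite mulNr (morphN _ (fr _)).
  by rewrite (morphN (f := fun z => f z _) _ (fun x y => fl x y _)) opprK.
rewrite parE symGD mulrDl fr -[in RHS](hcE (alpha a)) symGD mulrDl fr.
rewrite (morphN (f := fun z => f z _) _ (fun x y => fl x y _)).
rewrite (morphN (f := @symG K M) _ (@symGD K M)) mulNr (morphN _ (fr _)).
by rewrite hcE addrACA.
Qed.
End Cod.

Lemma fH_comp (N : superModType K) i j (phi : C -> N) (alpha : C -> M) :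
  fH j phi -> fH i alpha -> fH (i (+) j) (fun w => phi (cod alpha w)).
Proof.
move=> h ha; have hc := fH_cod ha; split; first split.
- by move=> x y; rewrite (fHD hc) (fHD h).
- by move=> x k; rewrite urscaleE (fHr hc) urscaleE (fHr h).
- by move=> w; rewrite (fH_par h) (fH_par hc) (fH_sgn h) sgnsgn addbC.
Qed.

(** Dual to [sw_cod]: composition with a coderivation is a derivation of convolution. It acts from
    the right, so the sign sits on the term in which it passes psi. *)
Lemma conv_cod (N1 N2 N3 : superModType K) (B : N1 -> N2 -> N3) i j k phi psi alpha :
  bilin B -> fH j phi -> fH k psi -> fH i alpha -> forall w,
  conv B phi psi (cod alpha w) =
  sgn (i && k) (conv B (fun w => phi (cod alpha w)) psi w) + conv B phi (fun w => psi (cod alpha w)) w.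
Proof.
move=> b h1 h2 ha w; have hc := fH_cod ha.
rewrite (convE b h1 h2) (convE b (fH_comp h1 ha) h2) (convE b h1 (fH_comp h2 ha)).
rewrite (sw_cod ha _ (bal_conv b h1 h2)); congr (_ + _).
  rewrite -sw_sgnf; apply: sw_eq => u v.
  rewrite -(bilsl b) -(fH_sgn h1); congr (B (phi _) _).
  by case: (k); rewrite /= ?andbF ?andbT // (fH_par hc).
by apply: sw_eq => u v; rewrite parnn addbC.
Qed.

Lemma fH_gpt : fH false (@gpt K M).
Proof.
split; first split.
- exact: gptD.
- by move=> x k; rewrite urscaleE gptM counit_uC gpt_uC scaler0 add0r.
move=> w /=; elim/sym_ind: w => [k|v w Hv Hw|i x w hx _].
- by rewrite par_uC !gpt_uC par0.
- by rewrite parD !gptD parD Hv Hw.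
rewrite parMU par_symG !gptM !counit_uG !scale0r !add0r !gpt_symG par_rscale.
by rewrite counit_par.
Qed.

Section Vanish.
Variable N : superModType K.
Definition vord (n : nat) (phi : C -> N) : Prop :=
  forall m w, flt m w -> (m < n)%N -> phi w = 0.

Lemma vord0 phi : vord 0 phi. Proof. by []. Qed.
End Vanish.

(** If p + q < m + n, then p < m or q < n, so one of the two factors kills each term of the
    coproduct. *)
Lemma vord_conv (N1 N2 N3 : superModType K) (B : N1 -> N2 -> N3) i j phi psi m n :
  bilin B -> fH i phi -> fH j psi -> vord m phi -> vord n psi -> vord (m + n) (conv B phi psi).
Proof.
move=> b h1 h2 o1 o2 l w hw lmn; rewrite (convE b h1 h2).
apply: (sw_flt (P := fun z => z = 0) (bal_conv b h1 h2) _ _ hw).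
  by move=> x y -> ->; rewrite addr0.
move=> p q u v pq hu hv; have [pm|mp] := ltnP p m.
  by rewrite (o1 p) ?(bil0l b) //; apply: flt_parn.
rewrite (o2 q) ?(bil0r b) //; rewrite -(ltn_add2l p).
by apply: leq_ltn_trans pq _; apply: leq_trans lmn _; rewrite leq_add2r.
Qed.
Lemma vord_gpt : vord 1 (@gpt K M).
Proof.
move=> m w hw; rewrite ltnS leqn0 => /eqP m0.
elim: hw m0 => {m w} //.
- by move=> k _; rewrite gpt_uC.
- by move=> n v w _ Hv _ Hw n0; rewrite gptD Hv // Hw // addr0.
Qed.
(** At most one degree is gained, as alpha takes values in M. This is why series composed with [cod]
    are truncated at n + 1 below. *)
Lemma flt_cod i alpha n w : fH i alpha -> flt n w -> flt n.+1 (cod alpha w).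
Proof.
move=> h; apply: (sw_flt (P := flt n.+1) (bal_cod h)); first exact: flt_D.
move=> p q u v pq _ hv; apply: (@flt_le K M q.+1); last exact: flt_symG.
by rewrite ltnS (leq_trans _ pq) // leq_addl.
Qed.

Lemma fH_const (N : superModType K) i (a : N) : homog i a -> fH i (@Fconst K M N a).
Proof.
move=> ha; rewrite /Fconst; split; first split.
- by move=> x y; rewrite counitD rscaleDr.
- by move=> x k; rewrite urscaleE counitM counit_uC rscaleA.
by move=> w; rewrite par_rscale counit_par (par_homog ha); case: (i); rewrite //= rscaleNl.
Qed.

Lemma symG_comm i j (x y : M) : homog i x -> homog j y ->
  symG x * symG y = sgn (i && j) (symG y * symG x) :> C.
Proof.
move=> hx hy; apply/eqP; rewrite -subr_eq0 -(@uG_lbr K (abel M) i j x y hx hy).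
by rewrite /lbr /= /abel_lbr -/(symG (0 : M)) symG0.
Qed.

(** The second-order terms [T3], where alpha and beta act on different factors of the coproduct,
    agree up to sign because S(M) is cocommutative and commutative. Only the terms in which one
    function is composed with the other coderivation remain. *)
Lemma cod_comm i j alpha beta w : fH i alpha -> fH j beta ->
  cod alpha (cod beta w) - sgn (i && j) (cod beta (cod alpha w)) =
  cod (fun w => alpha (cod beta w) - sgn (i && j) (beta (cod alpha w))) w.
Proof.
move=> ha hb.
pose T3 i (al be : C -> M) a b c : C := symG (al (parn i a)) * (symG (be b) * c).
have b3 i' j' al be : fH i' al -> fH j' be -> bal3 (T3 j' al be).
  move=> h1 h2; rewrite /T3; split=> [*|*|*|a k b c|a b k c].
  - by rewrite parnD (fHD h1) symGD mulrDl.
  - by rewrite (fHD h2) symGD mulrDl mulrDr.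
  - by rewrite !mulrDr.
  - by rewrite parn_uCr (fHr h1) (fHl h2) [symG (_ *:> _)]uGZr [symG (_ *: _)]uGZl !mulrA.
  - by rewrite (fHr h2) [symG (_ *:> _)]uGZr !mulrA.
have e i' j' al be v : fH i' al -> fH j' be -> cod al (cod be v) =
    sweedler (fun a b => symG (al (cod be a)) * b) v + tri (T3 j' al be) v.
  move=> h1 h2; rewrite {1}/cod (sw_cod h2 _ (bal_cod h1)); congr (_ + _).
  by apply: sw_eq => a u; rewrite (sw_morph (h := fun z => _ * z)) // => x y; rewrite mulrDr.
rewrite (e i j) // (e j i) // sgnD opprD addrACA [X in _ + X](_ : _ = 0) ?addr0.
  rewrite -sw_sgnf -sw_oppf -sw_addf; apply: sw_eq => a b.
  rewrite symGD mulrDl; congr (_ + _).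
  rewrite (morphN (f := @symG K M) _ (@symGD K M)) symG_sgn mulNr; congr (- _).
  by case: (i && j); rewrite //= mulNr.
apply/eqP; rewrite subr_eq0; apply/eqP; rewrite (tri_swap _ (b3 j i _ _ hb ha)).
rewrite -tri_sgnf; apply: tri_homog => [||l m n a b c hl hm hn].
- exact: (b3 i j).
- exact/bal3_sgn/bal3_flip/(b3 j i).
rewrite -[X in _ = sgn _ X]/(flip (fun a b => T3 i beta alpha a b c) a b).
rewrite (flip_homog (bal3_12 c (b3 j i _ _ hb ha)) hl hm) /T3 sgnsgn.
rewrite !(parn_homog _ hl, parn_homog _ hm) (fH_sgn ha) (fH_sgn hb) !symG_sgn.
rewrite [in RHS]mulrA (sgn_additive (f := fun z => z * _)); last by move=> *; rewrite mulrDl.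
rewrite (sgn_additive (f := fun z => z * _)); last by move=> *; rewrite mulrDl.
rewrite (sgn_additive (f := fun z => z * _)); last by move=> *; rewrite mulrDl.
rewrite mulrA (symG_comm (fH_homog ha hl) (fH_homog hb hm)).
rewrite (sgn_additive (f := fun z => z * _)); last by move=> *; rewrite mulrDl.
by rewrite !sgnsgn; congr sgn; case: (i) (j) (l) (m) => [] [] [] [].
Qed.
End F.

(** * Products of divided powers and the zero curvature equation *)

Section Cauchy.
Variable L : zmodType.
Implicit Types F : nat -> nat -> L.

(** The coefficient of t^N in a product of two series whose coefficients of index k and l pair to F
    k l. *)
Definition cau F N := \sum_(k < N.+1) F k (N - k)%N.

Lemma cau0 F : cau F 0 = F 0%N 0%N.
Proof. by rewrite /cau big_ord1. Qed.
Lemma cau_l F N : cau F N.+1 = F 0%N N.+1 + cau (fun k l => F k.+1 l) N.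
Proof. by rewrite /cau big_ord_recl subn0; congr (_ + _). Qed.
Lemma cau_r F N : cau F N.+1 = cau (fun k l => F k l.+1) N + F N.+1 0%N.
Proof.
rewrite /cau big_ord_recr /= subnn; congr (_ + _); apply: eq_bigr => k _.
by rewrite subSn // -ltnS.
Qed.

(* Multiplying the term (k, l) by (k + p) + (l + q) turns a pair of
   first-order recursions for the factors into one for their product. *)
Lemma cau_rec F (R : L -> L) p q N :
  (forall x y, R (x + y) = R x + R y) ->
  (forall k l, F k.+1 l *+ (k.+1 + p) + F k l.+1 *+ (l.+1 + q) = R (F k l)) ->
  cau F N.+1 *+ (N.+1 + p + q) = F 0%N N.+1 *+ p + F N.+1 0%N *+ q + R (cau F N).
Proof.
move=> RD e.
have -> : cau F N.+1 *+ (N.+1 + p + q) =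
    cau (fun k l => F k l *+ (k + p)) N.+1 + cau (fun k l => F k l *+ (l + q)) N.+1.
  rewrite /cau -sumrMnl -big_split; apply: eq_bigr => k _ /=.
  by rewrite -mulrnDr addnACA subnKC ?addnA // -ltnS.
rewrite cau_l cau_r !add0n.
have AC (a b c d : L) : a + c + (d + b) = a + b + (c + d) by rewrite [d + b]addrC addrACA.
rewrite AC; congr (_ + _).
by rewrite /cau -big_split (morph_sum _ _ RD); apply: eq_bigr => k _; apply: e.
Qed.

(** Plays the part of the uniqueness theorem for linear differential equations in t. *)
Lemma rec_unique (R : L -> L) (c : nat -> nat) (b S T : nat -> L) :
  (forall (x : L) n, x *+ n.+1 = 0 -> x = 0) ->
  S 0%N = T 0%N ->
  (forall N, S N.+1 *+ (c N).+1 = b N + R (S N)) ->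
  (forall N, T N.+1 *+ (c N).+1 = b N + R (T N)) -> S =1 T.
Proof.
move=> tf e0 eS eT; elim=> // N IH; apply/eqP; rewrite -subr_eq0; apply/eqP.
by apply: (tf _ (c N)); rewrite mulrnBl eS eT IH subrr.
Qed.

Lemma sum_triangle F n : (forall k l, (n <= k + l)%N -> F k l = 0) ->
  \sum_(k < n) \sum_(l < n) F k l = \sum_(N < n) cau F N.
Proof.
move=> F0; transitivity (\sum_(k < n) \sum_(l < n - k) F k l).
  apply: eq_bigr => k _; rewrite -!(big_mkord xpredT (F k)).
  rewrite (@big_cat_nat _ _ _ (n - k)%N) ?leq_subr //=.
  rewrite [X in _ + X](_ : _ = 0) ?addr0 // big_nat big1 // => l /andP[kl _].
  by apply: F0; rewrite -leq_subLR.
elim: n {F0} => [|n IH]; first by rewrite !big_ord0.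
rewrite [RHS]big_ord_recr -IH big_ord_recr /= /cau big_ord_recr /= subSnn big_ord1.
rewrite subnn addrA -big_split; congr (_ + _); apply: eq_bigr => k _.
by rewrite subSn ?big_ord_recr //; apply/ltnW.
Qed.
End Cauchy.

Section Zero.
Variables (L : zmodType) (br : L -> L -> L) (y : L).
Hypothesis tf : forall (x : L) n, x *+ n.+1 = 0 -> x = 0.
Hypothesis brDl : forall a b c, br (a + b) c = br a c + br b c.
Hypothesis brDr : forall a b c, br a (b + c) = br a b + br a c.

Let R x := - br y x.
Let RD a b : R (a + b) = R a + R b. Proof. by rewrite /R brDr opprD. Qed.
Let brMl a b n : br (a *+ n) b = br a b *+ n.
Proof. by elim: n => [|n IH]; rewrite ?mulr0n ?(morph0 (f := fun x => br x b)) // !mulrS brDl IH. Qed.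
Let brMr a b n : br a (b *+ n) = br a b *+ n.
Proof. by elim: n => [|n IH]; rewrite ?mulr0n ?(morph0 (f := fun x => br a x)) // !mulrS brDr IH. Qed.
Let brNl a b : br (- a) b = - br a b.
Proof. by apply: (morphN (f := fun x => br x b)). Qed.
Let brNr a b : br a (- b) = - br a b.
Proof. by apply: (morphN (f := fun x => br a x)). Qed.

(* f is e^{-t ad y} f_0 for c = 0, and t^{-1} int_0^t e^{-t ad y} f_0 for c = 1. *)
Definition adrec (c : nat) (f : nat -> L) := forall n, f n.+1 *+ (n.+1 + c) = - br y (f n).

Lemma adrec_br p q f f' : adrec p f -> adrec q f' ->
  (forall k l, br y (br (f k) (f' l)) = br (br y (f k)) (f' l) + br (f k) (br y (f' l))) ->
  forall N, cau (fun k l => br (f k) (f' l)) N.+1 *+ (N.+1 + p + q) =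
    br (f 0%N) (f' N.+1) *+ p + br (f N.+1) (f' 0%N) *+ q +
    - br y (cau (fun k l => br (f k) (f' l)) N).
Proof.
move=> hf hf' der N; apply: (cau_rec (R := R)) => // k l.
by rewrite -brMl -brMr hf hf' brNl brNr /R der opprD.
Qed.

(* That is, e^{-t ad y} is a morphism for the bracket. *)
Lemma exp_br f f' f'' : adrec 0 f -> adrec 0 f' -> adrec 0 f'' ->
  (forall k l, br y (br (f k) (f' l)) = br (br y (f k)) (f' l) + br (f k) (br y (f' l))) ->
  f'' 0%N = br (f 0%N) (f' 0%N) ->
  forall N, cau (fun k l => br (f k) (f' l)) N = f'' N.
Proof.
move=> hf hf' hf'' der e0.
apply: (rec_unique (R := R) (c := id) (b := fun=> 0)) => // [|N|N].
- by rewrite cau0 e0.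
- by have := adrec_br hf hf' der N; rewrite !addn0 !mulr0n add0r.
- by have := hf'' N; rewrite addn0 add0r.
Qed.

(* D (e^{-ad y} b) = [e^{-ad y} b, A(D)] for a derivation D killing b. *)
Lemma exp_der (D : L -> L) f A :
  (forall u v, D (u + v) = D u + D v) -> adrec 0 f -> adrec 1 A ->
  (forall k l, br y (br (f k) (A l)) = br (br y (f k)) (A l) + br (f k) (br y (A l))) ->
  D (f 0%N) = 0 ->
  (forall n, D (br y (f n)) = - br (f n) (A 0%N) + br y (D (f n))) ->
  forall N, cau (fun k l => br (f k) (A l)) N = D (f N.+1).
Proof.
move=> DD hf hA der D0 Dy.
have DM x n : D (x *+ n) = D x *+ n.
  by elim: n => [|n IH]; rewrite ?mulr0n ?(morph0 DD) // !mulrS DD IH.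
(* The shift to f_{N+1} is possible because D f_0 = 0; both sides satisfy (N + 2) x_{N+1} =
   [f_{N+1}, A_0] - [y, x_N]. *)
apply: (rec_unique (R := R) (c := succn) (b := fun N => br (f N.+1) (A 0%N))) => // [|N|N].
- rewrite cau0 -[D (f 1%N)]mulr1n -DM (hf 0%N) (morphN _ DD) Dy D0.
  by rewrite (morph0 (f := br y)) // addr0 opprK.
- by have := adrec_br hf hA der N; rewrite addn0 addn1 mulr0n mulr1n add0r.
- by have := hf N.+1; rewrite -DM addn0 => ->; rewrite (morphN _ DD) Dy opprD opprK.
Qed.

(* The zero curvature equation for A(D) = "e^{-y} D e^y". *)
Lemma zero_curvature (D D' : L -> L) e A A' A'' :
  (forall u v, D (u + v) = D u + D v) -> (forall u v, D' (u + v) = D' u + D' v) ->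
  adrec 1 A -> adrec 1 A' -> adrec 1 A'' ->
  (forall k l, br y (br (A k) (A' l)) = br (br y (A k)) (A' l) + br (A k) (br y (A' l))) ->
  (forall n, D' (br y (A n)) = - br (A n) (A' 0%N) + br y (D' (A n))) ->
  (forall n, D (br y (A' n)) = - br (A' n) (A 0%N) + br y (D (A' n))) ->
  (forall n, br (A' n) (A 0%N) = - sgn e (br (A 0%N) (A' n))) ->
  A'' 0%N = D' (A 0%N) - sgn e (D (A' 0%N)) ->
  forall N, cau (fun k l => br (A k) (A' l)) N =
    D' (A N.+1) - sgn e (D (A' N.+1)) - A'' N.+1.
Proof.
move=> DD DD' hA hA' hA'' der Dy Dy' anti e0.
have DM x n : D (x *+ n) = D x *+ n.
  by elim: n => [|n IH]; rewrite ?mulr0n ?(morph0 DD) // !mulrS DD IH.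
have DM' x n : D' (x *+ n) = D' x *+ n.
  by elim: n => [|n IH]; rewrite ?mulr0n ?(morph0 DD') // !mulrS DD' IH.
have sM (x : L) n : sgn e x *+ n = sgn e (x *+ n).
  by case: e {anti e0} => //=; rewrite mulNrn.
(* The right-hand side at N is S (N + 1), and S 0 vanishes by the choice of A'' 0. *)
pose S n := D' (A n) - sgn e (D (A' n)) - A'' n.
have S0 : S 0%N = 0 by rewrite /S e0 subrr.
have SS n : S n.+1 *+ n.+2 = br (A n) (A' 0%N) + br (A 0%N) (A' n) - br y (S n).
  have e1 f m : adrec 1 f -> f m.+1 *+ m.+2 = - br y (f m) by move=> hf; have := hf m; rewrite addn1.
  rewrite /S !mulrnBl sM -DM -DM' !e1 // !(morphN _ DD, morphN _ DD') Dy Dy' anti.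
  rewrite !(sgnN, opprD, opprK, sgnD, sgnsgn, addbb) /=.
  rewrite !brDr !brNr (sgn_additive (f := br y)) // !(opprD, opprK).
  by rewrite -!addrA; congr (_ + _); rewrite addrCA.
(* The multiplier is N + 3: besides N + 1, each of A and A' contributes 1. *)
apply: (rec_unique (R := R) (c := fun n => n.+2)
   (b := fun N => br (A N.+1) (A' 0%N) + br (A 0%N) (A' N.+1))) => // [|N|N].
- have := SS 0%N; rewrite S0 (morph0 (f := br y)) // subr0 -/(S 1%N) cau0 => h.
  by apply/eqP; rewrite -subr_eq0; apply/eqP; apply: (tf (n := 1)); rewrite mulrnBl h mulr2n subrr.
- have := adrec_br hA hA' der N; rewrite !addn1 !mulr1n => ->.
  by rewrite [br (A 0%N) _ + _]addrC.
- exact: SS N.+1.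
Qed.
End Zero.

(** * Sums and convergent series in F(M, N) *)

Section Rational.
Variables (K : superComAlgType) (N : superModType K).
Lemma qinj_par c (x : N) : par (qinj c *: x) = (qinj c : K) *: par x.
Proof. by rewrite parZ (par_homog (homog_qinj _ c)). Qed.
Lemma rscale_qinj c (x : N) : x *:> (qinj c : K) = (qinj c : K) *: x.
Proof.
by rewrite rscaleE !(homog_hcE _ (homog_qinj _ c)) /= scale0r addr0.
Qed.
Lemma qinj_muln c (x : N) n : ((qinj c : K) *: x) *+ n = (qinj (c * n%:R) : K) *: x.
Proof.
by rewrite -scaler_nat scalerA -qinj_nat -qinjM mulrC.
Qed.
End Rational.

Lemma fctDE (T : Type) (N : zmodType) (phi psi : T -> N) w : (phi + psi) w = phi w + psi w.
Proof. by []. Qed.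
Lemma fctNE (T : Type) (N : zmodType) (phi : T -> N) w : (- phi) w = - phi w.
Proof. by []. Qed.

Section FunSpace.
Variables (K : superComAlgType) (M : superModType K).
Notation C := (SymAlg M).

Section FHops.
Variables (N : superModType K) (i : bool).
Implicit Types phi psi : C -> N.
Lemma fH_zero : fH i (0 : C -> N).
Proof.
split; first split.
- by move=> *; rewrite /= addr0.
- by move=> *; rewrite rscale0l.
- by move=> w; rewrite par0 sgn0.
Qed.
Lemma fH_add phi psi : fH i phi -> fH i psi -> fH i (phi + psi).
Proof.
move=> h1 h2; split; first split.
- by move=> x y; rewrite /= !fctDE (fHD h1) (fHD h2) addrACA.
- by move=> x k; rewrite !fctDE urscaleE (fHr h1) (fHr h2) rscaleDl.
- by move=> w; rewrite !fctDE parD (fH_par h1) (fH_par h2) sgnD.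
Qed.
Lemma fH_opp phi : fH i phi -> fH i (- phi).
Proof.
move=> h1; split; first split.
- by move=> x y; rewrite !fctNE (fHD h1) opprD.
- by move=> x k; rewrite !fctNE urscaleE (fHr h1) rscaleNl.
- by move=> w; rewrite !fctNE parN (fH_par h1) sgnN.
Qed.
Lemma fH_sub phi psi : fH i phi -> fH i psi -> fH i (phi - psi).
Proof. by move=> h1 h2; apply: fH_add => //; apply: fH_opp. Qed.
Lemma fH_sgnf e phi : fH i phi -> fH i (sgn e phi).
Proof. by case: e => //=; apply: fH_opp. Qed.
Lemma fH_sum (I : Type) (r : seq I) (F : I -> C -> N) :
  (forall k, fH i (F k)) -> fH i (\sum_(k <- r) F k).
Proof. by move=> h; elim/big_ind: _ => //; [exact: fH_zero|exact: fH_add]. Qed.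
Lemma fH_scale c phi : fH i phi -> fH i (fun w => (qinj c : K) *: phi w).
Proof.
move=> h1; split; first split.
- by move=> x y; rewrite (fHD h1) scalerDr.
- by move=> x k; rewrite urscaleE (fHr h1) rscaleZ.
- by move=> w; rewrite qinj_par (fH_par h1) sgnZr.
Qed.
End FHops.

Lemma sgn_fct (N : zmodType) e (phi : C -> N) w : (sgn e phi) w = sgn e (phi w).
Proof. by case: e. Qed.
Lemma fct_sum (N : zmodType) (I : Type) (r : seq I) (F : I -> C -> N) w :
  (\sum_(k <- r) F k) w = \sum_(k <- r) F k w.
Proof. exact: (morph_sum (f := fun phi : C -> N => phi w)). Qed.

Section ConvOps.
Variables (N1 N2 N3 : superModType K) (B : N1 -> N2 -> N3).
Hypothesis b : bilin B.

Lemma conv_addl phi phi' psi : conv B (phi + phi') psi = conv B phi psi + conv B phi' psi :> (C -> N3).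
Proof.
apply: funext => w; rewrite fctDE /conv /sconv -sw_addf; apply: sw_eq => u v.
rewrite -big_split; apply: eq_bigr => i _; rewrite -big_split; apply: eq_bigr => j _ /=.
by rewrite fctDE (bilDl b) sgnD.
Qed.
Lemma homcD j (psi psi' : C -> N2) w : homc j (psi + psi') w = homc j psi w + homc j psi' w.
Proof. by rewrite /homc -big_split; apply: eq_bigr => i _ /=; exact: hcD. Qed.
Lemma conv_addr phi psi psi' : conv B phi (psi + psi') = conv B phi psi + conv B phi psi' :> (C -> N3).
Proof.
apply: funext => w; rewrite fctDE /conv /sconv -sw_addf; apply: sw_eq => u v.
rewrite -big_split; apply: eq_bigr => i _; rewrite -big_split; apply: eq_bigr => j _ /=.
by rewrite homcD (bilDr b) sgnD.
Qed.
Lemma conv_suml (I : Type) (r : seq I) F psi :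
  conv B (\sum_(k <- r) F k) psi = \sum_(k <- r) conv B (F k) psi :> (C -> N3).
Proof. exact: (morph_sum (f := fun x => conv B x psi) _ _ (fun x y => conv_addl x y psi)). Qed.
Lemma conv_sumr (I : Type) (r : seq I) F phi :
  conv B phi (\sum_(k <- r) F k) = \sum_(k <- r) conv B phi (F k) :> (C -> N3).
Proof. exact: (morph_sum (f := fun x => conv B phi x) _ _ (conv_addr phi)). Qed.
Lemma conv_scaler i j c phi psi : fH i phi -> fH j psi ->
  conv B phi (fun w => (qinj c : K) *: psi w) = (fun w => (qinj c : K) *: conv B phi psi w) :> (C -> N3).
Proof.
move=> h1 h2; apply: funext => w.
rewrite (convE b h1 (fH_scale c h2)) (convE b h1 h2) (sw_morph (h := fun z => (qinj c : K) *: z)).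
  by apply: sw_eq => u v; rewrite -!rscale_qinj (bilZr b).
by move=> *; rewrite scalerDr.
Qed.
End ConvOps.

(* Convergence of a series in F(M, N) in the degree filtration; it forces u n to
   vanish in degree < n. *)
Definition osum (N : superModType K) (u : nat -> C -> N) (phi : C -> N) : Prop :=
  forall n m w, flt m w -> (m < n)%N -> phi w = \sum_(k < n) u k w.

Section Osum.
Variable N : superModType K.
Implicit Types (u : nat -> C -> N) (phi : C -> N).

(** The partial sums of length n and n + 1 both give phi below degree n, so their difference
    vanishes there. *)
Lemma osum_vord u phi n : osum u phi -> vord n (u n).
Proof.
move=> h m w hw mn; have := h n.+1 m w hw (leqW mn).
rewrite (h n m w hw mn) big_ord_recr /= => e.
by apply: (@addrI _ (\sum_(k < n) u k w)); rewrite -e addr0.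
Qed.
Lemma osum_eq u phi psi : osum u phi -> osum u psi -> phi = psi.
Proof.
move=> h1 h2; apply: funext => w; have [m hm] := flt_ex w.
by rewrite (h1 m.+1 m) // (h2 m.+1 m).
Qed.
Lemma osum_fH i u phi : (forall n, fH i (u n)) -> osum u phi -> fH i phi.
Proof.
move=> hu h; split; first split.
- move=> x y; have [m hx] := flt_ex x; have [n hy] := flt_ex y.
  have hx' := flt_le (leq_addr n m) hx; have hy' := flt_le (leq_addl m n) hy.
  rewrite !(h (m + n).+1 (m + n)%N) //; last exact: flt_D.
  by rewrite -big_split; apply: eq_bigr => k _; rewrite (fHD (hu k)).
- move=> x k; have [m hx] := flt_ex x; rewrite urscaleE !(h m.+1 m) //; last exact: flt_uCr.
  rewrite (morph_sum (f := fun z => z *:> k)); last by move=> *; rewrite rscaleDl.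
  by apply: eq_bigr => l _; rewrite (fHr (hu l)).
- move=> x; have [m hx] := flt_ex x; rewrite !(h m.+1 m) //; last exact: (flt_parn true).
  rewrite (morph_sum (f := @par N)) ?(morph_sum (f := sgn i)); first last.
  + exact: parD.
  + exact: sgnD.
  by apply: eq_bigr => l _; rewrite (fH_par (hu l)).
Qed.
Lemma osum_rem u phi n : osum u phi -> vord n (phi - \sum_(k < n) u k).
Proof.
by move=> h m w hw mn; rewrite fctDE fctNE fct_sum (h n m w hw mn) subrr.
Qed.
End Osum.

(** Below degree n both series may be truncated at n, as the remainders have order n; in the product
    of the truncations the terms with k + l >= n vanish because orders add. *)
Lemma osum_conv (N1 N2 N3 : superModType K) (B : N1 -> N2 -> N3) i j u v phi psi :
  bilin B -> (forall n, fH i (u n)) -> (forall n, fH j (v n)) ->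
  osum u phi -> osum v psi ->
  osum (cau (fun k l => conv B (u k) (v l))) (conv B phi psi).
Proof.
move=> b hu hv h1 h2 n m w hw mn.
have hphi := osum_fH hu h1; have hpsi := osum_fH hv h2.
have hsu : fH i (\sum_(k < n) u k) by apply: fH_sum.
have hsv : fH j (\sum_(k < n) v k) by apply: fH_sum.
have E : conv B phi psi w = conv B (\sum_(k < n) u k) (\sum_(l < n) v l) w.
  have e1 : phi = \sum_(k < n) u k + (phi - \sum_(k < n) u k) by rewrite addrC subrK.
  have e2 : psi = \sum_(k < n) v k + (psi - \sum_(k < n) v k) by rewrite addrC subrK.
  rewrite {1}e1 conv_addl // fctDE {1}e2 conv_addr // fctDE.
  rewrite (vord_conv b hsu (fH_sub hpsi hsv) (@vord0 _ _ _ _) (osum_rem h2) hw) //.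
  by rewrite (vord_conv b (fH_sub hphi hsu) hpsi (osum_rem h1) (@vord0 _ _ _ _) hw) ?addn0 ?addr0.
rewrite E conv_suml // fct_sum.
transitivity (\sum_(k < n) \sum_(l < n) conv B (u k) (v l) w).
  by apply: eq_bigr => k _; rewrite conv_sumr // fct_sum.
rewrite (sum_triangle (F := fun k l => conv B (u k) (v l) w)).
  by apply: eq_bigr => k _; rewrite /cau fct_sum.
move=> k l kl; apply: (vord_conv b (hu k) (hv l) (osum_vord h1) (osum_vord h2) hw).
exact: leq_trans mn kl.
Qed.

(** Links the finitely supported sums over nat, as in [ad_series], with truncation by degree. *)
Lemma osum_fsbig (N : superModType K) (u : nat -> C -> N) : (forall n, vord n (u n)) ->
  osum u (fun w => \sum_(n \in [set: nat]) u n w).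
Proof.
move=> hu n m w hw mn; rewrite -(big_mkord xpredT (fun k => u k w)).
rewrite (fsbigE (index_iota 0 n)) ?iota_uniq //.
  by apply: eq_bigl => k; rewrite in_setT.
by move=> k _; rewrite mem_index_iota /= -leqNgt => nk; apply: (hu k m) => //; apply: leq_trans nk.
Qed.
End FunSpace.

(** * The Lie superalgebra F(M, g) *)

Section LieFun.
Variables (K : superComAlgType) (M : superModType K) (g : lieSuperType K).
Notation C := (SymAlg M).
Implicit Types (phi psi : C -> g).
Local Notation bl := (bilin_lbr g).

Lemma fct_torsion (N : superModType K) (x : C -> N) n : x *+ n.+1 = 0 -> x = 0.
Proof.
move=> e; apply: funext => w; apply: (@mulrn_inj K _ _ n).
by rewrite -[RHS](congr1 (fun f : C -> N => f w) e) natmulfctE.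
Qed.

Lemma FlbrDl phi phi' psi : Flbr (phi + phi') psi = Flbr phi psi + Flbr phi' psi :> (C -> g).
Proof. exact: (conv_addl bl). Qed.
Lemma FlbrDr phi psi psi' : Flbr phi (psi + psi') = Flbr phi psi + Flbr phi psi' :> (C -> g).
Proof. exact: (conv_addr bl). Qed.

Lemma Flbr_anti i j phi psi : fH i phi -> fH j psi ->
  Flbr phi psi = - sgn (i && j) (Flbr psi phi) :> (C -> g).
Proof.
(* The sign of antisymmetry is absorbed into the pairing, so that [conv_flip] applies. *)
move=> h1 h2; pose B (x y : g) : g := - lbr x y.
have bB : bilin B.
  rewrite /B; split=> *; rewrite ?lbrDl ?lbrDr ?lbr_rscale ?lbrZr ?opprD ?rscaleNl //.
  by rewrite parN par_lbr.
rewrite -[LHS]/(conv (@lbr K g) phi psi) (conv_flip bl bB _ h1 h2); last first.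
  by move=> l m x y hx hy; rewrite /B (lbr_anti _ _ _ _ hx hy) sgnN.
apply: funext => w; rewrite fctNE sgn_fct -sgnN; congr sgn.
rewrite (convE bB h2 h1) [Flbr _ _ _](convE bl h2 h1) -sw_oppf.
exact: sw_eq.
Qed.

(** The Jacobi identity on each term of the threefold coproduct; [tri_swap] brings [phi, [y, psi]],
    where y is evaluated on the second factor, into the order of the other two terms. *)
Lemma Flbr_der i j (y : C -> g) phi psi : fH false y -> fH i phi -> fH j psi ->
  Flbr y (Flbr phi psi) = Flbr (Flbr y phi) psi + Flbr phi (Flbr y psi) :> (C -> g).
Proof.
move=> hy h1 h2; apply: funext => w; rewrite fctDE.
have [b1 e1] := conv_triE w bl bl hy h1 h2.
have [b2 e2] := conv_triE' w bl bl hy h1 h2.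
have [b3 e3] := conv_triE w bl bl h1 hy h2.
rewrite -[LHS]/(conv _ _ (conv _ _ _) w) e1.
rewrite -[X in _ = X + _]/(conv _ (conv _ _ _) _ w) e2.
rewrite -[X in _ = _ + X]/(conv _ _ (conv _ _ _) w) e3 (tri_swap _ b3).
rewrite -tri_addf; apply: tri_homog => // [|l m n a b c ha hb hc].
  by apply: bal3_add => //; exact: bal3_flip b3.
rewrite -[X in _ = _ + X]/(flip (fun a b => lbr (phi (parn j a)) (lbr (y (parn j b)) (psi c))) a b).
rewrite (flip_homog (bal3_12 c b3) ha hb).
rewrite !(parn_homog _ ha) !(parn_homog _ hb) !(fH_sgn h1) !(fH_sgn hy).
rewrite !(lbr_sgnl, lbr_sgnr) !sgnsgn.
rewrite (lbr_jacobi _ _ _ _ _ (fH_homog hy ha) (fH_homog h1 hb)) sgnD sgnsgn.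
congr (_ + _).
by congr sgn; case: (i) (j) (l) (m) => [] [] [] [].
Qed.

Section Ad.
Variable y : C -> g.
Hypotheses (hy : fH false y) (oy : vord 1 y).

Lemma fH_ad n i phi : fH i phi -> fH i (iter n (Flbr y) phi).
Proof. by move=> h; elim: n => //= n IH; apply: (fH_conv bl hy IH). Qed.
Lemma vord_ad n m i phi : fH i phi -> vord m phi -> vord (n + m) (iter n (Flbr y) phi).
Proof.
move=> h o; elim: n => //= n IH.
exact: (vord_conv bl hy (fH_ad n h) oy IH).
Qed.
Lemma ad_add n phi psi : iter n (Flbr y) (phi + psi) = iter n (Flbr y) phi + iter n (Flbr y) psi.
Proof. by elim: n => //= n ->; rewrite FlbrDr. Qed.
Lemma ad_scale n c i phi : fH i phi ->
  iter n (Flbr y) (fun w => (qinj c : K) *: phi w) = (fun w => (qinj c : K) *: iter n (Flbr y) phi w).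
Proof.
by move=> h; elim: n => //= n ->; apply: (conv_scaler bl c hy (fH_ad n h)).
Qed.

Definition ter (f : nat -> rat) phi n : C -> g := fun w => (qinj (f n) : K) *: iter n (Flbr y) phi w.
(** f(ad y) applied to phi; for constant phi this unfolds to [ad_series]. *)
Definition ser (f : nat -> rat) phi : C -> g := fun w => \sum_(n \in [set: nat]) ter f phi n w.

Lemma fH_ter f n i phi : fH i phi -> fH i (ter f phi n).
Proof. by move=> h; apply: fH_scale; apply: fH_ad. Qed.
Lemma vord_ter f n i phi : fH i phi -> vord n (ter f phi n).
Proof.
move=> h m w hw mn; rewrite /ter (@vord_ad n 0 i _ h (@vord0 _ _ _ _) m w hw) ?scaler0 //.
by rewrite addn0.
Qed.
Lemma osum_ser f i phi : fH i phi -> osum (ter f phi) (ser f phi).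
Proof. by move=> h; apply: osum_fsbig => n; apply: vord_ter h. Qed.
Lemma fH_ser f i phi : fH i phi -> fH i (ser f phi).
Proof. by move=> h; apply: osum_fH (osum_ser f h) => n; apply: fH_ter. Qed.

Lemma terD f phi psi n : ter f (phi + psi) n = ter f phi n + ter f psi n.
Proof. by apply: funext => w; rewrite /ter ad_add fctDE scalerDr. Qed.
Lemma ter_ter f h n m i phi : fH i phi -> ter f (ter h phi m) n = (fun w => qinj (f n * h m) *: iter (n + m) (Flbr y) phi w).
Proof.
move=> hp; apply: funext => w; rewrite {1}/ter /ter (ad_scale n _ (fH_ad m hp)).
by rewrite scalerA -qinjM iterD.
Qed.

(** Composition of operators f(ad y) is multiplication of series. Below degree n the inner series is
    truncated at n: its remainder has order n, and ad y only raises orders. *)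
Lemma ser_ser f h i phi : fH i phi ->
  ser f (ser h phi) = ser (cau (fun k l => f k * h l)) phi.
Proof.
move=> hp; apply: (@osum_eq _ _ _ (ter (cau (fun k l => f k * h l)) phi)); last exact: osum_ser hp.
have hs := fH_ser h hp => n m w hw mn.
rewrite (osum_ser f hs hw mn).
transitivity (\sum_(k < n) \sum_(l < n) (qinj (f k * h l) : K) *: iter (k + l) (Flbr y) phi w).
  apply: eq_bigr => k _.
  have -> : ser h phi = \sum_(l < n) ter h phi l + (ser h phi - \sum_(l < n) ter h phi l).
    by rewrite addrC subrK.
  rewrite terD fctDE [X in _ + X](_ : _ = 0) ?addr0.
    rewrite (morph_sum (f := fun x => ter f x k)); last by move=> *; rewrite terD.
    by rewrite fct_sum; apply: eq_bigr => l _; rewrite (ter_ter _ _ _ _ hp).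
  have h' : fH i (ser h phi - \sum_(l < n) ter h phi l).
    by apply: fH_sub => //; apply: fH_sum => l; apply: fH_ter.
  have o' := osum_rem (n := n) (osum_ser h hp).
  rewrite /ter (@vord_ad k n i _ h' o' m w hw) ?scaler0 //.
  by apply: leq_trans mn _; apply: leq_addl.
rewrite (sum_triangle (F := fun k l => (qinj (f k * h l) : K) *: iter (k + l) (Flbr y) phi w)).
  apply: eq_bigr => N _; rewrite /ter /cau.
  rewrite (big_morph (@qinj K) (@qinjD K) (@qinj0 K)).
  rewrite scaler_suml.
  apply: eq_bigr => k _.
  by rewrite subnKC // -ltnS.
move=> k l kl; rewrite (@vord_ad (k + l) 0 i _ hp (@vord0 _ _ _ _) m w hw) ?scaler0 //.
by rewrite addn0; apply: leq_trans mn kl.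
Qed.

(** The coefficients of e^{-t} for c = 0 and of (1 - e^{-t}) / t for c = 1. *)
Definition ecoef (c n : nat) : rat := (-1) ^+ n / (n + c)`!%:R.

Lemma adrec_ter c i phi : fH i phi -> adrec (@Flbr K M g) y c (ter (ecoef c) phi).
Proof.
move=> h n; apply: funext => w.
have e : Flbr y (ter (ecoef c) phi n) = (fun w => (qinj (ecoef c n) : K) *: iter n.+1 (Flbr y) phi w).
  exact: (conv_scaler bl _ hy (fH_ad n h)).
rewrite e fctNE natmulfctE /ter qinj_muln -scaleNr -qinjN; congr (qinj _ *: _).
have nz m : m.+1%:R != 0 :> rat by rewrite Num.Theory.pnatr_eq0.
rewrite /ecoef addSn factS natrM invfM exprS mulN1r !mulNr; congr (- _).
by rewrite -!mulrA; congr (_ * _); rewrite mulrCA mulVf ?mulr1.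
Qed.

Lemma ter0 f i phi : fH i phi -> f 0%N = 1 -> ter f phi 0 = phi.
Proof. by move=> h f0; apply: funext => w; rewrite /ter f0 qinj1 scale1r. Qed.
End Ad.
End LieFun.

Lemma scale_homog (K : superComAlgType) (N : superModType K) j (k : K) (b : N) :
  homog j b -> k *: b = b *:> parn j k.
Proof.
move=> hb; rewrite rscaleE (par_homog hb) !hc_parn andbF andbT !sgnZl sgnZr sgnsgn addbb.
by rewrite -scalerDl hcE.
Qed.

(** * The equation determining alpha and theta *)

Section Pair.
Variables (K : superComAlgType) (g : lieSuperType K) (s : involution g).
Notation h := (eig s false).
Notation q := (eig s true).
Notation C := (SymAlg q).
Local Notation bl := (bilin_lbr g).
Local Notation y := (@gpt_q K g s : C -> g).

Section Val.
Variable e : bool.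
Lemma valD (a b : eig s e) : val (a + b) = val a + val b. Proof. by []. Qed.
Lemma valN (a : eig s e) : val (- a) = - val a. Proof. by []. Qed.
Lemma val_par (a : eig s e) : val (par a) = par (val a).
Proof. by rewrite !parE. Qed.
Definition vf (phi : C -> eig s e) : C -> g := fun w => val (phi w).
Lemma fH_val i (phi : C -> eig s e) : fH i phi -> fH i (vf phi).
Proof.
move=> hp; split; first split.
- by move=> x z; rewrite /vf (fHD hp).
- by move=> x k; rewrite /vf urscaleE (fHr hp) val_rscale.
- by move=> w; rewrite /vf -val_par (fH_par hp) val_sgn.
Qed.
Lemma fH_of_val i (phi : C -> eig s e) : fH i (vf phi) -> fH i phi.
Proof.
move=> hp; split; first split.
- by move=> x z; apply: val_inj; have := fHD hp x z.
- by move=> x k; apply: val_inj; rewrite urscaleE val_rscale; have := fHr hp x k.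
- by move=> w; apply: val_inj; rewrite val_par val_sgn; have := fH_par hp w.
Qed.
End Val.

Lemma fH_y : fH false y. Proof. exact: (fH_val (@fH_gpt K q)). Qed.
Lemma vord_y : vord 1 y.
Proof. by move=> m w hw m1; rewrite /gpt_q (vord_gpt hw m1). Qed.

Definition Eexp (a : g) : C -> g := ser y (ecoef 0) (Fconst a).
Definition Aexp (phi : C -> g) : C -> g := ser y (ecoef 1) phi.

(* With A(alpha) = e^{-y} D(e^y), D the derivation given by the coderivation of
   alpha, this reads a e^y = D(e^y) + e^y theta. *)
Definition key (a : g) (alpha : C -> q) (theta : C -> h) : Prop :=
  Eexp a = Aexp (vf alpha) + vf theta.

Lemma eig_disjoint (a : q) (b : h) : val a + val b = 0 -> a = 0 /\ b = 0.
Proof.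
move=> e; have e2 : - val a + val b = 0.
  by have := congr1 s e; rewrite invD !eigE inv0.
have hb : val b = 0.
  apply: (@mulrn_inj K _ _ 1); rewrite mulr2n -[RHS](addr0 0) -{1}e -e2.
  by rewrite addrACA subrr add0r.
by split; apply: val_inj => //; move: e; rewrite hb addr0.
Qed.

Lemma ecoef0 c : (c <= 1)%N -> ecoef c 0 = 1.
Proof. by case: c => [|[|c]] // _; rewrite /ecoef divr1. Qed.

Lemma Aexp_eq0 i (alpha : C -> q) (theta : C -> h) : fH i alpha -> Aexp (vf alpha) + vf theta = 0 ->
  (alpha = fun=> 0) /\ (theta = fun=> 0).
Proof.
move=> ha e; have hva := fH_val ha.
have ew w : Aexp (vf alpha) w + val (theta w) = 0 := congr1 (fun f : C -> g => f w) e.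
(* If alpha has order n, the terms of A(alpha) with a positive power of ad y have order n + 1, so up
   to degree n the equation reads alpha + theta = 0 in the direct sum of q and h. *)
have step (n m : nat) w : vord n (vf alpha) -> flt m w -> (m < n.+1)%N -> alpha w = 0 /\ theta w = 0.
  move=> o hw mn; apply: eig_disjoint; rewrite -[RHS](ew w); congr (_ + _).
  rewrite /Aexp (osum_ser fH_y vord_y (ecoef 1) hva hw (ltnSn m)) big_ord_recl big1.
    by rewrite addr0 /ter ecoef0 // qinj1 scale1r.
  move=> k _; rewrite /ter (@vord_ad _ _ _ _ fH_y vord_y _ n i _ hva o m w hw) ?scaler0 //.
  by apply: leq_trans mn _; rewrite -addn1 addnC leq_add2r.
have all n : vord n (vf alpha).
  elim: n => [|n IH]; first exact: vord0.
  by move=> m w hw mn; rewrite /vf; have [-> _] := step n m w IH hw mn.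
by split; apply: funext => w; have [m hw] := flt_ex w; case: (step m m w (all m) hw (ltnSn m)).
Qed.

Lemma key_unique i a (alpha alpha' : C -> q) (theta theta' : C -> h) :
  fH i alpha -> fH i alpha' -> key a alpha theta -> key a alpha' theta' ->
  alpha = alpha' /\ theta = theta'.
Proof.
move=> h1 h2 k1 k2.
have [||e1 e2] := @Aexp_eq0 i (alpha - alpha') (theta - theta').
- exact: fH_sub.
- have -> : vf (theta - theta') = vf theta - vf theta' by [].
  have -> : Aexp (vf (alpha - alpha')) = Aexp (vf alpha) - Aexp (vf alpha').
    apply/eqP; rewrite eq_sym subr_eq; apply/eqP.
    apply: (osum_eq (osum_ser fH_y vord_y (ecoef 1) (fH_val h1))) => n m w hw mn.
    rewrite fctDE /Aexp (osum_ser fH_y vord_y (ecoef 1) (fH_val (fH_sub h1 h2)) hw mn).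
    rewrite (osum_ser fH_y vord_y (ecoef 1) (fH_val h2) hw mn).
    rewrite -big_split; apply: eq_bigr => k _ /=.
    rewrite -fctDE -terD; congr (ter _ _ _ _ _).
    by apply: funext => v; rewrite fctDE /vf !fctDE !fctNE valD valN subrK.
  by rewrite addrACA -k1 -opprD -k2 subrr.
split; apply/eqP; rewrite -subr_eq0; apply/eqP.
  by rewrite e1.
by rewrite e2.
Qed.

(** The derivation rule for the bracket, where y composed with c_beta is beta itself; [beta, phi] is
    then reversed to match the hypotheses of [exp_der] and [zero_curvature]. *)
Lemma Flbr_gpt_cod i j (beta : C -> q) phi w : fH j beta -> fH i phi ->
  Flbr y phi (cod beta w) = (- Flbr phi (vf beta) + Flbr y (fun w => phi (cod beta w))) w.
Proof.
move=> hb hp; rewrite fctDE [LHS](conv_cod bl fH_y hp hb); congr (_ + _).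
have -> : (fun w => y (cod beta w)) = vf beta.
  by apply: funext => v; rewrite /gpt_q (gpt_cod hb).
rewrite -[conv _ _ _]/(Flbr (vf beta) phi) (Flbr_anti (fH_val hb) hp) !fctNE sgn_fct.
by rewrite sgnN sgnsgn addbb.
Qed.

Lemma Eexp_der i j a (beta : C -> q) : homog i a -> fH j beta ->
  (fun w => Eexp a (cod beta w)) = Flbr (Eexp a) (Aexp (vf beta)).
Proof.
move=> ha hb; have hc := @fH_const K q g i a ha; have hvb := fH_val hb.
apply: (osum_eq (u := cau (fun k l => Flbr (ter y (ecoef 0) (Fconst a) k) (ter y (ecoef 1) (vf beta) l)))); last first.
  exact: (osum_conv bl (fun n => fH_ter fH_y _ n hc) (fun n => fH_ter fH_y _ n hvb)
    (osum_ser fH_y vord_y _ hc) (osum_ser fH_y vord_y _ hvb)).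
move=> n m w hw mn.
(* Truncation at n + 1, since c_beta may raise the degree by one; the zeroth term drops out because
   the counit kills the image of c_beta. *)
rewrite -[LHS]/(ser y (ecoef 0) (Fconst a) (cod beta w)) (osum_ser fH_y vord_y (ecoef 0) hc (flt_cod hb hw) (n := n.+1)) //.
rewrite big_ord_recl {1}/ter /= /Fconst counit_cod rscale0r scaler0 add0r.
apply: eq_bigr => k _.
pose D (phi : C -> g) : C -> g := fun w => phi (cod beta w).
rewrite (@exp_der _ (@Flbr K q g) y _ _ _ D) //.
- exact: fct_torsion.
- exact: FlbrDl.
- exact: FlbrDr.
- exact: (adrec_ter fH_y _ hc).
- exact: (adrec_ter fH_y _ hvb).
- by move=> k' l'; apply: (Flbr_der fH_y (fH_ter fH_y _ _ hc) (fH_ter fH_y _ _ hvb)).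
- apply: funext => v; rewrite /D (ter0 _ hc (ecoef0 _)) // /Fconst counit_cod.
  by rewrite rscale0r.
move=> n'; apply: funext => v; rewrite /D (Flbr_gpt_cod _ hb (fH_ter fH_y _ _ hc)).
by rewrite (ter0 _ hvb (ecoef0 _)).
Qed.

Lemma Flbr_const i j (a b : g) : homog i a -> homog j b ->
  Flbr (Fconst a) (Fconst b) = Fconst (lbr a b) :> (C -> g).
Proof.
move=> ha hb; have hca := @fH_const K q g i a ha; have hcb := @fH_const K q g j b hb.
apply: funext => w; rewrite [LHS](convE bl hca hcb).
rewrite -[RHS](sw_counitl (h := fun w => lbr a b *:> counit w)); last first.
  by move=> u v; rewrite counitD rscaleDr.
apply: sw_eq => u v; rewrite /Fconst counit_parn lbr_rscale counitM counit_uC -rscaleA -!lbrZr.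
by rewrite -rscaleZ (scale_homog _ hb) parnn addbb.
Qed.

Lemma Eexp_br i j a b : homog i a -> homog j b -> Flbr (Eexp a) (Eexp b) = Eexp (lbr a b).
Proof.
move=> ha hb; have hca := @fH_const K q g i a ha; have hcb := @fH_const K q g j b hb.
have hcc := @fH_const K q g _ _ (homog_lbr _ _ _ _ ha hb).
apply: (osum_eq (u := ter y (ecoef 0) (Fconst (lbr a b)))); last exact: (osum_ser fH_y vord_y _ hcc).
have -> : ter y (ecoef 0) (Fconst (lbr a b)) =
    cau (fun k l => Flbr (ter y (ecoef 0) (Fconst a) k) (ter y (ecoef 0) (Fconst b) l)).
  apply: funext => N; symmetry; apply: (@exp_br _ (@Flbr K q g) y).
  - exact: fct_torsion.
  - exact: FlbrDl.
  - exact: FlbrDr.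
  - exact: (adrec_ter fH_y _ hca).
  - exact: (adrec_ter fH_y _ hcb).
  - exact: (adrec_ter fH_y _ hcc).
  - by move=> k l; apply: (Flbr_der fH_y (fH_ter fH_y _ _ hca) (fH_ter fH_y _ _ hcb)).
  rewrite (ter0 _ hcc (ecoef0 _)) // (ter0 _ hca (ecoef0 _)) // (ter0 _ hcb (ecoef0 _)) //.
  exact/esym/(Flbr_const ha hb).
exact: (osum_conv bl (fun n => fH_ter fH_y _ n hca) (fun n => fH_ter fH_y _ n hcb)
    (osum_ser fH_y vord_y _ hca) (osum_ser fH_y vord_y _ hcb)).
Qed.

Lemma fH_Eexp i a : homog i a -> fH i (Eexp a).
Proof. by move=> ha; apply: (fH_ser fH_y vord_y); apply: fH_const. Qed.
Lemma fH_Aexp i phi : fH i phi -> fH i (Aexp phi).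
Proof. exact: (fH_ser fH_y vord_y). Qed.

(** For phi = alpha and psi = beta this is the function of the commutator of c_alpha and c_beta, by
    [cod_comm]; for coefficients theta and eta, the part of the commutator in which each
    coderivation differentiates the other coefficient. *)
Definition dcomm (e : bool) (N : zmodType) (phi psi : C -> N) (alpha beta : C -> q) : C -> N :=
  fun w => phi (cod beta w) - sgn e (psi (cod alpha w)).

Lemma fH_dcomm i j (N : superModType K) (phi psi : C -> N) alpha beta :
  fH i phi -> fH j psi -> fH i alpha -> fH j beta ->
  fH (i (+) j) (dcomm (i && j) phi psi alpha beta).
Proof.
move=> h1 h2 ha hb; have e1 := fH_comp h1 hb; have e2 := fH_comp h2 ha.
apply: (@fH_ext _ _ _ _ ((fun w => phi (cod beta w)) - sgn (i && j) (fun w => psi (cod alpha w)))).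
  by move=> w; rewrite fctDE fctNE sgn_fct.
by apply: fH_sub; [rewrite addbC|apply: fH_sgnf].
Qed.

Lemma Aexp_curvature i j (alpha beta : C -> q) : fH i alpha -> fH j beta ->
  dcomm (i && j) (Aexp (vf alpha)) (Aexp (vf beta)) alpha beta -
    Aexp (vf (dcomm (i && j) alpha beta alpha beta)) =
  Flbr (Aexp (vf alpha)) (Aexp (vf beta)).
Proof.
move=> ha hb; have hva := fH_val ha; have hvb := fH_val hb.
have hc := fH_dcomm ha hb ha hb; have hvc := fH_val hc.
set gam := dcomm _ _ _ _ _ in hc hvc *.
pose D (phi : C -> g) : C -> g := fun w => phi (cod alpha w).
pose D' (phi : C -> g) : C -> g := fun w => phi (cod beta w).
apply: (osum_eq (u := cau (fun k l => Flbr (ter y (ecoef 1) (vf alpha) k) (ter y (ecoef 1) (vf beta) l)))); last first.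
  exact: (osum_conv bl (fun n => fH_ter fH_y _ n hva) (fun n => fH_ter fH_y _ n hvb)
    (osum_ser fH_y vord_y _ hva) (osum_ser fH_y vord_y _ hvb)).
have e0 : vf gam = D' (vf alpha) - sgn (i && j) (D (vf beta)).
  by apply: funext => w; rewrite fctDE fctNE sgn_fct /vf /gam /dcomm valD valN val_sgn.
have zc := @zero_curvature _ (@Flbr K q g) y (@fct_torsion _ _ _) (@FlbrDl _ _ _) (@FlbrDr _ _ _)
  D D' (i && j) (ter y (ecoef 1) (vf alpha)) (ter y (ecoef 1) (vf beta)) (ter y (ecoef 1) (vf gam)).
have {}zc N : cau (fun k l => Flbr (ter y (ecoef 1) (vf alpha) k) (ter y (ecoef 1) (vf beta) l)) N =
  D' (ter y (ecoef 1) (vf alpha) N.+1) - sgn (i && j) (D (ter y (ecoef 1) (vf beta) N.+1))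
   - ter y (ecoef 1) (vf gam) N.+1.
  apply: zc => //.
  - exact: (adrec_ter fH_y _ hva).
  - exact: (adrec_ter fH_y _ hvb).
  - exact: (adrec_ter fH_y _ hvc).
  - by move=> k l; apply: (Flbr_der fH_y (fH_ter fH_y _ _ hva) (fH_ter fH_y _ _ hvb)).
  - move=> k; apply: funext => v; rewrite /D' (Flbr_gpt_cod _ hb (fH_ter fH_y _ _ hva)).
    by rewrite (ter0 _ hvb (ecoef0 _)).
  - move=> k; apply: funext => v; rewrite /D (Flbr_gpt_cod _ ha (fH_ter fH_y _ _ hvb)).
    by rewrite (ter0 _ hva (ecoef0 _)).
  - move=> k; rewrite (Flbr_anti (fH_ter fH_y _ _ hvb) (fH_ter fH_y _ _ hva)).
    by rewrite andbC.
  by rewrite (ter0 _ hvc (ecoef0 _)) // (ter0 _ hva (ecoef0 _)) // (ter0 _ hvb (ecoef0 _)).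
move=> n m w hw mn.
rewrite fctDE fctNE /dcomm /Aexp.
rewrite (osum_ser fH_y vord_y (ecoef 1) hva (flt_cod hb hw) (n := n.+1)) //.
rewrite (osum_ser fH_y vord_y (ecoef 1) hvb (flt_cod ha hw) (n := n.+1)) //.
rewrite (osum_ser fH_y vord_y (ecoef 1) hvc hw (n := n.+1)); last exact: leqW.
rewrite (morph_sum (f := sgn (i && j))); last exact: sgnD.
rewrite -!sumrB big_ord_recl [X in X + _](_ : _ = 0) ?add0r.
  apply: eq_bigr => k _; rewrite zc !fctDE !fctNE sgn_fct /D /D' //.
rewrite (ter0 _ hvc (ecoef0 _)) // (ter0 _ hva (ecoef0 _)) // (ter0 _ hvb (ecoef0 _)) //.
by rewrite e0 !fctDE !fctNE sgn_fct subrr.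
Qed.

(** Compose the equation for a with c_beta, the one for b with c_alpha, and subtract. [Eexp_der] and
    [Aexp_curvature] evaluate the result, and [Eexp_br] the bracket of the two equations. *)
Lemma key_br i j a b (alpha beta : C -> q) (theta eta : C -> h) :
  homog i a -> homog j b -> fH i alpha -> fH j beta -> fH i theta -> fH j eta ->
  key a alpha theta -> key b beta eta ->
  key (lbr a b) (dcomm (i && j) alpha beta alpha beta)
    (dcomm (i && j) theta eta alpha beta + Flbr theta eta).
Proof.
move=> ha hb h1 h2 h3 h4 k1 k2; rewrite /key -(Eexp_br ha hb).
have c12 := Aexp_curvature h1 h2.
have dA e (phi psi phi' psi' : C -> g) : dcomm e (phi + phi') (psi + psi') alpha beta =
    dcomm e phi psi alpha beta + dcomm e phi' psi' alpha beta.
  apply: funext => w; rewrite /dcomm !fctDE sgnD opprD addrACA //.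
have e1 := Eexp_der ha h2; have e2 := Eexp_der hb h1.
have e3 : dcomm (i && j) (Eexp a) (Eexp b) alpha beta =
    Flbr (Eexp a) (Aexp (vf beta)) + Flbr (Aexp (vf alpha)) (Eexp b).
  apply: funext => w; rewrite /dcomm fctDE -e1; congr (_ + _).
  rewrite (Flbr_anti (fH_Aexp (fH_val h1)) (fH_Eexp hb)) -e2 fctNE sgn_fct //.
have vD : vf (dcomm (i && j) theta eta alpha beta + Flbr theta eta) =
    dcomm (i && j) (vf theta) (vf eta) alpha beta + Flbr (vf theta) (vf eta).
  apply: funext => w; rewrite fctDE /vf fctDE valD /dcomm valD valN val_sgn; congr (_ + _).
  rewrite [LHS](f_equal val (convE (bilin_lbr h) h3 h4 w)) [RHS](convE bl (fH_val h3) (fH_val h4)).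
  by rewrite (sw_morph (h := val)).
rewrite vD.
have e4 : dcomm (i && j) (vf theta) (vf eta) alpha beta =
   dcomm (i && j) (Eexp a) (Eexp b) alpha beta -
   dcomm (i && j) (Aexp (vf alpha)) (Aexp (vf beta)) alpha beta.
  by rewrite k1 k2 dA addrC addKr.
(* P, Q, R, S are the four brackets in the expansion of [A(alpha) + theta, A(beta) + eta]; X is the
   [dcomm] term of A(alpha) and A(beta). *)
have AG (X P Q R S : C -> g) : P + Q + (R + S) = X - P + (P + R + (P + Q) - X + S).
  have e Y : X - P + (Y - X + S) = Y - P + S by rewrite addrA [X - P + _]addrC addrA subrK.
  by rewrite e -[P + R + (P + Q)]addrA [P + _ - P]addrC addKr [R + (P + Q)]addrC !addrA.
have -> : Aexp (vf (dcomm (i && j) alpha beta alpha beta)) =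
    dcomm (i && j) (Aexp (vf alpha)) (Aexp (vf beta)) alpha beta -
    Flbr (Aexp (vf alpha)) (Aexp (vf beta)).
  by rewrite -c12 subKr.
rewrite e4 e3 k1 k2 !FlbrDl !FlbrDr; exact: AG.
Qed.
End Pair.

(** * The power series t coth t and - tanh (t / 2) *)

(** A copy of nat -> rat that carries the Cauchy product, so that [ring] can be used on power
    series. *)
Definition pser : Type := nat -> rat.
HB.instance Definition _ := GRing.Zmodule.copy pser (nat -> rat).

Section PowerSeries.
Implicit Types f h : pser.

Definition psmul f h : pser := cau (fun k l => f k * h l).
Definition ps1 : pser := fun n => (n == 0%N)%:R.
Let T (f : nat -> rat) n := \poly_(i < n.+1) f i.
(** Up to degree n the product is that of the truncated polynomials, from which commutativity and
    associativity are inherited. *)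
Lemma psmulE f h m n : (m <= n)%N -> psmul f h m = (T f n * T h n)`_m.
Proof.
move=> mn; rewrite coefM; apply: eq_bigr => j _.
rewrite !coef_poly !ltnS (leq_trans _ mn) ?(leq_trans _ mn) ?leq_subr //.
by rewrite -ltnS.
Qed.
Lemma psmulC : commutative psmul.
Proof. by move=> f h; apply: funext => n; rewrite !(psmulE _ _ (leqnn n)) mulrC. Qed.
Lemma psmulA : associative psmul.
Proof.
move=> f h k; apply: funext => n.
have E u v w : psmul u (psmul v w) n = (T u n * (T v n * T w n))`_n.
  rewrite coefM; apply: eq_bigr => j _.
  by rewrite (psmulE _ _ (leq_subr j n)) coef_poly ltnS -ltnS ltn_ord.
by rewrite E psmulC E [in RHS]mulrC mulrA.
Qed.
Lemma psmulDl : left_distributive psmul +%R.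
Proof.
move=> f h k; apply: funext => n; rewrite fctDE /psmul /cau -big_split.
by apply: eq_bigr => j _; rewrite fctDE mulrDl.
Qed.
Lemma psmul1 : left_id ps1 psmul.
Proof.
move=> f; apply: funext => n; rewrite /psmul /cau big_ord_recl big1 ?addr0.
  by rewrite mul1r subn0.
by move=> j _; rewrite mul0r.
Qed.
HB.instance Definition _ := GRing.Zmodule_isComPzRing.Build pser
  psmulA psmulC psmul1 psmulDl.

Lemma pserM f h n : (f * h) n = cau (fun k l => f k * h l) n. Proof. by []. Qed.
Lemma pserD f h n : (f + h) n = f n + h n. Proof. by []. Qed.
Lemma pserN f n : (- f) n = - f n. Proof. by []. Qed.

Lemma pser_mulI f h : f 0%N != 0 -> f * h = 0 -> h = 0.
Proof.
move=> f0 e; apply: funext => n; elim/ltn_ind: n => n IH.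
have := congr1 (fun f : pser => f n) e; rewrite pserM /cau big_ord_recl /= subn0 big1 ?addr0.
  by move/eqP; rewrite mulf_eq0 (negbTE f0) /= => /eqP.
by move=> j _; rewrite IH ?mulr0 // /bump /= add1n ltn_subrL /=; case: n {IH} j => // -[].
Qed.

Definition pX : pser := fun n => (n == 1%N)%:R.
Lemma pXM f n : (pX * f) n.+1 = f n.
Proof.
rewrite pserM cau_l mul0r add0r /cau big_ord_recl big1 ?addr0.
  by rewrite subn0 mul1r.
by move=> j _; rewrite mul0r.
Qed.
Lemma pXM0 f : (pX * f) 0%N = 0. Proof. by rewrite pserM cau0 mul0r. Qed.
Lemma pX_mulI f : pX * f = 0 -> f = 0.
Proof. by move=> e; apply: funext => n; rewrite -pXM e. Qed.

Definition pexp (a : rat) : pser := fun n => a ^+ n / n`!%:R.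
Lemma pexpD a b : pexp a * pexp b = pexp (a + b).
Proof.
apply: funext => n; rewrite pserM /cau /pexp addrC exprDn mulr_suml.
apply: eq_bigr => j _.
have le : (j <= n)%N by rewrite -ltnS.
have nz m : m`!%:R != 0 :> rat by rewrite Num.Theory.pnatr_eq0 -lt0n fact_gt0.
apply: (canRL (mulfK (nz n))); rewrite -(bin_fact le) !natrM.
transitivity (a ^+ j * b ^+ (n - j) * 'C(n, j)%:R * (j`!%:R / j`!%:R) * ((n - j)`!%:R / (n - j)`!%:R)).
  by ring.
by rewrite !mulfV // !mulr1 mulr_natr [a ^+ j * _]mulrC.
Qed.
Lemma pexp0 : pexp 0 = 1.
Proof.
apply: funext => -[|n]; rewrite /pexp ?expr0 ?divr1 //.
by rewrite expr0n mul0r.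
Qed.

Lemma pserMn f m n : (m%:R * f) n = f n *+ m.
Proof. by rewrite mulr_natl; elim: m => [|m IH] //; rewrite !mulrS pserD IH. Qed.
Lemma pser1 n : (1 : pser) n = (n == 0%N)%:R. Proof. by []. Qed.

(** This says (1 - e^{-t}) / t . t coth t - tanh(t / 2) = e^{-t}, the equation for an element of q.
    In terms of P = e^{t/2} and N = e^{-t/2} it reduces, once denominators are cleared, to P N =
    1. *)
Lemma key_series_q n : cau (fun k l => ecoef 1 k * p1_series l) n + q1_series n = ecoef 0 n.
Proof.
pose h : rat := 2%:R^-1.
pose P := pexp h; pose N := pexp (- h).
have PN : P * N = 1 by rewrite pexpD subrr pexp0.
have sgnX (a : rat) m : (- a) ^+ m = if odd m then - a ^+ m else a ^+ m.
  by rewrite exprNn -signr_odd; case: odd; rewrite /= ?mulN1r ?mul1r.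
have hh : h + h = 1 by [].
pose Ch : pser := fun n => if odd n then 0 else n`!%:R^-1.
pose G : pser := fun n => if odd n then 0 else n.+1`!%:R^-1.
pose S : pser := fun n => if odd n then h ^+ n / n`!%:R else 0.
pose C : pser := fun n => if odd n then 0 else h ^+ n / n`!%:R.
pose p1 : pser := p1_series; pose q1 : pser := q1_series.
pose phi : pser := ecoef 1; pose e0 : pser := ecoef 0.
have e0E : e0 = N * N.
  rewrite pexpD -opprD hh; apply: funext => m.
  by rewrite /e0 /ecoef /pexp addn0.
have CE : 2%:R * C = P + N.
  apply: funext => m; rewrite pserMn pserD /C /P /N /pexp sgnX.
  by case: odd; rewrite ?mulNr ?subrr ?mul0rn // mulr2n.
have SE : 2%:R * S = P - N.
  apply: funext => m; rewrite pserMn pserD pserN /S /P /N /pexp sgnX.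
  by case: odd; rewrite ?mulNr ?opprK ?subrr ?mul0rn // mulr2n.
have PE : P * P = pexp 1 by rewrite pexpD.
have NE : N * N = pexp (- 1) by rewrite pexpD -opprD.
have ChE : 2%:R * Ch = P * P + N * N.
  rewrite PE NE; apply: funext => m; rewrite pserMn pserD /Ch /pexp sgnX expr1n.
  by case: odd; rewrite ?mulNr ?mul1r ?subrr ?mul0rn // mulr2n.
have GE : 2%:R * (pX * G) = P * P - N * N.
  rewrite PE NE; apply: funext => -[|m].
    by rewrite pserMn pXM0 mul0rn pserD pserN /pexp subrr.
  rewrite pserMn pXM pserD pserN /G /pexp sgnX expr1n /=.
  by case: odd => /=; rewrite ?mulNr ?mul1r ?opprK ?subrr ?mul0rn // mulr2n.
have phiE : pX * phi = 1 - e0.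
  apply: funext => -[|m].
    by rewrite pXM0 pserD pserN pser1 /e0 /ecoef expr0 divr1 subrr.
  rewrite pXM pserD pserN pser1 /e0 /phi /ecoef addn0 addn1 add0r exprS.
  by rewrite mulN1r mulNr opprK.
have p1E : p1 * G = Ch.
  apply: funext => m; rewrite pserM /cau; exact: fdivP.
have q1E : q1 * C = - S.
  apply: funext => m; rewrite pserM pserN /q1 /q1_series /cau -(@fdivP S C m); last by rewrite /C.
  by rewrite -sumrN; apply: eq_bigr => j _; rewrite mulNr.
suff H : phi * p1 + q1 - e0 = 0.
  have := congr1 (fun f : pser => f n) (subr0_eq H); rewrite pserD pserM //.
(* The denominators are G = sinh t / t, C = cosh(t / 2) and t; the factor 8 turns the hyperbolic
   series into integral combinations of products of P and N. *)
apply: (@pser_mulI G); first by rewrite /G.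
apply: (@pser_mulI C); first by rewrite /C.
apply: pX_mulI; apply: (@pser_mulI 8%:R); first by rewrite -[8%:R]mulr1 pserMn.
transitivity (4%:R * (pX * phi) * (p1 * G) * (2%:R * C) + 4%:R * (2%:R * (pX * G)) * (q1 * C)
   - 2%:R * (2%:R * (pX * G)) * (2%:R * C) * e0).
  by ring.
rewrite phiE p1E q1E CE GE e0E.
transitivity (2%:R * ((1 - N * N) * (2%:R * Ch) * (P + N) - (P * P - N * N) * (2%:R * S) - (P * P - N * N) * (P + N) * (N * N))).
  by ring.
rewrite ChE SE.
transitivity (2%:R * (P + N) * (2%:R * (P * N) - 2%:R * (P * N) * (P * N))).
  by ring.
by rewrite PN; ring.
Qed.

(* The series -t and 1, for which f1_series (ad y) a = [a, y]. *)
Definition f1_series (n : nat) : rat := if n == 1%N then -1 else 0.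
Definition delta0 (n : nat) : rat := if n == 0%N then 1 else 0.
(** This says (1 - e^{-t}) / t . (- t) + 1 = e^{-t}: for a in h the pair ([a, y], a) solves the
    equation. *)
Lemma key_series_h n : cau (fun k l => ecoef 1 k * f1_series l) n + delta0 n = ecoef 0 n.
Proof.
case: n => [|n]; first by rewrite cau0 /f1_series mulr0 add0r /delta0 /ecoef divr1.
rewrite cau_r [f1_series 0]/f1_series mulr0 !addr0 /cau big_ord_recr big1 /= ?add0r.
  by rewrite subnn /f1_series /= /ecoef addn0 addn1 exprS mulrN1 mulN1r mulNr.
by move=> k _; rewrite /f1_series eqSS subn_eq0 leqNgt ltn_ord mulr0.
Qed.
End PowerSeries.

(** * The explicit solution *)

Section SerOps.
Variables (K : superComAlgType) (M : superModType K) (g : lieSuperType K).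
Notation C := (SymAlg M).
Variable y : C -> g.
Hypotheses (hy : fH false y) (oy : vord 1 y).

Lemma serDl i (f f' : nat -> rat) phi : fH i phi ->
  ser y f phi + ser y f' phi = ser y (fun n => f n + f' n) phi.
Proof.
move=> h; apply: (@osum_eq _ _ _ (ter y (fun n => f n + f' n) phi)); last exact: osum_ser h.
move=> n m w hw mn; rewrite fctDE !(osum_ser hy oy _ h hw mn) -big_split.
by apply: eq_bigr => k _; rewrite /ter qinjD scalerDl.
Qed.
Lemma serDr i f (phi psi : C -> g) : fH i phi -> fH i psi ->
  ser y f (phi + psi) = ser y f phi + ser y f psi.
Proof.
move=> h1 h2; have h := fH_add h1 h2.
apply: (@osum_eq _ _ _ (ter y f (phi + psi))); first exact: osum_ser h.
move=> n m w hw mn; rewrite fctDE (osum_ser hy oy _ h1 hw mn) (osum_ser hy oy _ h2 hw mn) -big_split.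
by apply: eq_bigr => k _; rewrite terD.
Qed.
Lemma eq_ser f f' (phi : C -> g) : f =1 f' -> ser y f phi = ser y f' phi.
Proof. by move=> e; congr (ser y _ _); apply: funext. Qed.
Lemma ser_delta0 i phi : fH i phi -> ser y delta0 phi = phi.
Proof.
move=> h; apply: (@osum_eq _ _ _ (ter y delta0 phi)); first exact: osum_ser h.
move=> [|n] m w hw // mn; rewrite big_ord_recl big1 ?addr0 => [|k _].
  by rewrite /ter /delta0 /= qinj1 scale1r.
by rewrite /ter /delta0 /= qinj0 scale0r.
Qed.
Lemma ser_f1 i phi : fH i phi -> ser y f1_series phi = - Flbr y phi.
Proof.
move=> h; apply: (@osum_eq _ _ _ (ter y f1_series phi)); first exact: osum_ser h.
have h' := fH_ad hy 1 h.
move=> [|[|n]] m w hw // mn.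
  rewrite big_ord_recl big_ord0 addr0 /ter /f1_series /= qinj0 scale0r fctNE.
  have o1 : vord 1 (Flbr y phi) := @vord_ad _ _ _ _ hy oy 1 0 _ _ h (@vord0 _ _ _ _).
  by rewrite (o1 m w hw mn) oppr0.
rewrite !big_ord_recl big1 ?addr0 => [|k _].
  rewrite /ter /f1_series /= qinj0 scale0r add0r qinjN qinj1 scaleN1r //.
by rewrite /ter /f1_series /= qinj0 scale0r.
Qed.
End SerOps.

Section Alpha1.
Variables (K : superComAlgType) (g : lieSuperType K) (s : involution g).
Notation h := (eig s false).
Notation q := (eig s true).
Notation C := (SymAlg q).
Local Notation bl := (bilin_lbr g).
Local Notation y := (@gpt_q K g s : C -> g).
Implicit Types a b : g.

Lemma php_val a : val (ph s a) + val (pq s a) = a.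
Proof.
rewrite /= -scalerDr addrACA subrr addr0; exact: halfD.
Qed.
Lemma homog_ph i a : homog i a -> homog i (val (ph s a)).
Proof.
move=> ha; rewrite /=; apply: (@homogZM _ _ false i); first exact: homog_qinj.
by apply: homogD => //; apply: inv_homog.
Qed.
Lemma homog_pq i a : homog i a -> homog i (val (pq s a)).
Proof.
move=> ha; rewrite /=; apply: (@homogZM _ _ false i); first exact: homog_qinj.
by apply: homogD => //; apply: homogN; apply: inv_homog.
Qed.

Lemma fconstD (N : superModType K) (a b : N) : Fconst (a + b) = Fconst a + Fconst b :> (C -> N).
Proof. by apply: funext => w; rewrite fctDE /Fconst rscaleDl. Qed.

Lemma vf_alpha1 i a : homog i a -> vf (alpha1 (s:=s) a) =
  ser y f1_series (Fconst (val (ph s a))) + ser y p1_series (Fconst (val (pq s a))).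
Proof.
move=> ha; have hb := @fH_const K q g i _ (homog_ph ha).
apply: funext => w; rewrite /vf val_alpha1 /alpha1_val fctDE; congr (_ + _).
by rewrite (Flbr_anti hb (@fH_y K g s)) andbF (ser_f1 (@fH_y K g s) (@vord_y K g s) hb).
Qed.
Lemma vf_theta1 i a : homog i a -> vf (theta1 (s:=s) a) =
  ser y delta0 (Fconst (val (ph s a))) + ser y q1_series (Fconst (val (pq s a))).
Proof.
move=> ha; have hb := @fH_const K q g i _ (homog_ph ha).
apply: funext => w; rewrite /vf val_theta1 /theta1_val fctDE; congr (_ + _).
by rewrite (ser_delta0 (@fH_y K g s) (@vord_y K g s) hb).
Qed.
Lemma fH_alpha1 i a : homog i a -> fH i (alpha1 (s:=s) a).
Proof.
move=> ha; apply: fH_of_val; rewrite (vf_alpha1 ha).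
have hy := @fH_y K g s; have oy := @vord_y K g s.
by apply: fH_add; apply: (fH_ser hy oy); apply: fH_const; [apply: homog_ph|apply: homog_pq].
Qed.
Lemma fH_theta1 i a : homog i a -> fH i (theta1 (s:=s) a).
Proof.
move=> ha; apply: fH_of_val; rewrite (vf_theta1 ha).
have hy := @fH_y K g s; have oy := @vord_y K g s.
by apply: fH_add; apply: (fH_ser hy oy); apply: fH_const; [apply: homog_ph|apply: homog_pq].
Qed.

(** All terms are power series in ad y applied to the constant components of a, so [ser_ser] reduces
    the equation to one series identity on each eigenspace. *)
Lemma key_alpha1 i a : homog i a -> key a (alpha1 (s:=s) a) (theta1 (s:=s) a).
Proof.
move=> ha; have hy := @fH_y K g s; have oy := @vord_y K g s.
have hb := @fH_const K q g i _ (homog_ph ha); have hc := @fH_const K q g i _ (homog_pq ha).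
rewrite /key /Eexp /Aexp -{1}(php_val a) fconstD (serDr hy oy _ hb hc).
rewrite (vf_alpha1 ha) (vf_theta1 ha) (serDr hy oy _ (fH_ser hy oy _ hb) (fH_ser hy oy _ hc)).
rewrite (ser_ser hy oy _ _ hb) (ser_ser hy oy _ _ hc) addrACA.
rewrite (serDl hy oy _ _ hb) (serDl hy oy _ _ hc).
congr (_ + _); apply: eq_ser => n; [rewrite key_series_h|rewrite key_series_q] => //.
Qed.

(** The estimate of orders is available for homogeneous functions; a general constant is split by
    parity. This gives the additivity of [alpha1] and [theta1] in a. *)
Lemma osum_serc f a : osum (ter y f (Fconst a)) (ser y f (Fconst a)).
Proof.
have hy := @fH_y K g s; have oy := @vord_y K g s.
apply: osum_fsbig => n m w hw mn; rewrite -(hcE a) fconstD terD fctDE.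
rewrite (vord_ter hy oy f (fH_const q (homog_hc false a)) hw mn) add0r.
by rewrite (vord_ter hy oy f (fH_const q (homog_hc true a)) hw mn).
Qed.
Lemma sercD f a b : ser y f (Fconst (a + b)) = ser y f (Fconst a) + ser y f (Fconst b).
Proof.
apply: (osum_eq (osum_serc f (a + b))) => n m w hw mn.
rewrite fctDE (osum_serc f a hw mn) (osum_serc f b hw mn) -big_split.
by apply: eq_bigr => k _; rewrite fconstD terD.
Qed.
Lemma phD a b : ph s (a + b) = ph s a + ph s b.
Proof. by apply: val_inj; rewrite valD /= invD addrACA scalerDr. Qed.
Lemma pqD a b : pq s (a + b) = pq s a + pq s b.
Proof. by apply: val_inj; rewrite valD /= invD opprD addrACA scalerDr. Qed.
Lemma alpha1D a b : alpha1 (s:=s) (a + b) = alpha1 (s:=s) a + alpha1 (s:=s) b.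
Proof.
apply: funext => w; apply: val_inj; rewrite fctDE valD !val_alpha1 /alpha1_val.
rewrite -[ad_series _ _ _ _]/(ser y p1_series _ w) pqD valD sercD fctDE.
by rewrite phD valD fconstD FlbrDl fctDE addrACA.
Qed.
Lemma theta1D a b : theta1 (s:=s) (a + b) = theta1 (s:=s) a + theta1 (s:=s) b.
Proof.
apply: funext => w; apply: val_inj; rewrite fctDE valD !val_theta1 /theta1_val.
rewrite -[ad_series _ _ _ _]/(ser y q1_series _ w) pqD valD sercD fctDE.
by rewrite phD valD fconstD fctDE addrACA.
Qed.

Lemma rscale_parn (N : superModType K) l (k : K) (x : N) : homog l k -> parn l x *:> k = k *: x.
Proof.
move=> hk; rewrite rscaleE !(homog_hcE _ hk).
by case: (l); rewrite /= ?parK scale0r ?addr0 ?add0r.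
Qed.
Lemma fH_scalek (N : superModType K) l i (k : K) (phi : C -> N) : homog l k -> fH i phi ->
  fH (l (+) i) (fun w => k *: phi w).
Proof.
move=> hk h1; split; first split.
- by move=> x z; rewrite (fHD h1) scalerDr.
- by move=> x c; rewrite urscaleE (fHr h1) rscaleZ.
- by move=> w; rewrite parZ (par_homog hk) (fH_par h1) sgnZl sgnZr sgnsgn.
Qed.
Lemma Flbr_scale l i (k : K) phi : homog l k -> fH i phi ->
  Flbr y (fun w => k *: phi w) = (fun w => k *: Flbr y phi w).
Proof.
move=> hk h1; have hy := @fH_y K g s; apply: funext => w.
rewrite [LHS](convE bl hy (fH_scalek hk h1)) [Flbr _ _ _](convE bl hy h1).
rewrite (sw_morph (h := fun z => k *: z)); last by move=> *; rewrite scalerDr.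
apply: sw_eq => u v; rewrite -lbr_rscale -parnn -[y (parn l _)](_ : parn l (y (parn i u)) = _).
  by rewrite (rscale_parn _ hk) lbrZl.
by rewrite (fH_parn hy).
Qed.
Lemma ter_scalek f n l i (k : K) phi : homog l k -> fH i phi ->
  ter y f (fun w => k *: phi w) n = (fun w => k *: ter y f phi n w).
Proof.
move=> hk h1; have hy := @fH_y K g s.
have e : iter n (Flbr y) (fun w => k *: phi w) = (fun w => k *: iter n (Flbr y) phi w).
  by elim: n => //= n ->; rewrite (Flbr_scale hk (fH_ad hy n h1)).
apply: funext => w; rewrite /ter e !scalerA; congr (_ *: _).
by rewrite (mulKC (homog_qinj _ _) hk).
Qed.
Lemma serZ f l i (k : K) a : homog l k -> homog i a ->
  ser y f (Fconst (k *: a)) = (fun w => k *: ser y f (Fconst a) w).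
Proof.
move=> hk ha; have ec : Fconst (k *: a) = (fun w : C => k *: Fconst a w).
  by apply: funext => w; rewrite /Fconst rscaleZ.
apply: (osum_eq (osum_serc f (k *: a))) => n m w hw mn.
rewrite (osum_serc f a hw mn) scaler_sumr; apply: eq_bigr => j _.
by rewrite ec (ter_scalek _ _ hk (fH_const q ha)).
Qed.
Lemma valZ e (k : K) (b : eig s e) : val (k *: b) = k *: val b. Proof. by []. Qed.
Lemma phZ (k : K) a : ph s (k *: a) = k *: ph s a.
Proof.
apply: val_inj; rewrite valZ /= invZ -scalerDr !scalerA; congr (_ *: _).
elim/homog_ind: k => [k l Hk Hl|l k hk]; first by rewrite mulrDr mulrDl Hk Hl.
by rewrite (mulKC (homog_qinj _ _) hk).
Qed.
Lemma pqZ (k : K) a : pq s (k *: a) = k *: pq s a.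
Proof.
apply: val_inj; rewrite valZ /= invZ -scalerN -scalerDr !scalerA; congr (_ *: _).
elim/homog_ind: k => [k l Hk Hl|l k hk]; first by rewrite mulrDr mulrDl Hk Hl.
by rewrite (mulKC (homog_qinj _ _) hk).
Qed.
Lemma alpha1Z l i (k : K) a : homog l k -> homog i a ->
  alpha1 (s:=s) (k *: a) = (fun w => k *: alpha1 (s:=s) a w).
Proof.
move=> hk ha; have hka := homogZM hk ha.
apply: funext => w; apply: val_inj; rewrite valZ.
rewrite -[LHS]/(vf (alpha1 (s:=s) (k *: a)) w) -[val (alpha1 a w)]/(vf (alpha1 (s:=s) a) w).
rewrite (vf_alpha1 hka) (vf_alpha1 ha) phZ pqZ !valZ.
by rewrite (serZ _ hk (homog_ph ha)) (serZ _ hk (homog_pq ha)) !fctDE scalerDr.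
Qed.
Lemma theta1Z l i (k : K) a : homog l k -> homog i a ->
  theta1 (s:=s) (k *: a) = (fun w => k *: theta1 (s:=s) a w).
Proof.
move=> hk ha; have hka := homogZM hk ha.
apply: funext => w; apply: val_inj; rewrite valZ.
rewrite -[LHS]/(vf (theta1 (s:=s) (k *: a)) w) -[val (theta1 a w)]/(vf (theta1 (s:=s) a) w).
rewrite (vf_theta1 hka) (vf_theta1 ha) phZ pqZ !valZ.
by rewrite (serZ _ hk (homog_ph ha)) (serZ _ hk (homog_pq ha)) !fctDE scalerDr.
Qed.
End Alpha1.

(** * The representation of g on S(q) (x) V *)

Section AddEnd.
Variable X : zmodType.
(** Merely additive maps, so that scalars of any parity acting on the left lie in the same ring as
    the operators of g; [ulift] asks for the images of K and of g in one ring. *)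
Record aend := Aend { afun :> X -> X; afunD : forall x y, afun (x + y) = afun x + afun y }.
HB.instance Definition _ := gen_eqMixin aend.
HB.instance Definition _ := gen_choiceMixin aend.
Implicit Types f h : aend.

Lemma aendP f h : (forall x, f x = h x) -> f = h.
Proof.
case: f h => f fD [h hD] /= e; have {}e : f = h by apply: funext.
by rewrite -e in hD *; rewrite (Prop_irrelevance fD hD).
Qed.
Fact aend_add_subproof f h x y : f (x + y) + h (x + y) = f x + h x + (f y + h y).
Proof. by rewrite !afunD addrACA. Qed.
Definition aend_add f h := Aend (aend_add_subproof f h).
Fact aend_opp_subproof f x y : - f (x + y) = - f x + - f y.
Proof. by rewrite afunD opprD. Qed.
Definition aend_opp f := Aend (aend_opp_subproof f).
Fact aend_zero_subproof (x y : X) : 0 = 0 + 0 :> X. Proof. by rewrite addr0. Qed.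
Definition aend_zero := Aend aend_zero_subproof.
Fact aend_mul_subproof f h x y : f (h (x + y)) = f (h x) + f (h y).
Proof. by rewrite !afunD. Qed.
Definition aend_mul f h := Aend (aend_mul_subproof f h).
Definition aend_one := @Aend idfun (fun x y => erefl).

Fact aend_addA : associative aend_add.
Proof. by move=> f h k; apply: aendP => x /=; rewrite addrA. Qed.
Fact aend_addC : commutative aend_add.
Proof. by move=> f h; apply: aendP => x /=; rewrite addrC. Qed.
Fact aend_add0 : left_id aend_zero aend_add.
Proof. by move=> f; apply: aendP => x /=; rewrite add0r. Qed.
Fact aend_addN : left_inverse aend_zero aend_opp aend_add.
Proof. by move=> f; apply: aendP => x /=; rewrite addNr. Qed.
HB.instance Definition _ := GRing.isZmodule.Build aend aend_addA aend_addC aend_add0 aend_addN.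
Fact aend_mulA : associative aend_mul. Proof. by move=> f h k; apply: aendP. Qed.
Fact aend_mul1 : left_id aend_one aend_mul. Proof. by move=> f; apply: aendP. Qed.
Fact aend_mulr1 : right_id aend_one aend_mul. Proof. by move=> f; apply: aendP. Qed.
Fact aend_mulDl : left_distributive aend_mul +%R. Proof. by move=> f h k; apply: aendP. Qed.
Fact aend_mulDr : right_distributive aend_mul +%R.
Proof. by move=> f h k; apply: aendP => x /=; rewrite afunD. Qed.
HB.instance Definition _ := GRing.Zmodule_isPzRing.Build aend
  aend_mulA aend_mul1 aend_mulr1 aend_mulDl aend_mulDr.

Lemma aendDE f h x : (f + h) x = f x + h x. Proof. by []. Qed.
Lemma aendNE f x : (- f) x = - f x. Proof. by []. Qed.
Lemma aendME f h x : (f * h) x = f (h x). Proof. by []. Qed.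
Lemma aend1E x : (1 : aend) x = x. Proof. by []. Qed.
Lemma aend_sgn e f x : (sgn e f) x = sgn e (f x). Proof. by case: e. Qed.
Lemma afun0 f : f 0 = 0. Proof. exact: (morph0 (afunD f)). Qed.
End AddEnd.

Section Action.
Variables (K : superComAlgType) (g : lieSuperType K) (s : involution g).
Notation h := (eig s false).
Notation q := (eig s true).
Notation C := (SymAlg q).
Variables (V : superModType K) (chi : lie_rep h V).
Let X : zmodType := C *t V.
Local Notation bc := (bilin_act chi).

Definition thP (alpha : C -> q) (w : C) (v : V) : X := pureK (cod alpha w) v.
Definition thT (theta : C -> h) (w : C) (v : V) : X :=
  sconv (fun v' b => pureK v' (chi b v)) theta w.

Lemma thTE i theta w v : fH i theta ->
  thT theta w v = sweedler (fun a b => pureK (parn i a) (chi (theta b) v)) w.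
Proof.
move=> ht; apply: (sconvE (B := fun v' b => pureK v' (chi b v))) => // [x x' b|x].
  by rewrite pureDl.
by rewrite (bil0l bc) pure0r.
Qed.
Lemma bal_thT i theta v : fH i theta ->
  bal (fun a b : C => pureK (parn i a) (chi (theta b) v) : X).
Proof.
move=> ht; split=> [a a' b|a b b'|a k b]; rewrite ?parnD ?(fHD ht) ?pureDl ?actDl ?pureDr //.
rewrite parn_uCr (fHl ht) actZl; apply: pure_rel.
by exists (parn i k); rewrite /= urscaleE.
Qed.
Lemma pureZk (w : C) k v : pureK (w * uC k) v = pureK w (k *: v) :> X.
Proof. by apply: pure_rel; exists k; rewrite /= urscaleE. Qed.

Definition thF (a : g) (w : C) (v : V) : X := thP (alpha1 a) w v + thT (theta1 a) w v.

Lemma codD (al be : C -> q) w : cod (al + be) w = cod al w + cod be w.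
Proof. by rewrite /cod -sw_addf; apply: sw_eq => u v; rewrite fctDE symGD mulrDl. Qed.
Lemma thTD (th et : C -> h) w v : thT (th + et) w v = thT th w v + thT et w v.
Proof.
rewrite /thT /sconv -sw_addf; apply: sw_eq => u z.
rewrite -big_split; apply: eq_bigr => i _; rewrite -big_split; apply: eq_bigr => j _ /=.
by rewrite homcD actDl pureDr sgnD.
Qed.
Lemma thFD a b w v : thF (a + b) w v = thF a w v + thF b w v.
Proof. by rewrite /thF alpha1D theta1D /thP codD pureDl thTD addrACA. Qed.

Lemma thF_ok a : tlift_ok (@Krel K C V) (thF a).
Proof.
suff ok i b : homog i b -> tlift_ok (@Krel K C V) (thF b).
  have [l0 r0 k0] := ok _ _ (homog_hc false a); have [l1 r1 k1] := ok _ _ (homog_hc true a).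
  rewrite -(hcE a); split=> [m m' n|m n n'|m n m' n' r]; rewrite !thFD.
  - by rewrite l0 l1 addrACA.
  - by rewrite r0 r1 addrACA.
  - by rewrite (k0 _ _ _ _ r) (k1 _ _ _ _ r).
move=> hb; have ha := fH_alpha1 s hb; have ht := fH_theta1 s hb.
split=> [m m' n|m n n'|m n m' n' [k /= [-> ->]]]; rewrite /thF /thP !(thTE _ _ ht).
- by rewrite (fHD (fH_cod ha)) pureDl (swD (bal_thT _ ht)) addrACA.
- rewrite pureDr (sw_eq (f' := fun u z => pureK (parn i u) (chi (theta1 b z) n) + pureK (parn i u) (chi (theta1 b z) n'))).
    by rewrite sw_addf addrACA.
  by move=> u z; rewrite actDr pureDr.
rewrite urscaleE (fHr (fH_cod ha)) urscaleE pureZk (sw_uCr _ _ (bal_thT _ ht)); congr (_ + _).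
by apply: sw_eq => u z; rewrite (fHr ht) (bilk bc).
Qed.

Lemma Theta1_pure a w v : Theta1 chi a (pureK w v) = thF a w v.
Proof. exact: (tlift_pure (thF_ok a)). Qed.
Lemma Theta1D a (x y : X) : Theta1 chi a (x + y) = Theta1 chi a x + Theta1 chi a y.
Proof. exact: (tliftD (thF_ok a)). Qed.
Definition thE a : aend X := @Aend X (Theta1 chi a) (Theta1D a).

Lemma lk_ok k : tlift_ok (@Krel K C V) (fun w v => pureK (uC k * w) v : X).
Proof.
split=> [m m' n|m n n'|m n m' n' [l /= [-> ->]]].
- by rewrite mulrDr pureDl.
- by rewrite pureDr.
by rewrite urscaleE mulrA pureZk.
Qed.
Definition lkf k : X -> X := tlift (fun w v => pureK (uC k * w) v).
Lemma lkfD k (x y : X) : lkf k (x + y) = lkf k x + lkf k y.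
Proof. exact: (tliftD (lk_ok k)). Qed.
Definition lkE k : aend X := Aend (lkfD k).
Lemma lkE_pure k w v : lkE k (pureK w v) = pureK (uC k * w) v.
Proof. exact: (tlift_pure (lk_ok k)). Qed.

Lemma aend_pure (f f' : aend X) : (forall w v, f (pureK w v) = f' (pureK w v)) -> f = f'.
Proof.
move=> e; apply: aendP => x; elim/tensor_ind: x => [|w v|x y Hx Hy] //.
  by rewrite !afun0.
by rewrite !afunD Hx Hy.
Qed.
Lemma pure_sgn e (w : C) (v : V) : pureK (sgn e w) v = sgn e (pureK w v) :> X.
Proof. by apply: (sgn_additive (f := fun w => pureK w v)) => *; rewrite pureDl. Qed.
Lemma pure_sgnr e (w : C) (v : V) : pureK w (sgn e v) = sgn e (pureK w v) :> X.
Proof. by apply: (sgn_additive (f := fun v => pureK w v)) => *; rewrite pureDr. Qed.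

Lemma thE_Z l i k a : homog l k -> homog i a -> thE (k *: a) = lkE k * thE a.
Proof.
move=> hk ha; apply: aend_pure => w v; rewrite aendME [thE _ _]Theta1_pure [thE a _]Theta1_pure.
rewrite /thF afunD /thP lkE_pure; congr (_ + _).
  congr (pureK _ _); rewrite (alpha1Z s hk ha) /cod (sw_morph (h := fun z => uC k * z)).
    by apply: sw_eq => u z; rewrite [symG (_ *: _)]uGZl mulrA.
  by move=> *; rewrite mulrDr.
have ht := fH_theta1 s ha; rewrite (theta1Z s hk ha) (thTE _ _ (fH_scalek hk ht)) (thTE _ _ ht).
rewrite (sw_morph (h := lkE k)); last exact: afunD.
apply: sw_eq => u z; rewrite lkE_pure actZl -pureZk -parnn -urscaleE.
by rewrite (rscale_parn _ hk).
Qed.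
(** Scalars acting on the left supercommute with [Theta1], which supplies the right linearity
    condition in [ulift_ok]. *)
Lemma thE_lk l i k a : homog l k -> homog i a -> thE a * lkE k = sgn (i && l) (lkE k * thE a).
Proof.
move=> hk ha; apply: aend_pure => w v; rewrite aend_sgn !aendME lkE_pure.
rewrite [thE _ _]Theta1_pure [thE a _]Theta1_pure /thF afunD sgnD /thP lkE_pure.
have hal := fH_alpha1 s ha; have ht := fH_theta1 s ha; have hc := fH_cod hal.
rewrite (fHl hc) uscaleE (parn_homog _ hk) uC_sgn; congr (_ + _).
  by rewrite -pure_sgn; congr (pureK _ _); case: (i && l); rewrite //= mulNr.
rewrite !(thTE _ _ ht) (sw_uCl _ _ (bal_thT _ ht)) (sw_morph (h := lkE k)); last exact: afunD.
rewrite -sw_sgnf; apply: sw_eq => u z; rewrite lkE_pure parn_uCl (parn_homog _ hk) uC_sgn.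
by rewrite -pure_sgn; congr (pureK _ _); case: (i && l); rewrite //= mulNr.
Qed.

Lemma act_sgnl e (b : h) v : chi (sgn e b) v = sgn e (chi b v). Proof. exact: (bilsl bc). Qed.

Lemma act_Flbr i j (theta eta : C -> h) w v : fH i theta -> fH j eta ->
  chi (Flbr theta eta w) v =
  sweedler (fun a b => chi (theta (parn j a)) (chi (eta b) v)) w -
  sgn (i && j) (sweedler (fun a b => chi (eta (parn i a)) (chi (theta b) v)) w).
Proof.
move=> ht he; rewrite [Flbr _ _ _](convE (bilin_lbr h) ht he).
rewrite (sw_morph (h := fun z => chi z v)); last by move=> *; rewrite actDl.
have bb i' j' (th et : C -> h) : fH i' th -> fH j' et ->
    bal (fun a b => chi (th (parn j' a)) (chi (et b) v)).
  move=> h1 h2; split=> *; rewrite ?parnD ?(fHD h1) ?(fHD h2) ?actDl ?actDr //.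
  by rewrite parn_uCr (fHr h1) (bilk bc) (fHl h2) actZl.
have b1 := bb _ _ _ _ ht he; have b2 := bb _ _ _ _ he ht.
have b3 := bal_conv (bilin_lbr h) ht he.
rewrite (cocomm _ b2) -sw_sgnf -sw_oppf -sw_addf; apply: sw_homogb.
- by apply: (bal_morph (h := fun z => chi z v)) => // *; rewrite actDl.
- apply: bal_add => //; apply: (bal_morph (h := fun z => - sgn (i && j) z)).
    exact: bal_flip b2.
  by move=> *; rewrite sgnD opprD.
move=> l m a b ha hb; rewrite (flip_homog b2 ha hb).
rewrite !(parn_homog _ ha, parn_homog _ hb) (fH_sgn ht) (fH_sgn he) lbr_sgnl !act_sgnl.
rewrite (act_lbr _ _ (fH_homog ht ha) (fH_homog he hb)) sgnD sgnN; congr (_ - _).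
by rewrite !sgnsgn; congr sgn; case: (i) (j) (l) (m) => [] [] [] [].
Qed.

(** The cross terms of a composite, to which one operator contributes its coderivation and the other
    its chi part; they cancel in the commutator. *)
Definition thQ (gam : C -> q) j (et : C -> h) w v : X :=
  sweedler (fun u z => pureK (cod gam (parn j u)) (chi (et z) v)) w.
Definition thTT j (th et : C -> h) v z : V :=
  sweedler (fun a b => chi (th (parn j a)) (chi (et b) v)) z.

Lemma thE_comp i j a b w v : homog i a -> homog j b ->
  let al := alpha1 (s:=s) a in let be := alpha1 (s:=s) b in
  let th := theta1 (s:=s) a in let et := theta1 (s:=s) b in
  thE a (thE b (pureK w v)) =
    pureK (cod al (cod be w)) v + sgn (i && j) (thQ be i th w v) + thQ al j et w v +
    (thT (fun w => th (cod be w)) w v +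
     sweedler (fun u z => pureK (parn (i (+) j) u) (thTT j th et v z)) w).
Proof.
move=> ha hb al be th et.
have hal : fH i al := fH_alpha1 s ha; have hth : fH i th := fH_theta1 s ha.
have hbe : fH j be := fH_alpha1 s hb; have het : fH j et := fH_theta1 s hb.
have bF : bal3 (fun x z c => pureK (parn (i (+) j) x) (chi (th (parn j z)) (chi (et c) v)) : X).
  split=> [x x' z c|x z z' c|x z c c'|x k z c|x z k c].
  - by rewrite parnD pureDl.
  - by rewrite parnD (fHD hth) actDl pureDr.
  - by rewrite (fHD het) actDl actDr pureDr.
  - by rewrite parn_uCr pureZk parn_uCl (fHl hth) actZl parnn.
  - by rewrite parn_uCr (fHr hth) (bilk bc) (fHl het) actZl.
have E1 : thE a (thT et w v) =
    thQ al j et w v + sweedler (fun u z => pureK (parn (i (+) j) u) (thTT j th et v z)) w.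
  rewrite (thTE _ _ het) (sw_morph (h := thE a)); last exact: afunD.
  transitivity (thQ al j et w v +
      sweedler (fun u z => thT th (parn j u) (chi (et z) v)) w).
    by rewrite -sw_addf; apply: sw_eq => u z; rewrite [thE a _]Theta1_pure.
  congr (_ + _); transitivity (tri (fun x z c => pureK (parn (i (+) j) x)
      (chi (th (parn j z)) (chi (et c) v)) : X) w).
    rewrite -coassoc //; apply: sw_eq => u z.
    rewrite (thTE _ _ hth) sw_parn; last exact: bal_thT.
    by apply: sw_eq => x c; rewrite parnn.
  apply: sw_eq => u z.
  by rewrite (sw_morph (h := fun t => pureK _ t : X)) // => *; rewrite pureDr.
have E2 : thT th (cod be w) v = sgn (i && j) (thQ be i th w v) + thT (fun w => th (cod be w)) w v.
  rewrite (thTE _ _ hth) (sw_cod hbe _ (bal_thT _ hth)) (thTE _ _ (fH_comp hth hbe)).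
  rewrite -sw_sgnf; congr (_ + _); apply: sw_eq => u z.
    by rewrite -pure_sgn; congr (pureK _ _); rewrite (fH_parn (fH_cod hbe)) andbC.
  by rewrite parnn addbC.
rewrite [thE b _]Theta1_pure /thF afunD E1 /thP [thE a _]Theta1_pure /thF /thP E2.
by rewrite [X in X + _]addrA addrACA.
Qed.

Lemma thE_br i j a b : homog i a -> homog j b ->
  thE (lbr a b) = thE a * thE b - sgn (i && j) (thE b * thE a).
Proof.
move=> ha hb; apply: aend_pure => w v.
rewrite aendDE aendNE aend_sgn !aendME (thE_comp _ _ ha hb) (thE_comp _ _ hb ha).
have hal := fH_alpha1 s ha; have hth := fH_theta1 s ha.
have hbe := fH_alpha1 s hb; have het := fH_theta1 s hb.
have hab := homog_lbr _ _ _ _ ha hb.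
have [ea et] := key_unique (fH_alpha1 s hab) (fH_dcomm hal hbe hal hbe) (key_alpha1 s hab)
  (key_br ha hb hal hbe hth het (key_alpha1 s ha) (key_alpha1 s hb)).
rewrite [thE _ _]Theta1_pure /thF /thP ea et -(cod_comm _ hal hbe) thTD.
have -> : thT (dcomm (i && j) (theta1 a) (theta1 b) (alpha1 a) (alpha1 b)) w v =
    thT (fun w => theta1 a (cod (alpha1 b) w)) w v -
    sgn (i && j) (thT (fun w => theta1 b (cod (alpha1 a) w)) w v).
  rewrite (thTE _ _ (fH_dcomm hth het hal hbe)) (thTE _ _ (fH_comp hth hbe)) (thTE _ _ (fH_comp het hal)).
  rewrite -sw_sgnf -sw_oppf -sw_addf; apply: sw_eq => u z.
  by rewrite [j (+) i]addbC /dcomm actDl (morphN (f := fun t => chi t v) _ (fun x y => actDl chi x y v))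
    act_sgnl pureDr pureNr pure_sgnr.
have -> : thT (Flbr (theta1 a) (theta1 b)) w v =
    sweedler (fun u z => pureK (parn (i (+) j) u) (thTT j (theta1 a) (theta1 b) v z)) w -
    sgn (i && j) (sweedler (fun u z => pureK (parn (j (+) i) u) (thTT i (theta1 b) (theta1 a) v z)) w).
  rewrite (thTE _ _ (fH_conv (bilin_lbr _) hth het)) -sw_sgnf -sw_oppf -sw_addf; apply: sw_eq => u z.
  by rewrite (act_Flbr _ _ hth het) pureDr pureNr pure_sgnr [j (+) i]addbC.
rewrite pureDl pureNl pure_sgn !sgnD sgnsgn andbC addbb /= !opprD.
(* Q and R are the cross terms [thQ], which occur in both composites. *)
have AG (Y : zmodType) (A B Q R T T' S S' : Y) :
    A - B + (T - T' + (S - S')) = A + Q + R + (T + S) + (- B - R - Q + (- T' - S')).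
  rewrite [RHS]addrACA [T + S + _]addrACA; congr (_ + _).
  by rewrite addrA [A + Q + R + _]addrACA subrr addr0 addrAC addrK.
exact: AG.
Qed.

Lemma lkED k l : lkE (k + l) = lkE k + lkE l.
Proof. by apply: aend_pure => w v; rewrite aendDE !lkE_pure uCD mulrDl pureDl. Qed.
Lemma lkEM k l : lkE (k * l) = lkE k * lkE l.
Proof. by apply: aend_pure => w v; rewrite aendME !lkE_pure uCM mulrA. Qed.
Lemma lkE1 : lkE 1 = 1.
Proof. by apply: aend_pure => w v; rewrite aend1E lkE_pure mul1r. Qed.
Lemma thED a b : thE (a + b) = thE a + thE b.
Proof. by apply: aend_pure => w v; rewrite aendDE [thE _ _]Theta1_pure [thE a _]Theta1_pure [thE b _]Theta1_pure thFD. Qed.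

Lemma rho_ok : ulift_ok lkE thE.
Proof.
have eZ k a : thE (k *: a) = lkE k * thE a.
  elim/homog_ind: a => [x z Hx Hz|i a ha]; first by rewrite scalerDr !thED Hx Hz mulrDr.
  elim/homog_ind: k => [x z Hx Hz|l k hk]; first by rewrite scalerDl thED lkED Hx Hz mulrDl.
  exact: thE_Z hk ha.
split; first by split; [exact: lkED|exact: lkEM|exact: lkE1].
  split; [exact: thED|exact: eZ|move=> k a].
  elim/homog_ind: a => [x z Hx Hz|i a ha]; first by rewrite rscaleDl !thED Hx Hz mulrDl.
  elim/homog_ind: k => [x z Hx Hz|l k hk]; first by rewrite rscaleDr thED lkED Hx Hz mulrDr.
  rewrite (rscale_homog ha hk) (sgn_additive (f := thE)); last exact: thED.
  by rewrite (thE_Z hk ha) (thE_lk hk ha).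
by move=> *; apply: thE_br.
Qed.
Definition rho : U g -> aend X := ulift lkE thE.
Lemma rhoC k : rho (uC k) = lkE k. Proof. exact: (uliftC rho_ok). Qed.
Lemma rhoG a : rho (uG a) = thE a. Proof. exact: (uliftG rho_ok). Qed.
Lemma rhoD u u' : rho (u + u') = rho u + rho u'. Proof. exact: (uliftD rho_ok). Qed.
Lemma rhoN u : rho (- u) = - rho u. Proof. exact: (uliftN rho_ok). Qed.
Lemma rhoM u u' : rho (u * u') = rho u * rho u'. Proof. exact: (uliftM rho_ok). Qed.
End Action.

(** * Symmetrization as the exponential of the generic point *)

(** The permutation puts the factor of index i last: inversions with the last position give the sign
    of moving it past the factors after it, the other inversions give the sign of t on the remaining
    factors. *)
Lemma koszul_lift n (e : 'I_n.+1 -> bool) (i : 'I_n.+1) (t : 'S_n) :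
  koszul_sign e (lift_perm ord_max i t) =
  (e i && odd (\sum_(k < n) ((i < lift i k)%N && e (lift i k)))) (+) koszul_sign (e \o lift i) t.
Proof.
have wl k : widen_ord (leqnSn n) k = lift ord_max k :> 'I_n.+1.
  by apply: val_inj; rewrite /= /bump leqNgt ltn_ord.
rewrite /koszul_sign big_ord_recr /= [X in (_ + X)%N]big1 ?addn0; last first.
  by move=> j _; rewrite ltnNge -ltnS ltn_ord.
under eq_bigr => k _ do rewrite big_ord_recr /=.
rewrite big_split /= oddD addbC; congr (_ (+) _).
  rewrite [in RHS](reindex_inj (@perm_inj _ t)) /=.
  transitivity (odd (\sum_(k < n) (e i * ((i < lift i (t k))%N && e (lift i (t k)))))).
    congr odd; apply: eq_bigr => k _; rewrite wl lift_perm_id lift_perm_lift ltn_ord /=.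
    by case: (e i); rewrite ?andbT ?andbF ?mul1n ?mul0n.
  by rewrite -big_distrr /= oddM; case: (e i).
congr odd; apply: eq_bigr => k _; apply: eq_bigr => l _.
rewrite !wl !lift_perm_lift /=; congr (nat_of_bool [&& _, _ & _]).
by rewrite !ltnNge leq_bump2.
Qed.

(** Permutations are sorted by the image i of the last index; the parametrization is injective
    between sets of equal cardinality. *)
Lemma sum_perm_lift (G : zmodType) n (F : 'S_n.+1 -> G) :
  \sum_(p : 'S_n.+1) F p = \sum_(i < n.+1) \sum_(t : 'S_n) F (lift_perm ord_max i t).
Proof.
rewrite pair_big /= (reindex (fun x : 'I_n.+1 * 'S_n => lift_perm ord_max x.1 x.2)) //=.
apply: onW_bij; apply: inj_card_bij; last by rewrite card_prod !card_Sn card_ord factS.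
move=> [i t] [i' t'] /= e; have ei : i = i'.
  by have := congr1 (fun p : 'S_n.+1 => p ord_max) e; rewrite /= !lift_perm_id.
rewrite -ei in e *; congr (_, _); apply/permP => k; apply: (@lift_inj _ i).
by rewrite -!(lift_perm_lift ord_max) e.
Qed.

Section BetaExp.
Variables (K : superComAlgType) (M : superModType K) (g : lieSuperType K).
Notation C := (SymAlg M).
Variable f : M -> g.
Hypotheses (fhom : forall i x, homog i x -> homog i (f x))
  (fy : fH false (fun w : C => f (gpt w))).
Local Notation bm := (bilin_mul g).

Definition yU : C -> U g := fun w => uG (f (gpt w)).
Lemma fH_uG i (phi : C -> g) : fH i phi -> fH i (fun w => uG (phi w) : U g).
Proof.
move=> h; split; first split.
- by move=> x z; rewrite (fHD h) uGD.
- by move=> x k; rewrite urscaleE (fHr h) urscaleE uGZr.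
- by move=> w; rewrite (parU (uG (phi w))) uparG (fH_par h) uG_sgn.
Qed.
Lemma fH_yU : fH false yU. Proof. exact: fH_uG fy. Qed.
Lemma gpt_map0 : f 0 = 0.
Proof. by have := fH0 fy; rewrite -(uC0 (abel M)) gpt_uC. Qed.
Lemma gpt_mapZr x k : f (x *:> k) = f x *:> k.
Proof.
have := fHr fy (symG x) k; rewrite gptM counit_uG scale0r add0r gpt_symG.
by rewrite counit_uC.
Qed.
Lemma vord_yU : vord 1 yU.
Proof. by move=> m w hw m1; rewrite /yU (vord_gpt hw m1) gpt_map0 -(scale0r 0) uGZl mul0r. Qed.

(** Convolution powers of the generic point in U(g). The map f will be the identity for the
    symmetrization itself and [val] for its restriction to S(q). *)
Fixpoint bpow (n : nat) : C -> U g :=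
  if n is m.+1 then conv (fun x z : U g => x * z) (bpow m) yU else fun w => uC (counit w).

Lemma fH_counit : fH false (fun w : C => uC (counit w) : U g).
Proof.
split; first split.
- by move=> x z; rewrite counitD uCD.
- by move=> x k; rewrite !urscaleE counitM counit_uC uCM.
- by move=> w; rewrite par_uC counit_par.
Qed.
Lemma fH_bpow n : fH false (bpow n).
Proof. by elim: n => [|n IH] /=; [exact: fH_counit|exact: (fH_conv bm IH fH_yU)]. Qed.
Lemma vord_bpow n : vord n (bpow n).
Proof.
elim: n => [|n IH] /=; first exact: vord0.
by rewrite -addn1; apply: (vord_conv bm (fH_bpow n) fH_yU IH vord_yU).
Qed.

Lemma parn_prod n i (a : 'I_n -> M) (e : 'I_n -> bool) : (forall k, homog (e k) (a k)) ->
  parn i (\prod_(k < n) symG (a k) : C) = sgn (i && odd (\sum_(k < n) e k)) (\prod_(k < n) symG (a k)).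
Proof.
elim: n a e => [|n IH] a e ha.
  by rewrite !big_ord0 andbF; case: i; rewrite //= par1U.
rewrite !big_ord_recl parnM (IH _ (e \o lift ord0)); last by move=> k; apply: ha.
rewrite (parn_homog _ (homog_symG (ha _))) oddD oddb andb_addr.
by case: (i && e ord0); case: (i && _); rewrite /= ?mulNr ?mulrN ?opprK.
Qed.

(** y picks out the terms of the coproduct with a single generator in the second factor; the sign is
    that of moving a_i to the end. *)
Lemma conv_y_prod n (phi : C -> U g) (a : 'I_n.+1 -> M) (e : 'I_n.+1 -> bool) :
  (forall k, homog (e k) (a k)) ->
  (forall u v, phi (u + v) = phi u + phi v) -> (forall u k, phi (u * uC k) = phi u * uC k) ->
  sweedler (fun u v => phi u * yU v) (\prod_(k < n.+1) symG (a k)) =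
  \sum_(i < n.+1) sgn (e i && odd (\sum_(k < n) ((i < lift i k)%N && e (lift i k))))
    (phi (\prod_(k < n) symG (a (lift i k))) * uG (f (a i))).
Proof.
have bphi (psi : C -> U g) : (forall u v, psi (u + v) = psi u + psi v) ->
    (forall u k, psi (u * uC k) = psi u * uC k) -> bal (fun u v => psi u * yU v).
  move=> pD pr; split=> [u u' v|u v v'|u k v].
  - by rewrite pD mulrDl.
  - by rewrite (fHD fH_yU) mulrDr.
  - by rewrite pr (fHl fH_yU) uscaleE mulrA.
have step i x w (psi : C -> U g) : homog i x -> (forall u v, psi (u + v) = psi u + psi v) ->
    (forall u k, psi (u * uC k) = psi u * uC k) ->
    sweedler (fun u v => psi u * yU v) (symG x * w) =
    sweedler (fun u v => psi (symG x * u) * yU v) w + psi (parn i w) * uG (f x).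
  move=> hx pD pr; rewrite (sw_symG _ (bphi _ pD pr) hx); congr (_ + _).
  rewrite -[RHS](sw_counitr (h := fun u => psi (parn i u) * uG (f x))); last first.
    by move=> u v; rewrite parnD pD mulrDl.
  apply: sw_eq => u v; rewrite /yU gptM counit_uG scale0r add0r gpt_symG gpt_mapZr uGZr.
  rewrite parn_uCr pr -!mulrA; congr (_ * _).
  exact/homog_uC_comm/homog_uG/fhom.
elim: n phi a e => [|n IH] phi a e ha pD pr.
  have y1 : yU 1 = 0 := vord_yU (flt_C M 1) (ltnSn 0).
  rewrite big_ord_recl big_ord0 (step _ _ _ _ (ha ord0)) // -[X in sweedler _ X]uC1.
  rewrite sw_uC; last by apply: bphi => *; rewrite ?mulrDr ?mulrA.
  rewrite y1 mulr0 add0r big_ord1 !big_ord0 andbF /=; congr (phi _ * _).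
  by case: (e ord0); rewrite //= par1U.
rewrite big_ord_recl (step _ _ _ _ (ha ord0)) // (parn_prod _ (fun k => ha (lift ord0 k))).
rewrite (sgn_additive _ _ pD) [RHS]big_ord_recl addrC; congr (_ + _).
  rewrite (sgn_additive (f := fun z => z * _)); last by move=> *; rewrite mulrDl.
  by congr (sgn (_ && odd _) _); apply: eq_bigr => k _; rewrite /= add1n.
rewrite (IH (fun u => phi (symG (a ord0) * u)) _ (e \o lift ord0)); first last.
- by move=> *; rewrite mulrA pr.
- by move=> *; rewrite mulrDr pD.
- by move=> k; apply: ha.
have l0 (i : 'I_n.+1) : lift (lift ord0 i) ord0 = ord0 :> 'I_n.+2.
  by apply: val_inj; rewrite /= /bump.
have lS (i : 'I_n.+1) (k : 'I_n) : lift (lift ord0 i) (lift ord0 k) = lift ord0 (lift i k) :> 'I_n.+2.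
  by apply: val_inj; rewrite /= bumpS.
apply: eq_bigr => i _ /=.
rewrite !(big_ord_recl n) !l0 /= add0n.
congr (sgn (_ && odd _) (phi (_ * _) * _)).
  by apply: eq_bigr => k _; rewrite lS /= !bumpS.
by apply: eq_bigr => k _; rewrite lS.
Qed.

Lemma bpow_prod_neq n m (a : 'I_m -> M) (e : 'I_m -> bool) :
  (forall k, homog (e k) (a k)) -> n != m -> bpow n (\prod_(k < m) symG (a k)) = 0.
Proof.
elim: n m a e => [|n IH] [|m] a e ha // nm.
- by rewrite big_ord_recl /= counitM counit_uG mul0r.
- by rewrite big_ord0 -uC1 (@vord_bpow n.+1 0 (uC 1)) //; apply: flt_C.
rewrite [bpow _ _](convE bm (fH_bpow n) fH_yU).
have hb := fH_bpow n.
rewrite (conv_y_prod ha (fHD hb)); last by move=> u k; rewrite (fHr hb) urscaleE.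
by rewrite big1 // => i _; rewrite (IH _ _ _ (fun k => ha (lift i k))) // mul0r sgn0.
Qed.
(** The rightmost factor y chooses the image of the last index, as in [sum_perm_lift], and the
    remaining power arranges the other factors. *)
Lemma bpow_prod n (a : 'I_n -> M) (e : 'I_n -> bool) : (forall k, homog (e k) (a k)) ->
  bpow n (\prod_(k < n) symG (a k)) =
  \sum_(p : 'S_n) sgn (koszul_sign e p) (\prod_(k < n) uG (f (a (p k)))).
Proof.
elim: n a e => [|n IH] a e ha.
  rewrite big_ord0 /= counit1 uC1 (big_pred1 (perm_one _)) => [|p]; last first.
    by apply/esym/eqP/permP => -[].
  by rewrite big_ord0 /koszul_sign big_ord0.
have hb := fH_bpow n.
rewrite [bpow _ _](convE bm hb fH_yU).
rewrite (conv_y_prod ha (fHD hb)); last by move=> u k; rewrite (fHr hb) urscaleE.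
rewrite sum_perm_lift; apply: eq_bigr => i _.
rewrite (IH _ _ (fun k => ha (lift i k))) mulr_suml sgn_sum; apply: eq_bigr => t _.
rewrite koszul_lift big_ord_recr /= lift_perm_id -sgnsgn.
congr (sgn _ _); rewrite (sgn_additive (f := fun z => z * _)); last by move=> *; rewrite mulrDl.
congr (sgn _ (_ * _)); apply: eq_bigr => k _; congr (uG (f (a _))).
rewrite -(lift_perm_lift ord_max i t k); congr (lift_perm _ _ _ _).
by apply: val_inj; rewrite /= /bump leqNgt ltn_ord.
Qed.

Definition bter n : C -> U g := fun w => (qinj (n`!%:R^-1) : K) *: bpow n w.
Definition bexp : C -> U g := fun w => \sum_(n \in [set: nat]) bter n w.
Lemma fH_bter n : fH false (bter n).
Proof. exact: fH_scale (fH_bpow n). Qed.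
Lemma osum_bexp : osum bter bexp.
Proof.
apply: osum_fsbig => n m w hw mn.
by rewrite /bter (vord_bpow hw mn) scaler0.
Qed.
Lemma fH_bexp : fH false bexp.
Proof. exact: osum_fH fH_bter osum_bexp. Qed.

Lemma flt_prod n (a : 'I_n -> M) : flt n (\prod_(k < n) symG (a k)).
Proof.
elim: n a => [|n IH] a; first by rewrite big_ord0 -uC1; apply: flt_C.
by rewrite big_ord_recl; apply: flt_symG.
Qed.
Lemma bexp_prod n (a : 'I_n -> M) (e : 'I_n -> bool) : (forall k, homog (e k) (a k)) ->
  bexp (\prod_(k < n) symG (a k)) = (qinj (n`!%:R^-1) : K) *:
  \sum_(p : 'S_n) sgn (koszul_sign e p) (\prod_(k < n) uG (f (a (p k)))).
Proof.
move=> ha; rewrite (osum_bexp (flt_prod a) (ltnSn n)) big_ord_recr big1 /= ?add0r.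
  by rewrite /bter (bpow_prod ha).
by move=> k _; rewrite /bter (bpow_prod_neq ha) ?scaler0 // ltn_eqF.
Qed.
End BetaExp.

Lemma sym_span (K : superComAlgType) (M : superModType K) (P : SymAlg M -> Prop) :
  (forall v w, P v -> P w -> P (v + w)) -> (forall w k, P w -> P (w * uC k)) ->
  (forall n (a : 'I_n -> M) (e : 'I_n -> bool), (forall k, homog (e k) (a k)) ->
     P (\prod_(k < n) symG (a k))) -> forall w, P w.
Proof.
move=> PD PZ Pp w.
(* Generators are peeled off w from the left and collected at the end of a growing product. *)
suff H : forall m (b : 'I_m -> M) (d : 'I_m -> bool), (forall k, homog (d k) (b k)) ->
    P ((\prod_(k < m) symG (b k)) * w).
  by have := H 0%N (fun=> 0) (fun=> false) (fun k => homog0 _ _); rewrite big_ord0 mul1r.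
elim/sym_ind: w => [k|v w Hv Hw|i x w hx IH] m b d hb.
- by apply: PZ; apply: Pp hb.
- by rewrite mulrDr; apply: PD; [apply: Hv hb|apply: Hw hb].
have h' : forall k, homog ((fun k : 'I_m.+1 => if unlift ord_max k is Some k' then d k' else i) k)
   ((fun k : 'I_m.+1 => if unlift ord_max k is Some k' then b k' else x) k).
  by move=> k /=; case: (unlift _ _).
have := IH _ _ _ h'; rewrite big_ord_recr /= unlift_none mulrA; congr (P (_ * _ * _)).
apply: eq_bigr => k _; have -> : widen_ord (leqnSn m) k = lift ord_max k.
  by apply: val_inj; rewrite /= /bump leqNgt ltn_ord.
by rewrite liftK.
Qed.

Section Symm.
Variables (K : superComAlgType) (g : lieSuperType K).
Let fy : fH false (fun w : SymAlg g => (gpt w : g)) := @fH_gpt K g.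

(** This existence statement gives [symmetrization], a choice with default value 0, its defining
    property. *)
Lemma is_symmetrization_bexp : is_symmetrization (@bexp K g g id).
Proof.
split; first by case: (@fH_bexp K g g id fy).
by move=> n a e ha; rewrite (@bexp_prod _ _ _ id _ fy n a e ha).
Qed.
Lemma symmetrizationE : is_symmetrization (@symmetrization K g).
Proof. exact: (xgetI (fun=> 0) is_symmetrization_bexp). Qed.
End Symm.

Section BetaQ.
Variables (K : superComAlgType) (g : lieSuperType K) (s : involution g).
Notation q := (eig s true).
Lemma umap_ok (l l' : lieSuperType K) (f : l -> l') :
  (forall a b, f (a + b) = f a + f b) -> (forall (k : K) a, f (k *: a) = k *: f a) ->
  (forall a (k : K), f (a *:> k) = f a *:> k) -> (forall i a, homog i a -> homog i (f a)) ->
  (forall a b, f (lbr a b) = lbr (f a) (f b)) ->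
  ulift_ok (fun k => uC k : U l') (fun a => uG (f a) : U l').
Proof.
move=> fD fZ fr fh fb; split; first by split; [exact: uCD|exact: uCM|].
  by split=> *; rewrite ?fD ?fZ ?fr ?uGD ?uGZl ?uGZr.
by move=> i j a b ha hb; rewrite fb (uG_lbr (fh _ _ ha) (fh _ _ hb)).
Qed.
Lemma umapq_ok : ulift_ok (fun k => uC k : U (abel g)) (fun a : abel q => uG (val a : abel g)).
Proof.
apply: (@umap_ok (abel q) (abel g) (val : abel q -> abel g)) => //.
  by move=> a k; exact: (@val_rscale K g s true a k).
by move=> i a ha; apply: (proj1 (@val_homog K g s true i a) ha).
Qed.
(** Both sides are right linear, so products of homogeneous elements of q suffice, and there
    [bexp_prod] is the symmetrization formula. *)
Lemma betaqE : betaq (s:=s) = @bexp K q g val.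
Proof.
have fy := @fH_y K g s.
have fhom i (x : q) : homog i x -> homog i (val x : g) by move=> /val_homog.
have hb := fH_bexp fy; have [[sD sr] sp] := @symmetrizationE K g.
pose um : U (abel q) -> U (abel g) := umap (val : abel q -> abel g).
have uD v w : um (v + w) = um v + um w := uliftD umapq_ok v w.
have uM v w : um (v * w) = um v * um w := uliftM umapq_ok v w.
have uk k : um (uC k) = uC k := uliftC umapq_ok k.
have uS x : um (symG x) = symG (val x : g) := uliftG umapq_ok x.
have bE w : betaq w = symmetrization (um w) by [].
apply: funext; elim/sym_span => [v w Hv Hw|w k H|n a e ha].
- by rewrite bE uD sD -!bE Hv Hw (fHD hb).
- by rewrite bE uM uk -urscaleE sr -bE H (fHr hb).
rewrite (@bexp_prod K q g val fhom fy n a e ha) bE.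
rewrite -(sp n (fun k => val (a k)) e) => [|k]; last exact: (proj1 (@val_homog K g s true _ _) (ha k)).
congr (symmetrization _); elim: n a e ha => [|n IH] a e ha.
  by rewrite !big_ord0 -uC1 uk.
by rewrite !big_ord_recl uM uS (IH _ _ (fun k => ha (lift ord0 k))).
Qed.
End BetaQ.

(** * Left multiplication and symmetrization *)

Section Intertwine.
Variables (K : superComAlgType) (g : lieSuperType K) (s : involution g).
Notation h := (eig s false).
Notation q := (eig s true).
Notation C := (SymAlg q).
Local Notation bm := (bilin_mul g).
Local Notation y := (@gpt_q K g s : C -> g).
Local Notation "phi ** psi" := (conv (fun x z : U g => x * z) phi psi : C -> U g) (at level 40).
Definition uGf (phi : C -> g) : C -> U g := fun w => uG (phi w).
Local Notation b := (@bter K q g val).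
Local Notation beta := (@bexp K q g val).
Let yu : C -> U g := uGf y.

Let fy := @fH_y K g s.
Let oy := @vord_y K g s.
Let hyu : fH false yu := fH_uG fy.
Let hb n : fH false (b n) := fH_bter fy n.
Let hbeta : fH false beta := fH_bexp fy.

Lemma uG0 : uG (0 : g) = 0. Proof. exact: (morph0 (@uGD K g)). Qed.
Lemma uGf_opp phi : uGf (- phi) = - uGf phi.
Proof. by apply: funext => w; apply: (morphN _ (@uGD K g)). Qed.
Lemma uGf_add phi psi : uGf (phi + psi) = uGf phi + uGf psi.
Proof. by apply: funext => w; apply: uGD. Qed.
Lemma uGf_muln phi n : uGf (phi *+ n) = uGf phi *+ n.
Proof.
elim: n => [|n IH]; first by apply: funext => w; apply: uG0.
by rewrite !mulrS uGf_add IH.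
Qed.

(** By cocommutativity, the bracket with the even element y becomes a commutator for convolution in
    U(g). *)
Lemma uG_Flbr i phi : fH i phi -> uGf (Flbr y phi) = yu ** uGf phi - uGf phi ** yu.
Proof.
move=> hp; have hup := fH_uG hp; apply: funext => w; rewrite fctDE fctNE.
rewrite (convE bm hyu hup) (convE bm hup hyu) /uGf [Flbr _ _ _](convE (bilin_lbr g) fy hp).
rewrite (sw_morph (h := @uG K g)); last exact: uGD.
have b1 := bal_conv bm hyu hup; have b2 := bal_conv bm hup hyu.
rewrite (cocomm _ b2) -sw_oppf -sw_addf; apply: sw_homogb.
- by apply: (bal_morph (h := @uG K g)); [exact: (bal_conv (bilin_lbr g) fy hp)|exact: uGD].
- apply: bal_add => //; apply: (bal_morph (h := fun z => - z)); first exact: bal_flip b2.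
  by move=> *; rewrite opprD.
move=> l m u v hu hv; rewrite (flip_homog b2 hu hv) /= (parn_homog _ hu) (fH_sgn fy).
rewrite lbr_sgnl uG_sgn (uG_lbr (fH_homog fy hu) (fH_homog hp hv)) sgnD sgnN sgnsgn.
rewrite /yu /uGf (fH_sgn fy) uG_sgn.
congr (_ - _); first by rewrite (sgn_additive (f := fun z => z * _)) // => *; rewrite mulrDl.
by congr sgn; case: (i) (l) (m) => [] [] [].
Qed.

(** The coefficients of d/dt e^{ty} = e^{ty} y. *)
Lemma bter_rec n : b n.+1 *+ n.+1 = b n ** yu.
Proof.
apply: funext => w; rewrite natmulfctE /bter qinj_muln.
have -> : n.+1`!%:R^-1 * n.+1%:R = n`!%:R^-1 :> rat.
  by rewrite factS natrM invfM mulrAC mulVf ?mul1r // Num.Theory.pnatr_eq0.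
rewrite [RHS](convE bm (hb n) hyu) [bpow _ _ _](convE bm (fH_bpow fy n) hyu).
rewrite (sw_morph (h := fun z => (qinj _ : K) *: z)); last by move=> *; rewrite scalerDr.
by apply: sw_eq => u v; rewrite /bter !uscaleE mulrA.
Qed.

Lemma conv_mulnl (phi psi : C -> U g) n : (phi *+ n) ** psi = (phi ** psi) *+ n.
Proof.
elim: n => [|n IH]; last by rewrite !mulrS (conv_addl bm) IH.
exact: (morph0 (f := fun x => x ** psi) (fun u v => conv_addl bm u v psi)).
Qed.
Lemma conv_mulnr (phi psi : C -> U g) n : phi ** (psi *+ n) = (phi ** psi) *+ n.
Proof.
elim: n => [|n IH]; last by rewrite !mulrS (conv_addr bm) IH.
exact: (morph0 (f := fun x => phi ** x) (conv_addr bm phi)).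
Qed.
Lemma conv_opr (phi psi : C -> U g) : phi ** (- psi) = - (phi ** psi).
Proof. exact: (morphN (f := fun x => phi ** x) _ (conv_addr bm phi)). Qed.

(* e^y e^{-ad y}(v) obeys the right differential equation of e^y. *)
Lemma cau_beta i c (v : nat -> C -> g) : (forall n, fH i (v n)) -> adrec (@Flbr K q g) y c v ->
  forall N, cau (fun k l => b k ** uGf (v l)) N.+1 *+ (N.+1 + c) =
   (b N.+1 ** uGf (v 0%N)) *+ c + cau (fun k l => b k ** uGf (v l)) N ** yu.
Proof.
move=> hv rv N; have huv n := fH_uG (hv n).
have -> : (N.+1 + c = N.+1 + 0 + c)%N by rewrite addn0.
rewrite (cau_rec (R := fun x => x ** yu)) ?mulr0n ?add0r //.
  by move=> u z; rewrite (conv_addl bm).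
move=> k l; rewrite addn0 -conv_mulnl bter_rec -conv_mulnr -uGf_muln rv uGf_opp.
rewrite (uG_Flbr (hv l)) opprB (conv_addr bm) conv_opr.
rewrite (conv_assoc bm bm bm bm (fun x y z => esym (mulrA x y z)) (hb k) hyu (huv l)).
rewrite addrC subrK.
by rewrite -(conv_assoc bm bm bm bm (fun x y z => esym (mulrA x y z)) (hb k) (huv l) hyu).
Qed.

Lemma osum_uG u phi : osum u phi -> osum (fun n => uGf (u n)) (uGf phi).
Proof.
move=> ho n m w hw mn; rewrite /uGf (ho n m w hw mn) (morph_sum _ _ (@uGD K g)) //.
Qed.

Lemma bter0 w : b 0 w = uC (counit w).
Proof. by rewrite /bter /= invr1 qinj1 scale1r. Qed.
Lemma conv_bter0 i phi : fH i phi -> b 0 ** phi = phi.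
Proof.
move=> hp; apply: funext => w; rewrite (convE bm (hb 0) hp) -[RHS](sw_counitl (h := phi)).
  apply: sw_eq => u v; rewrite bter0 (fHl hp) uscaleE; congr (uC _ * _).
  by rewrite counit_parn.
exact: (fHD hp).
Qed.

(** This is a e^y = e^y e^{-ad y}(a): with t inserted, both sides solve x' = x y with value a at t =
    0. *)
Lemma beta_const i a : homog i a ->
  (fun w => uG a * beta w) = beta ** uGf (Eexp (s:=s) a).
Proof.
move=> ha; have hc := @fH_const K q g i a ha.
have hv n := fH_ter fy (ecoef 0) n hc.
have huv n := fH_uG (hv n).
apply: (osum_eq (u := cau (fun k l => b k ** uGf (ter y (ecoef 0) (Fconst a) l)))); last first.
  apply: (osum_conv bm hb huv (osum_bexp fy)); apply: osum_uG.
  exact: (osum_ser fy oy _ hc).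
have e : (fun N w => uG a * b N w) = cau (fun k l => b k ** uGf (ter y (ecoef 0) (Fconst a) l)).
  apply: funext; apply: (rec_unique (R := fun x => x ** yu) (c := id) (b := fun=> 0)).
  - exact: fct_torsion.
  - rewrite cau0 (conv_bter0 (huv 0)) (ter0 _ hc (ecoef0 _)) //.
    apply: funext => w; rewrite bter0 /uGf /Fconst uGZr //.
  - move=> N; apply: funext => w; rewrite natmulfctE add0r -mulrnAr.
    have := congr1 (fun f : C -> U g => f w) (bter_rec N); rewrite natmulfctE => ->.
    have hab : fH i (fun w => uG a * b N w : U g).
      split; first split.
      + by move=> u v; rewrite (fHD (hb N)) mulrDr.
      + by move=> u k; rewrite urscaleE (fHr (hb N)) !urscaleE mulrA.
      + move=> u; rewrite parMU (fH_par (hb N)) parU uparG (par_homog ha) uG_sgn.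
        by rewrite (sgn_additive (f := fun z => z * _)) // => *; rewrite mulrDl.
    rewrite (convE bm (hb N) hyu) (convE bm hab hyu) (sw_morph (h := fun z => uG a * z)).
      by apply: sw_eq => u v; rewrite mulrA.
    by move=> *; rewrite mulrDr.
  - by move=> N; have := cau_beta hv (adrec_ter fy 0 hc) N; rewrite addn0 mulr0n.
rewrite -e => n m w hw mn; rewrite (osum_bexp fy hw mn) mulr_sumr //.
Qed.

Lemma beta_cod i alpha : fH i alpha ->
  (fun w => beta (cod alpha w)) = beta ** uGf (Aexp (vf alpha)).
Proof.
move=> ha; have hva := fH_val ha.
have hv n := fH_ter fy (ecoef 1) n hva.
have huv n := fH_uG (hv n).
apply: (osum_eq (u := cau (fun k l => b k ** uGf (ter y (ecoef 1) (vf alpha) l)))); last first.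
  apply: (osum_conv bm hb huv (osum_bexp fy)); apply: osum_uG.
  exact: (osum_ser fy oy _ hva).
have yc : (fun w => yu (cod alpha w)) = uGf (vf alpha).
  by apply: funext => w; rewrite /yu /uGf /gpt_q (gpt_cod ha).
have Dc N : (fun w => (b N ** yu) (cod alpha w)) =
    b N ** uGf (vf alpha) + (fun w => b N (cod alpha w)) ** yu.
  apply: funext => w; rewrite (conv_cod bm (hb N) hyu ha) andbF fctDE addrC.
  by rewrite /sgn yc.
have e : (fun N w => b N.+1 (cod alpha w)) =
    cau (fun k l => b k ** uGf (ter y (ecoef 1) (vf alpha) l)).
  (* The shift is possible because D b_0 = 0; D(b_{N+1} y) = b_{N+1} alpha + D(b_{N+1}) y gives the
     recursion with multiplier N + 2. *)
  apply: funext; apply: (rec_unique (R := fun x => x ** yu) (c := succn)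
     (b := fun N => b N.+1 ** uGf (vf alpha))).
  - exact: fct_torsion.
  - rewrite cau0 (conv_bter0 (huv 0)) (ter0 _ hva (ecoef0 _)) //.
    rewrite -[b 1]mulr1n bter_rec Dc (conv_bter0 (fH_uG hva)).
    have -> : (fun w => b 0 (cod alpha w)) = 0.
      by apply: funext => w; rewrite bter0 counit_cod.
    by rewrite [X in _ + X](morph0 (f := fun x => x ** yu)) ?addr0 // => u v; rewrite (conv_addl bm).
  - move=> N; rewrite -Dc -bter_rec; apply: funext => w; by rewrite !natmulfctE.
  - move=> N; have := cau_beta hv (adrec_ter fy 1 hva) N.
    by rewrite addn1 mulr1n (ter0 _ hva (ecoef0 _)).
rewrite -e => n m w hw mn.
rewrite (osum_bexp fy (flt_cod ha hw) (n := n.+1)) // big_ord_recl bter0 counit_cod uC0 add0r //.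
Qed.

Lemma beta_intertw i a w : homog i a ->
  uG a * beta w = beta (cod (alpha1 (s:=s) a) w) +
    sweedler (fun u z => beta (parn i u) * uG (val (theta1 (s:=s) a z))) w.
Proof.
move=> ha; have hal := fH_alpha1 s ha; have hth := fH_theta1 s ha.
have := congr1 (fun f : C -> U g => f w) (beta_const ha); rewrite /= => ->.
rewrite (key_alpha1 s ha) uGf_add (conv_addr bm) fctDE.
rewrite -(congr1 (fun f : C -> U g => f w) (beta_cod hal)); congr (_ + _).
by rewrite (convE bm hbeta (fH_uG (fH_val hth))).
Qed.
End Intertwine.

(** * Injectivity and the first assertion *)

Section Low.
Variables (K : superComAlgType) (g : lieSuperType K) (s : involution g).
Notation h := (eig s false).
Notation q := (eig s true).
Notation C := (SymAlg q).
Local Notation y := (@gpt_q K g s : C -> g).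

Lemma p1_series0 : p1_series 0 = 1.
Proof. by rewrite /p1_series fdivE big_ord0 subr0 divr1. Qed.

Lemma ser_low (f : nat -> rat) i phi w : fH i phi -> flt 0 w -> ser y f phi w = (qinj (f 0%N) : K) *: phi w.
Proof.
move=> hp hw; rewrite (osum_ser (@fH_y K g s) (@vord_y K g s) f hp hw (n := 1)) //.
by rewrite big_ord1.
Qed.
Lemma alpha1_low i a w : homog i a -> flt 0 w -> alpha1 (s:=s) a w = Fconst (pq s a) w.
Proof.
move=> ha hw; apply: val_inj.
rewrite -[LHS]/(vf (alpha1 (s:=s) a) w) (vf_alpha1 s ha) fctDE.
rewrite (ser_low _ (fH_const q (homog_ph s ha)) hw) (ser_low _ (fH_const q (homog_pq s ha)) hw).
by rewrite p1_series0 /f1_series /= qinj0 scale0r add0r qinj1 scale1r /Fconst val_rscale.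
Qed.
Lemma theta1_low i a w : homog i a -> flt 0 w -> theta1 (s:=s) a w = Fconst (ph s a) w.
Proof.
move=> ha hw; apply: val_inj.
rewrite -[LHS]/(vf (theta1 (s:=s) a) w) (vf_theta1 s ha) fctDE.
rewrite (ser_low _ (fH_const q (homog_ph s ha)) hw) (ser_low _ (fH_const q (homog_pq s ha)) hw).
by rewrite q1_series_even // /delta0 /= qinj0 scale0r addr0 qinj1 scale1r /Fconst val_rscale.
Qed.
Lemma flt1 : flt 0 (1 : C). Proof. by rewrite -uC1; apply: flt_C. Qed.
Lemma alpha1_1 a : alpha1 (s:=s) a 1 = pq s a.
Proof.
rewrite -(hcE a) alpha1D fctDE pqD !(alpha1_low (homog_hc _ _) flt1).
by rewrite /Fconst counit1 !rscale1.
Qed.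
Lemma theta1_1 a : theta1 (s:=s) a 1 = ph s a.
Proof.
rewrite -(hcE a) theta1D fctDE phD !(theta1_low (homog_hc _ _) flt1).
by rewrite /Fconst counit1 !rscale1.
Qed.
Lemma pq_q (x : q) : pq s (val x) = x.
Proof. by apply: val_inj; apply: eig_projK; apply: eig_valP. Qed.
Lemma ph_h (x : h) : ph s (val x) = x.
Proof. by apply: val_inj; apply: eig_projK; apply: eig_valP. Qed.
Lemma pq_h (x : h) : pq s (val x) = 0.
Proof.
by apply: val_inj; apply: (@addrI _ (val x)); rewrite -{1}(ph_h x) php_val addr0.
Qed.
End Low.

Section RhoBeta.
Variables (K : superComAlgType) (g : lieSuperType K) (s : involution g).
Notation h := (eig s false).
Notation q := (eig s true).
Notation C := (SymAlg q).
Variables (V : superModType K) (chi : lie_rep h V).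
Local Notation X := (C *t V : zmodType).
Local Notation bc := (bilin_act chi).
Local Notation rho := (rho chi).
Local Notation beta := (betaq (s:=s)).

Lemma fH_betaq : fH false beta.
Proof. by rewrite betaqE; apply: fH_bexp; apply: fH_y. Qed.
Lemma betaq1 : beta 1 = 1.
Proof.
rewrite betaqE (osum_bexp (@fH_y K g s) (@flt1 K g s) (ltnSn 0)) big_ord1.
by rewrite bter0 counit1.
Qed.
Lemma betaq_intertw i a w : homog i a ->
  uG a * beta w = beta (cod (alpha1 (s:=s) a) w) +
    sweedler (fun u z => beta (parn i u) * uG (val (theta1 (s:=s) a z))) w.
Proof. by rewrite betaqE; apply: beta_intertw. Qed.

Lemma cod1 (alpha : C -> q) i : fH i alpha -> cod alpha 1 = symG (alpha 1).
Proof. by move=> ha; rewrite /cod -uC1 (sw_uC (bal_cod ha)) uC1 mulr1. Qed.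

(** For an element of h, [alpha1] vanishes at 1 and [theta1] takes its constant value there. This
    makes the action on 1 (x) v compatible with the relations of the tensor product over h. *)
Lemma thE_h (b : h) (v : V) : thE chi (val b) (pureK (1 : C) v) = pureK (1 : C) (chi b v) :> X.
Proof.
suff H i (c : h) : homog i c -> thE chi (val c) (pureK (1 : C) v) = pureK (1 : C) (chi c v) :> X.
  by rewrite -(hcE b) valD thED aendDE !(H _ _ (homog_hc _ _)) actDl pureDr.
move=> /val_homog hc; have hal := fH_alpha1 s hc; have hth := fH_theta1 s hc.
rewrite [thE _ _ _]Theta1_pure /thF /thP (cod1 hal) alpha1_1 pq_h symG0 pure0l add0r.
rewrite (thTE _ _ _ hth) -uC1 (sw_uC (bal_thT _ _ hth)) uC1 theta1_1 ph_h.
by congr pureK; case: (i); rewrite //= par1U.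
Qed.

(* By induction on the degree of w: the left side intertwines Theta1 with itself,
   and for x in q, Theta1 x (w (x) v) = x w (x) v modulo lower degree. *)
Lemma rho_betaq w (v : V) : rho (beta w) (pureK (1 : C) v) = pureK w v :> X.
Proof.
have hb := fH_betaq.
have GD w1 w2 v' : rho (beta (w1 + w2)) (pureK (1 : C) v') =
    rho (beta w1) (pureK (1 : C) v') + rho (beta w2) (pureK (1 : C) v') :> X.
  by rewrite (fHD hb) rhoD.
suff H n m w' : flt m w' -> (m <= n)%N -> forall v', rho (beta w') (pureK (1 : C) v') = pureK w' v' :> X.
  by have [m hw] := flt_ex w; apply: (H m m).
elim: n m w' => [|n IH] m w'; elim=> {m w'} //.
- move=> k _ v'; rewrite -[uC k]mul1r (fHr hb) betaq1 urscaleE !mul1r rhoC lkE_pure mulr1 //.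
- by move=> m w1 w2 _ H1 _ H2 mn v'; rewrite GD H1 // H2 // pureDl.
- move=> k _ v'; rewrite -[uC k]mul1r (fHr hb) betaq1 urscaleE !mul1r rhoC lkE_pure mulr1 //.
- move=> m i x w' hx hw' _ mn v'.
  have hvx : homog i (val x) by apply: (proj1 (val_homog i x)).
  have hal := fH_alpha1 s hvx; have hth := fH_theta1 s hvx.
  set al := alpha1 (val x) in hal; set th := theta1 (val x) in hth.
  (* The series t coth t starts with 1, so [be] vanishes in degree 0 and its coderivation does not
     raise the degree. *)
  pose be : C -> q := al - Fconst x.
  have hbe : fH i be by apply: fH_sub => //; apply: fH_const.
  have obe : vord 1 be.
    move=> l u hu; rewrite ltnS leqn0 => /eqP l0; rewrite l0 in hu.
    by rewrite /be fctDE fctNE /al (alpha1_low hvx hu) pq_q subrr.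
  have cE : cod al w' = symG x * w' + cod be w'.
    have -> : al = Fconst x + be by rewrite addrC subrK.
    rewrite codD; congr (_ + _).
    rewrite -[RHS](sw_counitl (h := fun z => symG x * z)); last by move=> *; rewrite mulrDr.
    by apply: sw_eq => u z; rewrite /Fconst [symG _]uGZr mulrA.
  have cbe : flt m (cod be w').
    apply: (sw_flt (P := flt m) (bal_cod hbe)) hw' => [u z|l j u z lj hu hz]; first exact: flt_D.
    case: l lj hu => [|l] lj hu; first by rewrite (obe 0%N) // symG0 mul0r; apply: flt0.
    apply: (@flt_le _ _ j.+1); last exact: flt_symG.
    by apply: leq_trans lj; rewrite addSn ltnS leq_addl.
  have e := betaq_intertw w' hvx.
  have := congr1 (fun u => rho u (pureK (1 : C) v') : X) e; rewrite rhoM rhoG aendME.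
  rewrite (IH m w') // [thE _ _ _]Theta1_pure /thF rhoD aendDE /thP -/al -/th.
  rewrite (thTE _ _ _ hth).
  (* Here the induction hypothesis applies to u, whose degree is at most that of w'. *)
  have -> : rho (sweedler (fun u z => beta (parn i u) * uG (val (th z))) w') (pureK (1 : C) v') =
      sweedler (fun u z => pureK (parn i u) (chi (th z) v')) w' :> X.
    pose ev (u : U g) : X := rho u (pureK (1 : C) v').
    have evD u z : ev (u + z) = ev u + ev z by rewrite /ev rhoD.
    rewrite -[LHS]/(ev _) (sw_morph (h := ev)) //.
    have b1 := bal_morph (bal_conv (bilin_mul g) hb (fH_uG (fH_val hth))) evD.
    have b2 := bal_thT chi v' hth.
    apply/eqP; rewrite -subr_eq0 -sw_oppf -sw_addf; apply/eqP.
    have bd := bal_add b1 (bal_morph b2 (fun x z => opprD x z)).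
    apply: (sw_flt (P := fun z => z = 0) bd) hw' => [u z -> ->|l j u z lj hu _]; first by rewrite addr0.
    rewrite /ev rhoM rhoG aendME /vf thE_h (IH l) ?subrr //; first exact: flt_parn.
    by apply: leq_trans (leq_trans (leq_addr j l) lj) _; rewrite -ltnS.
  (* The theta parts cancel first, then the terms with [cod be w'], which leaves the claim for
     [symG x * w']. *)
  move/addIr; rewrite cE GD pureDl (IH m (cod be w')) //.
  by move/addIr.
- by move=> m w1 w2 _ H1 _ H2 mn v'; rewrite GD H1 // H2 // pureDl.
- by move=> m w' _ H mn v'; apply: H; apply: ltnW.
Qed.

Lemma betabar_chi_ok : tlift_ok (@Krel K C V) (fun w v => pure (indrel chi) (beta w) v).
Proof.
have hb := fH_betaq; split=> [m m' n|m n n'|m n m' n' [k /= [-> ->]]].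
- by rewrite (fHD hb) pureDl.
- by rewrite pureDr.
by rewrite urscaleE (fHr hb); apply: pure_rel; left; exists k.
Qed.
Lemma indmod_ok (f : U g -> V -> X) :
  (forall u u' v, f (u + u') v = f u v + f u' v) -> (forall u v v', f u (v + v') = f u v + f u v') ->
  (forall u k v, f (u * uC k) v = f u (k *: v)) ->
  (forall u (b : h) v, f (u * uG (val b)) v = f u (chi b v)) -> tlift_ok (indrel chi) f.
Proof.
move=> fl fr fk fb; split=> // m n m' n' [[k /= [-> ->]]|[b /= [-> ->]]].
  by rewrite urscaleE fk.
exact: fb.
Qed.
Lemma psi_ok : tlift_ok (indrel chi) (fun u v => rho u (pureK (1 : C) v) : X).
Proof.
apply: indmod_ok => [u u' v|u v v'|u k v|u b v].
- by rewrite rhoD.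
- by rewrite pureDr afunD.
- by rewrite rhoM aendME rhoC lkE_pure mulr1 -[uC k]mul1r pureZk.
- by rewrite rhoM aendME rhoG thE_h.
Qed.
Definition psi : indmod chi -> X := tlift (fun u v => rho u (pureK (1 : C) v)).
Lemma psiK x : psi (betabar_chi chi x) = x.
Proof.
elim/tensor_ind: x => [|w v|x z Hx Hz].
- by rewrite /betabar_chi (tlift0 betabar_chi_ok) /psi (tlift0 psi_ok).
- by rewrite /betabar_chi (tlift_pure betabar_chi_ok) /psi (tlift_pure psi_ok) rho_betaq.
by rewrite -{2}Hx -{2}Hz /betabar_chi (tliftD betabar_chi_ok) /psi (tliftD psi_ok).
Qed.

Lemma lind_ok a : tlift_ok (indrel chi) (fun u v => pure (indrel chi) (uG a * u) v).
Proof.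
split=> [m m' n|m n n'|m n m' n' r].
- by rewrite mulrDr pureDl.
- by rewrite pureDr.
apply: pure_rel; case: r => [[k /= [-> ->]]|[b /= [-> ->]]].
  by left; exists k; rewrite /= !urscaleE mulrA.
by right; exists b; rewrite /= mulrA.
Qed.

(** This is [betaq_intertw], with the factor in h carried across the tensor product over h, where it
    acts through chi. *)
Lemma betabar_chi_Theta1 a x : betabar_chi chi (Theta1 chi a x) = lind (chi:=chi) a (betabar_chi chi x).
Proof.
have bD := tliftD betabar_chi_ok.
elim/tensor_ind: x => [|w v|x z Hx Hz]; first last.
- by rewrite Theta1D /betabar_chi !bD -/(betabar_chi chi) Hx Hz /lind (tliftD (lind_ok a)).
- suff H i c : homog i c ->
      betabar_chi chi (Theta1 chi c (pureK w v)) = lind (chi:=chi) c (betabar_chi chi (pureK w v)).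
    have LD c d u : lind (chi:=chi) (c + d) u = lind (chi:=chi) c u + lind (chi:=chi) d u.
      rewrite /lind /tlift -big_split; apply: eq_bigr => p _.
      by rewrite uGD mulrDl pureDl.
    rewrite -(hcE a) LD -!(H _ _ (homog_hc _ _)) -bD; congr (tlift _ _).
    by rewrite !Theta1_pure thFD.
  move=> hc; have hal := fH_alpha1 s hc; have hth := fH_theta1 s hc; have hb := fH_betaq.
  rewrite [betabar_chi _ (pureK w v)](tlift_pure betabar_chi_ok) /lind (tlift_pure (lind_ok c)).
  rewrite (betaq_intertw _ hc) pureDl Theta1_pure /thF /betabar_chi bD (tlift_pure betabar_chi_ok).
  congr (_ + _); rewrite (thTE _ _ _ hth) (sw_morph _ _ bD).
  rewrite (sw_morph (h := fun u => pure (indrel chi) u v)); last by move=> *; rewrite pureDl.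
  apply: sw_eq => u z; rewrite (tlift_pure betabar_chi_ok).
  by symmetry; apply: pure_rel; right; exists (theta1 c z).
have -> : Theta1 chi a 0 = 0 := afun0 (thE chi a).
by rewrite /betabar_chi (tlift0 betabar_chi_ok) /lind (tlift0 (lind_ok a)).
Qed.

(** [Theta1] gives a preimage and the left inverse [psi] shows that it is the only one, so the
    choice in [linv] returns it. *)
Lemma lbar_chiE a : lbar_chi chi a =1 Theta1 chi a.
Proof.
move=> x; apply: xget_unique; first exact: betabar_chi_Theta1.
by move=> z /= e; rewrite -(psiK z) e -betabar_chi_Theta1 psiK.
Qed.
End RhoBeta.

(** * The second assertion *)

Section LeftRep.
Variables (K : superComAlgType) (l : lieSuperType K).
Definition leftact (b : l) (u : U l) : U l := uG b * u.
Fact leftactDl a b v : leftact (a + b) v = leftact a v + leftact b v.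
Proof. by rewrite /leftact uGD mulrDl. Qed.
Fact leftactDr a u v : leftact a (u + v) = leftact a u + leftact a v.
Proof. by rewrite /leftact mulrDr. Qed.
Fact leftactZl (k : K) a v : leftact (k *: a) v = k *: leftact a v.
Proof. by rewrite /leftact uGZl uscaleE mulrA. Qed.
Fact leftactZr (k : K) a v : leftact a (v *:> k) = leftact a v *:> k.
Proof. by rewrite /leftact !urscaleE mulrA. Qed.
Fact homog_leftact i j a v : homog i a -> homog j v -> homog (i (+) j) (leftact a v).
Proof. by move=> ha hv; apply: homogMU => //; apply: homog_uG. Qed.
Fact leftact_lbr i j a b v : homog i a -> homog j b ->
  leftact (lbr a b) v = leftact a (leftact b v) - sgn (i && j) (leftact b (leftact a v)).
Proof.
move=> ha hb; rewrite /leftact (uG_lbr ha hb) mulrBl !mulrA; congr (_ - _).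
by case: (i && j); rewrite //= mulNr.
Qed.
(** With V = U(h) the space S(q) (x) U(h) becomes a case of S(q) (x) V, so that the action built for
    the first assertion serves the second. *)
Definition leftrep : lie_rep l (U l) := LieRep leftactDl leftactDr leftactZl leftactZr
  homog_leftact leftact_lbr.
End LeftRep.

Section PartII.
Variables (K : superComAlgType) (g : lieSuperType K) (s : involution g).
Notation h := (eig s false).
Notation q := (eig s true).
Notation C := (SymAlg q).
Local Notation chi := (leftrep h).
Local Notation X := (C *t U h : zmodType).
Local Notation rho := (rho (leftrep h)).
Local Notation beta := (betaq (s:=s)).
Local Notation jh := (jh (s:=s)).

Lemma jh_ok : ulift_ok (fun k => uC k : U g) (fun a : h => uG (val a) : U g).
Proof.
apply: (@umap_ok K h g val) => //; first by move=> a k; apply: val_rscale.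
by move=> i a ha; apply: (proj1 (@val_homog K g s false i a) ha).
Qed.
Lemma jhD u v : jh (u + v) = jh u + jh v :> U g. Proof. exact: (uliftD jh_ok). Qed.
Lemma jhN u : jh (- u) = - jh u :> U g. Proof. exact: (uliftN jh_ok). Qed.
Lemma jhM u v : jh (u * v) = jh u * jh v :> U g. Proof. exact: (uliftM jh_ok). Qed.
Lemma jhC k : jh (uC k : U h) = uC k :> U g. Proof. exact: (uliftC jh_ok). Qed.
Lemma jhG (b : h) : jh (uG b) = uG (val b) :> U g. Proof. exact: (uliftG jh_ok). Qed.

Lemma rho_jh (u u' : U h) : rho (jh u) (pureK (1 : C) u') = pureK (1 : C) (u * u') :> X.
Proof.
elim/U_ind: u u' => [k|b|x z Hx Hz|x Hx|x z Hx Hz] u'.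
- by rewrite jhC rhoC lkE_pure mulr1 -[uC k]mul1r pureZk.
- by rewrite jhG rhoG thE_h.
- by rewrite jhD rhoD aendDE Hx Hz mulrDl pureDr.
- by rewrite jhN rhoN aendNE Hx mulNr pureNr.
by rewrite jhM rhoM aendME Hz Hx mulrA.
Qed.

Lemma betabar_ok : tlift_ok (@Krel K C (U h)) (fun w u => beta w * jh u : U g).
Proof.
have hb := @fH_betaq K g s; split=> [m m' n|m n n'|m n m' n' [k /= [-> ->]]].
- by rewrite (fHD hb) mulrDl.
- by rewrite jhD mulrDr.
by rewrite urscaleE (fHr hb) uscaleE jhM jhC urscaleE mulrA.
Qed.
(** Acting on 1 (x) 1 undoes [betabar]: the factor from U(h) yields 1 (x) u, which the
    symmetrization of w turns into w (x) u. *)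
Lemma betabarK (x : X) : rho (betabar x) (pureK (1 : C) (1 : U h)) = x.
Proof.
elim/tensor_ind: x => [|w u|x z Hx Hz].
- by rewrite /betabar (tlift0 betabar_ok) (morph0 (f := rho)) // => *; rewrite rhoD.
- rewrite /betabar (tlift_pure betabar_ok) rhoM aendME.
  by rewrite rho_jh mulr1 rho_betaq.
by rewrite -{2}Hx -{2}Hz /betabar (tliftD betabar_ok) rhoD.
Qed.

Lemma betabar_Theta1 a (x : X) : betabar (Theta1 chi a x) = uG a * betabar x.
Proof.
have bD := tliftD betabar_ok; have b0 := tlift0 betabar_ok.
elim/tensor_ind: x => [|w u|x z Hx Hz]; first last.
- by rewrite Theta1D /betabar !bD -!/(betabar _) Hx Hz mulrDr.
- suff H i c : homog i c ->
      betabar (Theta1 chi c (pureK w u)) = uG c * betabar (pureK w u).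
    rewrite -(hcE a) uGD mulrDl -!(H _ _ (homog_hc _ _)) /betabar -bD; congr (tlift _ _).
    by rewrite !Theta1_pure thFD.
  move=> hc; have hal := fH_alpha1 s hc; have hth := fH_theta1 s hc.
  rewrite Theta1_pure /thF /betabar bD !(tlift_pure betabar_ok) mulrA (betaq_intertw _ hc) mulrDl.
  congr (_ + _); rewrite (thTE _ _ _ hth) (sw_morph _ _ bD).
  rewrite (sw_morph (h := fun z => z * jh u)); last by move=> *; rewrite mulrDl.
  apply: sw_eq => v z; rewrite (tlift_pure betabar_ok) /= /leftact jhM jhG mulrA //.
have -> : Theta1 chi a 0 = 0 := afun0 (thE chi a).
by rewrite /betabar b0 mulr0.
Qed.
Lemma lbarE a (x : X) : lbar a x = Theta1 chi a x.
Proof.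
apply: xget_unique; first exact: betabar_Theta1.
by move=> z /= e; rewrite -(betabarK z) e -betabar_Theta1 betabarK.
Qed.

Lemma right_linear_alpha1 a : right_linear (alpha1 (s:=s) a).
Proof.
have [[d0 r0] _] := fH_alpha1 s (homog_hc false a); have [[d1 r1] _] := fH_alpha1 s (homog_hc true a).
rewrite -(hcE a) alpha1D; split=> [x y|x k]; rewrite !fctDE.
  by rewrite d0 d1 addrACA.
by rewrite r0 r1 rscaleDl.
Qed.
Lemma right_linear_theta1 a : right_linear (theta1 (s:=s) a).
Proof.
have [[d0 r0] _] := fH_theta1 s (homog_hc false a); have [[d1 r1] _] := fH_theta1 s (homog_hc true a).
rewrite -(hcE a) theta1D; split=> [x y|x k]; rewrite !fctDE.
  by rewrite d0 d1 addrACA.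
by rewrite r0 r1 rscaleDl.
Qed.
End PartII.

(** * Parity components of alpha and theta, and their recovery from the operator *)

Section SymComm.
Variables (K : superComAlgType) (M : superModType K).
Notation C := (SymAlg M).

Lemma symG_parn i (x : M) (w : C) : homog i x -> symG x * w = parn i w * symG x.
Proof.
move=> hx; elim/sym_ind: w => [k|v w Hv Hw|j z w hz IH].
- by rewrite (symG_uC _ hx) parn_uC.
- by rewrite mulrDr parnD mulrDl Hv Hw.
rewrite mulrA (symG_comm hx hz) parnM (parn_homog _ (homog_symG hz)).
have e b (u v : C) : sgn b u * v = sgn b (u * v) by case: b; rewrite //= mulNr.
by rewrite !e -!mulrA IH.
Qed.
(** [left_data] writes the coderivation with alpha on the right, [cod] with alpha on the left;
    cocommutativity and commutativity of S(M) relate the two. *)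
Lemma cod_right i alpha (w : C) : fH i alpha ->
  cod alpha w = sweedler (fun a b => parn i a * symG (alpha b)) w.
Proof.
move=> ha; have b1 := bal_cod ha.
have b2 := bal_conv (bilin_mul (abel M)) (@fH_id K M) (fH_symG ha).
rewrite /cod (cocomm _ b1); apply: sw_homogb => [||l m a b hl hm]; [exact: bal_flip|exact: b2|].
rewrite (flip_homog b1 hl hm) (symG_parn _ (fH_homog ha hm)) !(parn_homog _ hl).
have e c (u v : C) : sgn c u * v = sgn c (u * v) by case: c; rewrite //= mulNr.
by rewrite !e sgnsgn; congr sgn; case: (i) (l) (m) => [] [] [].
Qed.

Lemma homc_sum (N : superModType K) (phi : C -> N) w : right_linear phi ->
  phi w = homc false phi w + homc true phi w.
Proof.
move=> [pD pr]; rewrite /homc !sum_bool /= -{1}(hcE w) pD.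
rewrite -{1}(hcE (phi (hc false w))) -{1}(hcE (phi (hc true w))).
by rewrite [hc false (phi (hc true w)) + _]addrC addrACA.
Qed.
Lemma homc_par (N : superModType K) (phi : C -> N) w : right_linear phi ->
  par (phi (par w)) = homc false phi w - homc true phi w.
Proof.
move=> [pD pr]; rewrite /homc !sum_bool /= [par w]parE pD (morphN _ pD) parD parN !parE.
by rewrite opprB addrACA -opprD.
Qed.
Lemma homc_half (N : superModType K) j (phi : C -> N) w : right_linear phi ->
  homc j phi w = half K *: (phi w + sgn j (par (phi (par w)))).
Proof.
move=> h; rewrite (homc_par w h) (homc_sum w h); case: j => /=.
  by rewrite opprB addrC addrA subrK halfD.
by rewrite addrACA subrr addr0 halfD.
Qed.
Lemma fH_homc (N : superModType K) j (phi : C -> N) : right_linear phi -> fH j (homc j phi).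
Proof.
move=> h; apply: (@fH_ext _ _ _ _ (fun w => half K *: (phi w + sgn j (par (phi (par w)))))).
  by move=> w; rewrite homc_half.
case: (h) => pD pr; split; first split.
- by move=> x z; rewrite parD !pD parD sgnD addrACA scalerDr.
- move=> x k; rewrite par_rscale !pr par_rscale parK rscaleZ rscaleDl; congr (_ *: (_ + _)).
  by case: (j); rewrite //= rscaleNl.
by move=> w; rewrite parZ par_half parD par_sgn !parK -sgnZr sgnD sgnsgn addbb addrC.
Qed.
End SymComm.

Lemma sconvDr (K : superComAlgType) (M N : superModType K) (G : zmodType)
    (B : SymAlg M -> N -> G) psi psi' w :
  (forall x y y', B x (y + y') = B x y + B x y') ->
  sconv B (psi + psi') w = sconv B psi w + sconv B psi' w.
Proof.
move=> BD; rewrite /sconv -sw_addf; apply: sw_eq => u z.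
rewrite -big_split; apply: eq_bigr => i _; rewrite -big_split; apply: eq_bigr => j _ /=.
by rewrite homcD BD sgnD.
Qed.

Section Data.
Variables (K : superComAlgType) (g : lieSuperType K) (s : involution g).
Notation h := (eig s false).
Notation q := (eig s true).
Notation C := (SymAlg q).
Local Notation chi := (leftrep h).
Local Notation X := (C *t U h : zmodType).

Lemma homc_sumf (N : superModType K) (phi : C -> N) : right_linear phi ->
  phi = homc false phi + homc true phi.
Proof. by move=> hp; apply: funext => w; rewrite fctDE -homc_sum. Qed.

Lemma sconv_thP (alpha : C -> q) w (u : U h) : right_linear alpha ->
  sconv (fun v m => pureK (v * symG m) u) alpha w = thP (V := U h) alpha w u.
Proof.
move=> ha; rewrite (homc_sumf ha) /thP sconvDr; last by move=> *; rewrite symGD mulrDr pureDl.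
rewrite codD pureDl.
suff H i al : fH i al -> sconv (fun v m => pureK (v * symG m) u) al w = pureK (cod al w) u :> X.
  by rewrite !(H _ _ (fH_homc _ ha)).
move=> hal; rewrite (sconvE (j := i)) //; first last.
- by move=> x; rewrite symG0 mulr0 pure0l.
- by move=> *; rewrite mulrDl pureDl.
by rewrite (cod_right _ hal) (sw_morph (h := fun z => pureK z u : X)) // => *; rewrite pureDl.
Qed.

Lemma gpt_cod_rl (alpha : C -> q) w : right_linear alpha -> gpt (cod alpha w) = alpha w.
Proof.
move=> ha; rewrite (homc_sumf ha) codD gptD fctDE.
by rewrite !(gpt_cod (fH_homc _ ha)).
Qed.

(** Evaluations that separate the two summands at u = 1: [obs1] returns alpha and kills the theta
    part, [obs2] kills the alpha part and returns theta inside U(h). *)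
Definition obs1 : X -> q := tlift (fun w u => gpt w *:> counit u).
Definition obs2 : X -> U h := tlift (fun w u => counit w *: u).
Lemma obs1_ok : tlift_ok (@Krel K C (U h)) (fun w u => gpt w *:> counit u).
Proof.
split=> [m m' n|m n n'|m n m' n' [k /= [-> ->]]].
- by rewrite gptD rscaleDl.
- by rewrite counitD rscaleDr.
by rewrite urscaleE (fHr (@fH_gpt K q)) uscaleE counitM counit_uC rscaleA.
Qed.
Lemma obs2_ok : tlift_ok (@Krel K C (U h)) (fun w u => counit w *: u).
Proof.
split=> [m m' n|m n n'|m n m' n' [k /= [-> ->]]].
- by rewrite counitD scalerDl.
- by rewrite scalerDr.
by rewrite urscaleE counitM counit_uC scalerA.
Qed.
Lemma obs1D x z : obs1 (x + z) = obs1 x + obs1 z. Proof. exact: (tliftD obs1_ok). Qed.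
Lemma obs2D x z : obs2 (x + z) = obs2 x + obs2 z. Proof. exact: (tliftD obs2_ok). Qed.
Lemma obs1_pure w u : obs1 (pureK w u) = gpt w *:> counit u. Proof. exact: (tlift_pure obs1_ok). Qed.
Lemma obs2_pure w u : obs2 (pureK w u) = counit w *: u. Proof. exact: (tlift_pure obs2_ok). Qed.

Lemma obs1_thP alpha w : right_linear alpha -> obs1 (thP alpha w (1 : U h)) = alpha w.
Proof. by move=> ha; rewrite /thP obs1_pure counit_uC rscale1 gpt_cod_rl. Qed.
Lemma obs2_thP (alpha : C -> q) w : obs2 (thP alpha w (1 : U h)) = 0.
Proof. by rewrite /thP obs2_pure counit_cod scale0r. Qed.
Lemma obs1_thT theta w : right_linear theta -> obs1 (thT chi theta w 1) = 0.
Proof.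
move=> ht; rewrite (homc_sumf ht) thTD obs1D.
suff H i th : fH i th -> obs1 (thT chi th w 1) = 0 by rewrite !(H _ _ (fH_homc _ ht)) addr0.
move=> hth; rewrite (thTE _ _ _ hth) (sw_morph _ _ obs1D) swE big1 // => p _.
by rewrite obs1_pure /= /leftact counitM counit_uG mul0r rscale0r.
Qed.
Lemma obs2_thT theta w : right_linear theta -> obs2 (thT chi theta w 1) = uG (theta w).
Proof.
move=> ht; rewrite {1}(homc_sumf ht) thTD obs2D (homc_sum w ht) uGD.
suff H i th : fH i th -> obs2 (thT chi th w 1) = uG (th w) by rewrite !(H _ _ (fH_homc _ ht)).
move=> hth; rewrite (thTE _ _ _ hth) (sw_morph _ _ obs2D).
rewrite -(sw_counitl (h := fun z => uG (th z))); last by move=> x z; rewrite (fHD hth) uGD.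
apply: sw_eq => u z; rewrite obs2_pure /= /leftact mulr1 (fHl hth) uGZl counit_parn //.
Qed.

Lemma left_data1 a : left_data a (alpha1 (s:=s) a) (theta1 (s:=s) a).
Proof.
split; [exact: right_linear_alpha1|exact: right_linear_theta1|move=> w u].
by rewrite lbarE Theta1_pure /thF sconv_thP //; apply: right_linear_alpha1.
Qed.

(** If j(a) = 0, then [Theta1] of a vanishes, being the action of j(a); the alpha part of its value
    at 1 (x) 1 is the q-component of a. *)
Lemma pq_uG_eq0 a : uG a = 0 :> U g -> pq s a = 0.
Proof.
move=> e; have e0 : thE chi a = 0.
  by rewrite -rhoG e (morph0 (f := rho chi)) // => *; rewrite rhoD.
have := congr1 (fun f : aend X => obs1 (f (pureK (1 : C) (1 : U h)))) e0.
rewrite [thE _ _ _]Theta1_pure /thF obs1D obs1_thP; last exact: right_linear_alpha1.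
rewrite obs1_thT; last exact: right_linear_theta1.
by rewrite addr0 alpha1_1 => ->; rewrite /= (morph0 obs1D).
Qed.
End Data.

(* The canonical map of a symmetric pair into its enveloping algebra is injective
   on the -1 eigenspace; for l x l with the exchange of the factors this gives
   injectivity on all of l, through the projection of (x, 0). *)
Definition dbl (K : superComAlgType) (l : lieSuperType K) : Type := (l * l)%type.

Section Double.
Variables (K : superComAlgType) (l : lieSuperType K).
HB.instance Definition _ := GRing.Lmodule.copy (dbl l) (l * l)%type.
Implicit Types a b c : dbl l.
Definition dhc i a : dbl l := (hc i a.1, hc i a.2).
Fact dhcD i a b : dhc i (a + b) = dhc i a + dhc i b.
Proof. by rewrite /dhc /= !hcD. Qed.
Fact dhcK i j a : dhc i (dhc j a) = if i == j then dhc j a else 0.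
Proof. by rewrite /dhc /= !hcK; case: eqP. Qed.
Fact dhcE a : dhc false a + dhc true a = a.
Proof. by case: a => x z; rewrite /dhc /=; congr pair; exact: hcE. Qed.
HB.instance Definition _ := isGraded.Build (dbl l) dhcD dhcK dhcE.
Lemma dbl_homog i a : homog i a <-> homog i a.1 /\ homog i a.2.
Proof.
split; first by case: a => x z [] e1 e2.
by case: a => x z [] /= e1 e2; rewrite /homog /hc /= /dhc /= e1 e2.
Qed.
Fact dbl_homogZ i j (k : K) a : hc i k = k -> hc j a = a -> hc (i (+) j) (k *: a) = k *: a.
Proof.
move=> hk /dbl_homog [h1 h2]; apply/dbl_homog; split; exact: homogZ.
Qed.
HB.instance Definition _ := isSuperMod.Build K (dbl l) dbl_homogZ.
Lemma dbl_rscale a (k : K) : a *:> k = (a.1 *:> k, a.2 *:> k) :> dbl l.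
Proof. by rewrite !rscaleE !parE. Qed.
Lemma dbl_sgn e a : sgn e a = (sgn e a.1, sgn e a.2) :> dbl l.
Proof. by case: e => //; case: a. Qed.
Definition dbr a b : dbl l := (lbr a.1 b.1, lbr a.2 b.2).
Fact dbrDl a b c : dbr (a + b) c = dbr a c + dbr b c.
Proof. by rewrite /dbr /= !lbrDl. Qed.
Fact dbrDr a b c : dbr a (b + c) = dbr a b + dbr a c.
Proof. by rewrite /dbr /= !lbrDr. Qed.
Fact dbrZl (k : K) a b : dbr (k *: a) b = k *: dbr a b.
Proof. by rewrite /dbr /= !lbrZl. Qed.
Fact dbrZr (k : K) a b : dbr a (b *:> k) = dbr a b *:> k.
Proof. by rewrite !dbl_rscale /dbr /= !lbrZr. Qed.
Fact dhomog_br i j a b : homog i a -> homog j b -> homog (i (+) j) (dbr a b).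
Proof. by move=> /dbl_homog [a1 a2] /dbl_homog [b1 b2]; apply/dbl_homog; split; apply: homog_lbr. Qed.
Fact dbr_anti i j a b : homog i a -> homog j b -> dbr a b = - sgn (i && j) (dbr b a).
Proof.
move=> /dbl_homog [a1 a2] /dbl_homog [b1 b2].
by rewrite dbl_sgn /dbr /= (lbr_anti _ _ _ _ a1 b1) (lbr_anti _ _ _ _ a2 b2).
Qed.
Fact dbr_jacobi i j a b c : homog i a -> homog j b ->
  dbr a (dbr b c) = dbr (dbr a b) c + sgn (i && j) (dbr b (dbr a c)).
Proof.
move=> /dbl_homog [a1 a2] /dbl_homog [b1 b2].
by rewrite dbl_sgn /dbr /= (lbr_jacobi _ _ _ _ _ a1 b1) (lbr_jacobi _ _ _ _ _ a2 b2).
Qed.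
HB.instance Definition _ := isLieSuper.Build K (dbl l) dbrDl dbrDr dbrZl dbrZr dhomog_br dbr_anti dbr_jacobi.

Definition dswap a : dbl l := (a.2, a.1).
Fact dswap_homog i a : homog i a -> homog i (dswap a).
Proof. by move=> /dbl_homog [a1 a2]; apply/dbl_homog. Qed.
Definition dbl_inv : involution (dbl l) :=
  @Involution K (dbl l) dswap (fun a b => erefl) (fun k a => erefl) dswap_homog
    (fun a b => erefl) (fun a => let: (x, z) := a in erefl).

Lemma uG_inj_eq0 (x : l) : uG x = 0 :> U l -> x = 0.
Proof.
pose f (x : l) : dbl l := (x, 0).
have ok : ulift_ok (fun k => uC k : U (dbl l)) (fun a : l => uG (f a) : U (dbl l)).
  apply: umap_ok.
  - by move=> a b; rewrite /f; congr pair; rewrite addr0.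
  - by move=> k a; rewrite /f; congr pair; rewrite scaler0.
  - by move=> a k; rewrite dbl_rscale /f /= rscale0l.
  - by move=> i a ha; apply/dbl_homog; split => //; apply: homog0.
  - by move=> a b; rewrite /f; congr pair; rewrite /= lbr0l.
move=> e; have e2 : uG (f x) = 0 :> U (dbl l).
  by rewrite -(uliftG ok) e; apply: (morph0 (uliftD ok)).
(* The -1 component of (x, 0) under the exchange is (x/2, -x/2). *)
have := pq_uG_eq0 dbl_inv e2 => /(congr1 val) /= /(congr1 fst) /= e3.
by move: e3; rewrite oppr0 addr0 => e3; rewrite -(halfD x) scalerDr e3 addr0.
Qed.
End Double.

Theorem theorem4p5 (K : superComAlgType) (g : lieSuperType K) (s : involution g)
    (V : superModType K) (chi : lie_rep (eig s false) V) :
  (forall a : g, lbar_chi chi a =1 Theta1 chi a) /\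
  (forall (a : g) (alpha : SymAlg (eig s true) -> eig s true)
      (theta : SymAlg (eig s true) -> eig s false),
    left_data a alpha theta <-> (alpha =1 alpha1 a /\ theta =1 theta1 a)).
Proof.
split; first exact: lbar_chiE.
move=> a alpha theta; split=> [[ha ht e]|[/funext -> /funext ->]]; last exact: left_data1.
(* The values at u = 1 suffice, since [obs1] and [obs2] recover the data from them. *)
have E w : thP alpha w (1 : U (eig s false)) + thT (leftrep (eig s false)) theta w 1 =
    thF (leftrep (eig s false)) a w 1.
  by rewrite -Theta1_pure -lbarE e sconv_thP.
have r1 := right_linear_alpha1 s a; have r2 := right_linear_theta1 s a.
split=> w.
  have := congr1 (@obs1 K g s) (E w); rewrite /thF !obs1D.
  by rewrite !obs1_thP // !obs1_thT // !addr0.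
have := congr1 (@obs2 K g s) (E w); rewrite /thF !obs2D !obs2_thP !add0r !obs2_thT // => eG.
(* So far only the images of the values of theta in U(h) have been compared; the injectivity of h ->
   U(h) lifts the equality to h. *)
apply/eqP; rewrite -subr_eq0; apply/eqP; apply: uG_inj_eq0.
rewrite uGD eG (morphN (f := @uG K _) _ (@uGD K _)) subrr //.
Qed.
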